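(* (Differentiating the Integral) Let $U\subseteq\mathbb R^n$ be open, $V\in\mathcal V(U)$, and let $J_t=V_{t*}J_0\in{}'\mathcal B_k(U)$ $(0\le t<t_0)$ be an evolving differential $k$-chain under the flow of $V$, where $J_0\in{}'\mathcal B_k(U)$ has compact support in $U$. Let $\{\omega_t\}$ be a one-parameter family in $\mathcal B_k(U)$ which is differentiable in time. Then $$\frac{\partial}{\partial t}\int_{J_t}\omega_t=\int_{J_t}\Big(\frac{\partial}{\partial t}\omega_t+L_V\omega_t\Big).$$
   Context: Chains and forms in an open set $U\subseteq\mathbb R^n$. Fix the standard inner product on $\mathbb R^n$, extended to $k$-vectors by $\langle u_1\wedge\dots\wedge u_k,v_1\wedge\dots\wedge v_k\rangle=\det(\langle u_i,v_j\rangle)$. A simple $k$-vector has mass $\|\alpha\|=\sqrt{\langle\alpha,\alpha\rangle}$; a general one has mass $\|\alpha\|=\inf\{\sum\|\alpha_j\|:\alpha=\sum\alpha_j,\ \alpha_j \text{ simple}\}$. $\mathcal A_k(U)$ is the space of Dirac $k$-chains in $U$: finite formal sums $\sum(p_i;\alpha_i)$, $p_i\in U$, $\alpha_i\in\Lambda_k(\mathbb R^n)$. With $T_u(p;\alpha)=(p+u;\alpha)$ and $\sigma=u_1\circ\dots\circ u_j$ a symmetric product of vectors, put $\|\sigma\|=\|u_1\|\cdots\|u_j\|$ and $\Delta_{\sigma}(p;\alpha)=(T_{u_1}-I)\cdots(T_{u_j}-I)(p;\alpha)$ (for $j=0$: $(p;\alpha)$, $\|\sigma\|=1$); this has order $j$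 and is inside $U$ if the convex hull of its support is contained in $U$. $\|A\|_{B^{r,U}}=\inf\{\sum_i\|\sigma_i\|\|\alpha_i\|: A=\sum_i\Delta_{\sigma_i}(p_i;\alpha_i)$ (finite sum), all terms inside $U$, orders $\le r\}$; $\hat{\mathcal B}_k^r(U)$ is the completion of $\mathcal A_k(U)$; ${}'\mathcal B_k(U)=\varinjlim_r\hat{\mathcal B}_k^r(U)$ (locally convex inductive limit, linking maps induced by the identity). A $k$-form on $U$ is a linear functional $\omega$ on $\mathcal A_k(U)$; $\|\omega\|_{B^{r,U}}=\max_{0\le j\le r}\sup\{|\omega(\Delta_\sigma(p;\alpha))|:\sigma\text{ of order }j,\ \Delta_\sigma(p;\alpha)\text{ inside }U,\ \|\sigma\|\|\alpha\|=1\}$; $\mathcal B_k(U)$ is the Fréchet space of forms with all these norms finite (smooth $k$-forms on $U$ with all derivatives bounded). $\int_J\omega=\lim\omega(A_i)$, where $A_i\in\mathcal A_k(U)$ converge to a representative of $J$ in some $\hat{\mathcal B}_k^r(U)$. A family $\omega_t$ is differentiable in time if $\frac{\partial}{\partial t}\omega_t=\lim_{h\to0}(\omega_{t+h}-\omega_t)/h$ exists in $\mathcal B_k(U)$. Support: $K\in{}'\mathcal B_k(\mathbb R^n)$ is accessible in $X$ if for every open $W\supseteq X$ there are Dirac chains supported in $W$ converging to $K$; $\mathrm{supp}(K)$ is the smallest closed set in which $K$ is accessible. The support of $J\in{}'\mathcal B_k(U)$ is that of its image in ${}'\mathcal B_k(\mathbb R^n)$; $J$ has compact support in $U$ if this is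 a compact subset of $U$. $\mathcal V(U)$: bounded smooth maps $V:U\to\mathbb R^n$ all of whose partial derivatives are bounded on $U$. $V_t$ is the time-$t$ map of the flow of $V$; $t_0>0$ is such that $V_t$ is defined with values in $U$ on a neighborhood $N$ of $\mathrm{supp}\,J_0$ for $0\le t<t_0$. The pushforward $V_{t*}J_0\in{}'\mathcal B_k(U)$ (given on Dirac chains by $(p;\alpha)\mapsto(V_t(p);D(V_t)_p\alpha)$) is the unique chain with $\int_{V_{t*}J_0}\omega=\int_{J_0}g\,V_t^*\omega$ for all $\omega\in\mathcal B_k(U)$, where $g\in C_c^\infty(N)$ equals $1$ near $\mathrm{supp}\,J_0$ and $gV_t^*\omega$ is extended by $0$. $L_V=i_Vd+d\,i_V$ is the Lie derivative. *)

(* Defs.v *)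
From HB Require Import structures.
From mathcomp Require Import all_boot all_order all_algebra.
From mathcomp Require Import ring_quotient.
From mathcomp Require Import all_classical all_reals all_analysis.
Set Implicit Arguments.
Unset Strict Implicit.
Unset Printing Implicit Defensive.
Import Order.TTheory GRing.Theory Num.Theory.
Import numFieldNormedType.Exports.
Local Open Scope classical_set_scope.
Local Open Scope ring_scope.

Section KVectors.
Variables (R : realType) (n : nat).

Definition dotv (u v : 'rV[R]_n) : R := \sum_j u 0 j * v 0 j.

(* The library norm on ['rV[R]_n] is the max norm; this is the Euclidean one. *)
Definition enorm (u : 'rV[R]_n) : R := Num.sqrt (dotv u u).

Definition increasing k (J : {ffun 'I_k -> 'I_n}) : bool :=
  [forall i : 'I_k, forall j : 'I_k, (i < j)%N ==> (J i < J j)%N].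

Definition multi_index k := {J : {ffun 'I_k -> 'I_n} | increasing J}.

(* [a J] is the coefficient of [a] on [e_(J 0) /\ ... /\ e_(J k.-1)]. *)
Definition kvec k := {ffun multi_index k -> R^o}.

Definition wedge k (u : 'I_k -> 'rV[R]_n) : kvec k :=
  [ffun J : multi_index k => \det (\matrix_(i, j) u i 0 (val J j))].

Definition gram k (u : 'I_k -> 'rV[R]_n) : 'M[R]_k :=
  \matrix_(i, j) dotv (u i) (u j).

(* A simple k-vector is written [c *: wedge u]; its norm
   [sqrt <c *: wedge u, c *: wedge u>] is then [`|c| * sqrt (\det (gram u))].
   The scalar [c] only matters for [k = 0], where the empty wedge is [1]. *)
Definition mass_set k (a : kvec k) : set R :=
  [set x | exists s : seq (R * ('I_k -> 'rV[R]_n)),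
    a = \sum_(c <- s) c.1 *: wedge c.2 /\
    x = \sum_(c <- s) `|c.1| * Num.sqrt (\det (gram c.2))].

Definition mass k (a : kvec k) : R := inf (mass_set a).

Definition vbase (j : 'I_n) : 'rV[R]_n := delta_mx 0 j.

Definition vcons k (v : 'rV[R]_n) (u : 'I_k -> 'rV[R]_n) (i : 'I_k.+1) :=
  oapp u v (unlift ord0 i).

End KVectors.

Section DiracChains.
Variables (R : realType) (n k : nat) (U : set 'rV[R]_n).
Local Notation E := 'rV[R]_n.
Local Notation L := (kvec R n k).

Definition chain_support (A : E -> L) : set E := [set p | A p != 0].

Definition dirac_pred : pred (E -> L) :=
  fun A => `[< finite_set (chain_support A) /\ chain_support A `<=` U >].

Lemma dirac_submod_closed : submod_closed dirac_pred.
Proof.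
split.
  apply/asboolP; have -> : chain_support (0 : E -> L) = set0.
    by apply/seteqP; split => p //=; rewrite /chain_support /= eqxx.
  by split.
move=> c A B /asboolP[fA sA] /asboolP[fB sB]; apply/asboolP.
have sub : chain_support (c *: A + B) `<=` chain_support A `|` chain_support B.
  move=> p /= nz; rewrite /chain_support /=.
  have [A0|] := eqVneq (A p) 0; last by left.
  right; apply: contra_neq nz => B0.
  have -> : (c *: A + B) p = c *: A p + B p by [].
  by rewrite A0 B0 scaler0 addr0.
split; first by apply: sub_finite_set sub _; rewrite finite_setU.
by move=> p /sub [/sA|/sB].
Qed.

HB.instance Definition _ :=
  GRing.isSubmodClosed.Build R (E -> L) dirac_pred dirac_submod_closed.

(* The formal sum [\sum_i (p_i; a_i)] is the finitely supported function
   [p |-> \sum_(i | p_i = p) a_i]. *)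
Record dirac := Dirac { dirac_val :> E -> L; _ : dirac_pred dirac_val }.

HB.instance Definition _ := [isSub for dirac_val].
HB.instance Definition _ := [Choice of dirac by <:].
HB.instance Definition _ := [SubChoice_isSubLmodule of dirac by <:].

End DiracChains.
Arguments dirac {R n} k U.

Section Differences.
Variables (R : realType) (n k : nat).
Local Notation E := 'rV[R]_n.
Local Notation L := (kvec R n k).

Definition simplep (p : E) (a : L) : E -> L := fun q => if q == p then a else 0.

Definition translate (u : E) (A : E -> L) : E -> L := fun q => A (q - u).

Definition Delta (sigma : seq E) (p : E) (a : L) : E -> L :=
  foldr (fun u A => translate u A - A) (simplep p a) sigma.

Definition snorm (sigma : seq E) : R := \prod_(u <- sigma) enorm u.

Definition convex_hull (X : set E) : set E := smallest (@convex_set R E) X.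

Definition inside (U : set E) (A : E -> L) : Prop :=
  convex_hull (chain_support A) `<=` U.

End Differences.

Section BNorm.
Variables (R : realType) (n k : nat) (U : set 'rV[R]_n).
Local Notation E := 'rV[R]_n.
Local Notation L := (kvec R n k).

Definition bnorm_set (r : nat) (A : dirac k U) : set R :=
  [set x | exists s : seq (seq E * E * L),
    [/\ forall c, c \in s ->
          (size c.1.1 <= r)%N /\ inside U (Delta c.1.1 c.1.2 c.2),
        (A : E -> L) = \sum_(c <- s) Delta c.1.1 c.1.2 c.2 &
        x = \sum_(c <- s) snorm c.1.1 * mass c.2]].

Definition bnorm (r : nat) (A : dirac k U) : R := inf (bnorm_set r A).

Lemma mass_set_ge0 (a : L) x : mass_set a x -> 0 <= x.
Proof.
by case=> s [_ ->]; apply: sumr_ge0 => c _; rewrite mulr_ge0 ?sqrtr_ge0.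
Qed.

Lemma mass_ge0 (a : L) : 0 <= mass a.
Proof.
rewrite /mass; have [->|S0] := eqVneq (mass_set a) set0; first by rewrite inf0.
by apply: lb_le_inf; [exact/set0P | move=> x; exact: mass_set_ge0].
Qed.

Lemma mass_setZ (c : R) (a : L) x :
  mass_set a x -> mass_set (c *: a) (`|c| * x).
Proof.
case=> s [-> ->]; exists [seq (c * b.1, b.2) | b <- s]; rewrite !big_map /=.
split; first by rewrite scaler_sumr; apply: eq_bigr => b _; rewrite scalerA.
by rewrite mulr_sumr; apply: eq_bigr => b _; rewrite normrM mulrA.
Qed.

Lemma mass_set_lb (a : L) : has_lbound (mass_set a).
Proof. by exists 0 => x; exact: mass_set_ge0. Qed.

Lemma massZ_le (c : R) (a : L) : mass (c *: a) <= `|c| * mass a.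
Proof.
have [->|c0] := eqVneq c 0.
  rewrite scale0r normr0 mul0r; apply: ge_inf; first exact: mass_set_lb.
  by exists [::]; rewrite !big_nil.
have [S0|S0] := eqVneq (mass_set a) set0.
  suff c0E : mass_set (c *: a) = set0.
    by rewrite {1}/mass c0E inf0 mulr_ge0 ?mass_ge0.
  apply/seteqP; split => x // cx.
  by have := mass_setZ c^-1 cx; rewrite scalerA mulVf // scale1r S0.
rewrite -ler_pdivrMl ?normr_gt0 //; apply: lb_le_inf; first exact/set0P.
move=> x ax; rewrite ler_pdivrMl ?normr_gt0 //.
by apply: ge_inf; [exact: mass_set_lb | exact: mass_setZ].
Qed.

Lemma snorm_ge0 (sigma : seq E) : 0 <= snorm sigma.
Proof. by apply: prodr_ge0 => u _; exact: sqrtr_ge0. Qed.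

Lemma DeltaZ (c : R) sigma (p : E) (a : L) :
  Delta sigma p (c *: a) = c *: Delta sigma p a.
Proof.
elim: sigma => [|u s IH] /=; last by rewrite IH scalerBr.
apply/funext => q.
have -> : (c *: simplep p a) q = c *: simplep p a q by [].
by rewrite /simplep; case: ifP => // _; rewrite scaler0.
Qed.

Lemma convex_hullS (X Y : set E) : X `<=` Y -> convex_hull X `<=` convex_hull Y.
Proof.
move=> XY p hp Z [cZ YZ]; apply: hp; split => //.
exact: subset_trans YZ.
Qed.

Lemma insideZ (c : R) (A : E -> L) : inside U A -> inside U (c *: A).
Proof.
move=> iA p hp; apply: iA; move: p hp; apply: convex_hullS => q /=.
rewrite /chain_support /=; apply: contra_neq => A0.
have -> : (c *: A) q = c *: A q by [].
by rewrite A0 scaler0.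
Qed.

Lemma bnorm_set_ge0 r (A : dirac k U) x : bnorm_set r A x -> 0 <= x.
Proof.
case=> s [_ _ ->]; apply: sumr_ge0 => c _.
by rewrite mulr_ge0 ?snorm_ge0 ?mass_ge0.
Qed.

Lemma bnorm_set_lb r (A : dirac k U) : has_lbound (bnorm_set r A).
Proof. by exists 0 => x; exact: bnorm_set_ge0. Qed.

Lemma bnorm_set_le r r' (A : dirac k U) :
  (r <= r')%N -> bnorm_set r A `<=` bnorm_set r' A.
Proof.
move=> rr' x [s [H ? ?]]; exists s; split => // c /H[sr ?]; split => //.
exact: leq_trans rr'.
Qed.

Lemma bnorm_set_neq0 r (A : dirac k U) : bnorm_set r A !=set0.
Proof.
have /asboolP[/finite_seqP[P0 PE] sA] := valP A.
pose P := undup P0.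
have PP q : (q \in P) = (A q != 0).
  rewrite mem_undup; apply/idP/idP => [qP|qA].
    by have : chain_support A q; [rewrite [chain_support _]PE|].
  by have : chain_support A q by []; rewrite [chain_support _]PE.
pose s := [seq ([::], p, A p) | p <- P] : seq (seq E * E * L).
exists (\sum_(c <- s) snorm c.1.1 * mass c.2); exists s; split => //.
  move=> _ /mapP[p pP ->] /=; split => //.
  have pA : chain_support A p by rewrite /chain_support /= -PP.
  move=> q hq; apply: sA.
  suff : [set p] q by move=> ->.
  apply: (hq [set p]); split.
    move=> x y l; rewrite !inE => -> ->.
    by rewrite convmm.
  move=> z; rewrite /chain_support /= /simplep; case: ifP => [/eqP //|_].
  by rewrite eqxx.
apply/funext => q; rewrite fct_sumE big_map /=.
have [qP|qP] := boolP (q \in P).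
  rewrite (bigD1_seq q) ?undup_uniq //= /simplep eqxx big1 ?addr0 // => p.
  by rewrite eq_sym => /negPf ->.
rewrite big_seq big1 => [|p pP]; last first.
  by rewrite /simplep; case: ifP => // /eqP qp; rewrite qp pP in qP.
by move: qP; rewrite PP negbK => /eqP.
Qed.

Lemma bnorm_ge0 r (A : dirac k U) : 0 <= bnorm r A.
Proof.
by apply: lb_le_inf; [exact: bnorm_set_neq0 | move=> x; exact: bnorm_set_ge0].
Qed.

Lemma bnorm_le r r' (A : dirac k U) : (r <= r')%N -> bnorm r' A <= bnorm r A.
Proof.
move=> rr'; apply: lb_le_inf; first exact: bnorm_set_neq0.
by move=> x /(bnorm_set_le rr'); apply: ge_inf; exact: bnorm_set_lb.
Qed.

Lemma bnormZ_le r (c : R) (A : dirac k U) : bnorm r (c *: A) <= `|c| * bnorm r A.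
Proof.
have key x : bnorm_set r A x -> bnorm r (c *: A) <= `|c| * x.
  case=> s [H AE ->].
  pose s' := [seq (b.1, c *: b.2) | b <- s] : seq (seq E * E * L).
  apply: (@le_trans _ _ (\sum_(b <- s') snorm b.1.1 * mass b.2)).
    apply: ge_inf; first exact: bnorm_set_lb.
    exists s'; split => //.
      move=> _ /mapP[b /H[sr ib] ->] /=; split => //.
      by rewrite DeltaZ; exact: insideZ.
    transitivity (c *: (A : E -> L)); first by [].
    by rewrite big_map AE scaler_sumr; apply: eq_bigr => b _; rewrite DeltaZ.
  rewrite big_map mulr_sumr; apply: ler_sum => b _ /=.
  by rewrite mulrCA ler_wpM2l ?snorm_ge0 ?massZ_le.
have [c0|c0] := eqVneq c 0.
  have [x /key] := bnorm_set_neq0 r A.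
  by rewrite c0 normr0 !mul0r.
rewrite -ler_pdivrMl ?normr_gt0 //; apply: lb_le_inf.
  exact: bnorm_set_neq0.
by move=> x /key; rewrite ler_pdivrMl ?normr_gt0.
Qed.

Lemma bnormD_le r (A B : dirac k U) : bnorm r (A + B) <= bnorm r A + bnorm r B.
Proof.
rewrite -lerBlDr; apply: lb_le_inf; first exact: bnorm_set_neq0.
move=> x [s [Hs sE ->]].
rewrite lerBlDr -lerBlDl; apply: lb_le_inf; first exact: bnorm_set_neq0.
move=> y [t [Ht tE ->]].
rewrite lerBlDl -big_cat; apply: ge_inf; first exact: bnorm_set_lb.
exists (s ++ t); split => //.
  by move=> c; rewrite mem_cat => /orP[/Hs|/Ht].
by rewrite big_cat /= -sE -tE.
Qed.

Lemma bnorm0 r : bnorm r 0 = 0.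
Proof.
by apply/eqP; rewrite eq_le bnorm_ge0 andbT -(scale0r 0)
  (le_trans (bnormZ_le _ _ _)) // normr0 mul0r.
Qed.

End BNorm.

Section DChains.
Variables (R : realType) (n k : nat) (U : set 'rV[R]_n).

Definition cauchy_bnorm (r : nat) (A : nat -> dirac k U) : Prop :=
  forall e : R, 0 < e -> exists N, forall i j,
    (N <= i)%N -> (N <= j)%N -> bnorm r (A i - A j) < e.

Definition cauchy_pred : pred (nat -> dirac k U) :=
  fun A => `[< exists r, cauchy_bnorm r A >].

Lemma cauchy_bnorm_le r r' A :
  (r <= r')%N -> cauchy_bnorm r A -> cauchy_bnorm r' A.
Proof.
move=> rr' cA e /cA[N HN]; exists N => i j Ni Nj.
by apply: le_lt_trans (HN i j Ni Nj); exact: bnorm_le.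
Qed.

Lemma cauchy_submod_closed : submod_closed cauchy_pred.
Proof.
split.
  apply/asboolP; exists 0%N => e e0; exists 0%N => i j _ _.
  have -> : (0 : nat -> dirac k U) i - (0 : nat -> dirac k U) j = 0.
    by rewrite subrr.
  by rewrite bnorm0.
move=> c A B /asboolP[r cA] /asboolP[s cB]; apply/asboolP.
have {}cA := cauchy_bnorm_le (leq_maxl r s) cA.
have {}cB := cauchy_bnorm_le (leq_maxr r s) cB.
exists (maxn r s) => e e0.
have c1 : 0 < 2 * (`|c| + 1) by rewrite mulr_gt0 // ltr_wpDl.
have [N HN] := cA _ (divr_gt0 e0 c1).
have [M HM] := cB _ (divr_gt0 e0 (ltr0n _ 2)).
exists (maxn N M) => i j; rewrite !geq_max => /andP[Ni Mi] /andP[Nj Mj].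
have -> : (c *: A + B) i - (c *: A + B) j = c *: (A i - A j) + (B i - B j).
  have E l : (c *: A + B) l = c *: A l + B l by [].
  by rewrite !E scalerBr opprD addrACA.
apply: le_lt_trans (bnormD_le _ _ _) _; rewrite [e]splitr.
apply: ler_ltD (HM i j Mi Mj).
apply: le_trans (bnormZ_le _ _ _) _.
apply: le_trans (ler_wpM2l (normr_ge0 c) (ltW (HN i j Ni Nj))) _.
rewrite invfM [e * _]mulrA mulrCA ler_piMr ?divr_ge0 ?ltW //.
by rewrite ltr_pdivrMr ?ltr_wpDl // mul1r ltrDl.
Qed.

HB.instance Definition _ := GRing.isSubmodClosed.Build R (nat -> dirac k U)
  cauchy_pred cauchy_submod_closed.

Record cauchy_seq :=
  CauchySeq { cauchy_val :> nat -> dirac k U; _ : cauchy_pred cauchy_val }.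

HB.instance Definition _ := [isSub for cauchy_val].
HB.instance Definition _ := [Choice of cauchy_seq by <:].
HB.instance Definition _ := [SubChoice_isSubLmodule of cauchy_seq by <:].

Definition null_bnorm (r : nat) (A : nat -> dirac k U) : Prop :=
  bnorm r (A i) @[i --> \oo] --> (0 : R).

Definition null_pred : pred cauchy_seq :=
  fun A => `[< exists r, null_bnorm r A >].

Lemma null_bnorm_le r r' A :
  (r <= r')%N -> null_bnorm r A -> null_bnorm r' A.
Proof.
move=> rr' nA; apply: (@squeeze_cvgr _ _ _ _ (cst 0) (fun i => bnorm r (A i))).
- by apply: nearW => i; rewrite bnorm_ge0 /= bnorm_le.
- exact: cvg_cst.
- exact: nA.
Qed.

Lemma null_submod_closed : submod_closed null_pred.
Proof.
split.
  apply/asboolP; exists 0%N; rewrite /null_bnorm.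
  have -> : (fun i => bnorm 0 ((0 : cauchy_seq) i)) = cst 0.
    by apply/funext => i; rewrite -(bnorm0 k U 0).
  exact: cvg_cst.
move=> c A B /asboolP[r nA] /asboolP[s nB]; apply/asboolP.
have {}nA := null_bnorm_le (leq_maxl r s) nA.
have {}nB := null_bnorm_le (leq_maxr r s) nB.
exists (maxn r s).
apply: (@squeeze_cvgr _ _ _ _ (cst 0)
  (fun i => `|c| * bnorm (maxn r s) (A i) + bnorm (maxn r s) (B i))).
- apply: nearW => i; rewrite bnorm_ge0 /=.
  by apply: le_trans (bnormD_le _ _ _) _; rewrite lerD2r bnormZ_le.
- exact: cvg_cst.
- rewrite -[X in _ --> X](addr0 0) -[X in _ --> X + _](mulr0 `|c|).
  by apply: cvgD nB; apply: cvgMr nA.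
Qed.

HB.instance Definition _ := GRing.isSubmodClosed.Build R cauchy_seq
  null_pred null_submod_closed.

Definition null_closed : zmodClosed cauchy_seq :=
  GRing.ZmodClosed.clone cauchy_seq null_pred _.

(* For each [r] the completion for [bnorm r] is {Cauchy sequences for bnorm r}
   modulo {null sequences for bnorm r}. The linking maps are induced by the
   identity, so the direct limit over [r] is the quotient of the union over [r]
   of the numerators by the union over [r] of the denominators. *)
Definition dchain : Type :=
  @Quotient.quot cauchy_seq null_closed.

HB.instance Definition _ := GRing.Zmodule.on dchain.
HB.instance Definition _ := EqQuotient.on dchain.

Local Open Scope quotient_scope.

Definition dclass (A : cauchy_seq) : dchain := \pi_dchain A.

Lemma dclass_eq A B : dclass A = dclass B <-> A - B \in null_pred.
Proof.
rewrite (Quotient.idealrBE null_closed).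
by split => [AB|/eqP //]; apply/eqP.
Qed.

Lemma dclassD A B : dclass (A + B) = dclass A + dclass B.
Proof. exact: raddfD. Qed.

Definition dscale (c : R) (J : dchain) : dchain := dclass (c *: repr J).

Lemma dscaleE c A : dscale c (dclass A) = dclass (c *: A).
Proof.
apply/dclass_eq; rewrite -scalerBr rpredZ //.
by apply/dclass_eq; rewrite /dclass reprK.
Qed.

Lemma dclassP (J : dchain) : exists A, J = dclass A.
Proof. by exists (repr J); rewrite /dclass reprK. Qed.

Lemma dscaleA a b J : dscale a (dscale b J) = dscale (a * b) J.
Proof. by have [A ->] := dclassP J; rewrite !dscaleE scalerA. Qed.

Lemma dscale1 : left_id 1 dscale.
Proof. by move=> J; have [A ->] := dclassP J; rewrite dscaleE scale1r. Qed.

Lemma dscaleDr : right_distributive dscale +%R.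
Proof.
move=> c J K; have [A ->] := dclassP J; have [B ->] := dclassP K.
by rewrite -dclassD !dscaleE scalerDr dclassD.
Qed.

Lemma dscaleDl J : {morph dscale^~ J : a b / a + b}.
Proof.
by move=> a b; have [A ->] := dclassP J; rewrite !dscaleE scalerDl dclassD.
Qed.

HB.instance Definition _ := GRing.Zmodule_isLmodule.Build R dchain
  dscaleA dscale1 dscaleDr dscaleDl.

Lemma cst_cauchy (A : dirac k U) : cauchy_pred (fun=> A).
Proof.
apply/asboolP; exists 0%N => e e0; exists 0%N => i j _ _.
by rewrite subrr bnorm0.
Qed.

Definition dchain_of_dirac (A : dirac k U) : dchain :=
  dclass (CauchySeq (cst_cauchy A)).

(* Image of the open ball of radius [e] of the completion for [bnorm r]. *)
Definition bball (r : nat) (e : R) : set dchain :=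
  [set J | exists A : cauchy_seq,
    [/\ J = dclass A, cauchy_bnorm r A & lim (bnorm r (A i) @[i --> \oo]) < e]].

Definition absolutely_convex (D : set dchain) : Prop :=
  forall (a b : R) (J K : dchain), `|a| + `|b| <= 1 ->
    D J -> D K -> D (a *: J + b *: K).

(* Neighbourhoods of 0 for the locally convex inductive limit topology, the
   finest locally convex one for which all canonical maps from the completions
   are continuous. *)
Definition dchain_nbhs0 (D : set dchain) : Prop :=
  exists C, [/\ C `<=` D, absolutely_convex C &
    forall r, exists2 e, 0 < e & bball r e `<=` C].

Definition dchain_cvg (K : nat -> dchain) (J : dchain) : Prop :=
  forall D, dchain_nbhs0 D -> exists N, forall i, (N <= i)%N -> D (K i - J).

End DChains.
Arguments dchain {R n} k U.

Section Inclusion.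
Variables (R : realType) (n k : nat) (U : set 'rV[R]_n).
Local Notation E := 'rV[R]_n.
Local Notation L := (kvec R n k).

Lemma dirac_incl_subproof (A : dirac k U) : dirac_pred [set: E] (A : E -> L).
Proof. by have /asboolP[fA _] := valP A; apply/asboolP; split. Qed.

Definition dirac_incl (A : dirac k U) : dirac k [set: E] :=
  Dirac (dirac_incl_subproof A).

Lemma bnorm_incl r (A B : dirac k U) :
  bnorm r (dirac_incl A - dirac_incl B) <= bnorm r (A - B).
Proof.
apply: lb_le_inf; first exact: bnorm_set_neq0.
move=> x [s [Hs sE xE]]; apply: ge_inf; first exact: bnorm_set_lb.
by exists s; split => // c /Hs[].
Qed.

Lemma cauchy_incl_subproof (A : cauchy_seq k U) :
  cauchy_pred (fun i => dirac_incl (A i)).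
Proof.
have /asboolP[r cA] := valP A; apply/asboolP; exists r => e /cA[N HN].
by exists N => i j Ni Nj; apply: le_lt_trans (HN i j Ni Nj); exact: bnorm_incl.
Qed.

Definition dchain_incl (J : dchain k U) : dchain k [set: E] :=
  dclass (CauchySeq (cauchy_incl_subproof (repr J))).

Definition accessible (K : dchain k [set: E]) (X : set E) : Prop :=
  forall W : set E, open W -> X `<=` W ->
    exists2 A : nat -> dirac k [set: E],
      (forall i, chain_support (A i) `<=` W) &
      dchain_cvg (fun i => dchain_of_dirac (A i)) K.

(* [smallest _ set0] is the intersection of all such [X]. *)
Definition dsupp (J : dchain k U) : set E :=
  smallest (fun X => closed X /\ accessible (dchain_incl J) X) set0.

End Inclusion.

Section Forms.
Variables (R : realType) (n : nat) (U : set 'rV[R]_n).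
Local Notation E := 'rV[R]_n.

Definition kform k := {scalar (dirac k U)}.

Definition form_norm k (w : dirac k U -> R) (r : nat) : \bar R :=
  \big[maxe/0%E]_(j < r.+1) ereal_sup [set x : \bar R |
    exists (sigma : seq E) (p : E) (a : kvec R n k) (A : dirac k U),
      [/\ size sigma = j, inside U (Delta sigma p a),
          snorm sigma * mass a = 1,
          (A : E -> kvec R n k) = Delta sigma p a & x = `|w A|%:E]].

Definition Bform k (w : kform k) : Prop := forall r, (form_norm w r < +oo)%E.

Definition dintegral k (J : dchain k U) (w : kform k) : R :=
  lim (w ((repr J : cauchy_seq k U) i) @[i --> \oo]).

Lemma dpoint_subproof k (p : E) (a : kvec R n k) :
  dirac_pred U (simplep p (if `[< U p >] then a else 0)).
Proof.
apply/asboolP; split.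
  apply: (@sub_finite_set _ _ [set p]) (finite_set1 p) => q.
  by rewrite /chain_support /= /simplep; case: ifP => [/eqP//|]; rewrite eqxx.
move=> q; rewrite /chain_support /= /simplep; case: ifP => [/eqP ->|].
  by case: asboolP => //; rewrite eqxx.
by rewrite eqxx.
Qed.

(* The chain [(p; a)] for [p] in [U], and 0 otherwise. *)
Definition dpoint k (p : E) (a : kvec R n k) : dirac k U :=
  Dirac (dpoint_subproof p a).

(* The form with coefficient [c p J] on [(p; e_(J 0) /\ ... /\ e_(J k.-1))]. *)
Definition form_eval k (c : E -> multi_index n k -> R) (A : dirac k U) : R :=
  \sum_(p \in chain_support A) \sum_J c p J * A p J.

Lemma form_eval_linear k c : scalar (@form_eval k c).
Proof.
have wide (A : dirac k U) D : chain_support A `<=` D ->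
    form_eval c A = \sum_(p \in D) \sum_J c p J * A p J.
  move=> AD; apply: fsbig_widen => // p [_ /= /negP/negPn/eqP A0].
  by rewrite big1 // => J _; rewrite A0 ffunE mulr0.
move=> a A B.
have /asboolP[fA _] := valP A; have /asboolP[fB _] := valP B.
pose D := chain_support A `|` chain_support B.
have fD : finite_set D by rewrite finite_setU.
rewrite (wide A D); last by move=> p; left.
rewrite (wide B D); last by move=> p; right.
rewrite (wide (a *: A + B) D); last first.
  move=> p nz; have [A0|] := eqVneq (A p) 0; last by left.
  right; apply: contra_neq nz => B0.
  have -> : (a *: A + B) p = a *: A p + B p by [].
  by rewrite A0 B0 scaler0 addr0.
rewrite mulr_fsumr -fsbig_split //; apply: eq_fsbigr => p _.
rewrite mulr_sumr -big_split; apply: eq_bigr => J _ /=.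
rewrite mulrCA -mulrDr; congr (_ * _).
transitivity ((a *: A p + B p) J); first by [].
by rewrite !ffunE.
Qed.

HB.instance Definition _ k c :=
  GRing.isLinear.Build R (dirac k U) R *%R (@form_eval k c)
    (@form_eval_linear k c).

Definition form_of k (c : E -> multi_index n k -> R) : kform k :=
  [the {scalar (dirac k U)} of form_eval c].

(* [i_V w (p; a) = w (p; V p /\ a)]; [vcons v u] is the family [v, u 0, u 1, ...] *)
Definition interior_prod k (V : E -> E) (w : kform k.+1) : kform k :=
  form_of (fun p J => w (dpoint p (wedge (vcons (V p) (@vbase R n \o val J))))).

(* [d w (p; e_J) = \sum_i (-1)^i d/dx_(J i) w (p; e_J minus its i-th factor)] *)
Definition ext_deriv k (w : kform k) : kform k.+1 :=
  form_of (fun p J => \sum_(i < k.+1) (-1) ^+ i *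
    'D_(vbase R (val J i))
      (fun q => w (dpoint q (wedge (fun j => vbase R (val J (lift i j))))) : R^o)
      p).

Definition lie_deriv k (V : E -> E) : kform k -> kform k :=
  match k return kform k -> kform k with
  | 0 => fun w => interior_prod V (ext_deriv w)
  | k'.+1 => fun w => [the {scalar (dirac k'.+1 U)} of
      interior_prod V (ext_deriv w) \+ ext_deriv (interior_prod V w)]
  end.

(* [g f^* w], with [f^* w (p; u_1 /\ ... /\ u_k)
   = w (f p; Df_p u_1 /\ ... /\ Df_p u_k)]. *)
Definition cut_pullback k (g : E -> R) (f : E -> E) (w : kform k) : kform k :=
  form_of (fun p J =>
    g p * w (dpoint (f p) (wedge (fun i => 'd f p (vbase R (val J i)))))).

End Forms.

Section Calculus.
Variables (R : realType) (n : nat).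
Local Notation E := 'rV[R]_n.

Definition partials (W : normedModType R) (s : seq 'I_n) (f : E -> W) : E -> W :=
  foldr (fun j F => 'D_(vbase R j) F) f s.

Definition smooth_on (W : normedModType R) (X : set E) (f : E -> W) : Prop :=
  forall s p, X p -> {for p, continuous (partials s f)} /\
    forall j, derivable (partials s f) p (vbase R j).

Definition bounded_smooth (U : set E) (V : E -> E) : Prop :=
  smooth_on U V /\
  forall s, exists M : R, forall p, U p -> `|partials s V p| <= M.

(* [g] is in [C_c^oo(N)] and equals 1 near [S]. *)
Definition cutoff (N S : set E) (g : E -> R) : Prop :=
  [/\ smooth_on [set: E] (g : E -> R^o),
      compact (closure [set p | g p != 0]),
      closure [set p | g p != 0] `<=` N &
      exists W, [/\ open W, S `<=` W & forall p, W p -> g p = 1]].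

(* One-sided at the endpoint 0. *)
Definition has_time_deriv (W : normedModType R) (T : R) (f : R -> W) (t : R)
    (l : W) : Prop :=
  (s - t)^-1 *: (f s - f t)
    @[s --> within [set s | 0 <= s < T] t^'] --> l.

Definition is_flow (U : set E) (V : E -> E) (N : set E) (T : R)
    (phi : R -> E -> E) : Prop :=
  forall p, N p -> phi 0 p = p /\ forall t, 0 <= t < T ->
    U (phi t p) /\ has_time_deriv T (phi^~ p) t (V (phi t p)).

Definition form_has_time_deriv k (U : set E) (T : R) (w : R -> kform U k)
    (t : R) (l : kform U k) : Prop :=
  forall r, form_norm (fun A => (s - t)^-1 * (w s A - w t A) - l A) r
    @[s --> within [set s | 0 <= s < T] t^'] --> 0%E.

(* Here [g] is meant to be a cutoff for [dsupp J0] supported in a set where [f]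
   is defined, so that [cut_pullback g f w] is [g f^* w] extended by 0. *)
Definition is_pushforward k (U : set E) (g : E -> R) (f : E -> E)
    (J0 J : dchain k U) : Prop :=
  forall w : kform U k, Bform w ->
    dintegral J w = dintegral J0 (cut_pullback g f w).

End Calculus.

(* Main.v *)
From HB Require Import structures.
Require Import Defs.
From mathcomp Require Import all_boot all_order all_algebra.
From mathcomp Require Import fingroup perm.
From mathcomp Require Import all_classical all_reals all_analysis.
From mathcomp Require Import ring lra.
Set Implicit Arguments.
Unset Strict Implicit.
Unset Printing Implicit Defensive.
Import Order.TTheory GRing.Theory Num.Theory.
Import numFieldNormedType.Exports.
Local Open Scope classical_set_scope.
Local Open Scope ring_scope.

(** Write [J_s] for the pushforward of [J0] and [g phi_s^* w] for the pullback
    extended by zero. By hypothesis the integral of [w] over [J_s] is the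
    integral of [g phi_s^* w] over [J0], and [J0] is a limit of Dirac chains
    [A_i] in one of the norms [B^r]. On a Dirac chain the statement is pointwise:
    for a fixed form [w], the derivative in time of [phi_s^* w] at a point is
    [phi_s^* (L_V w)], by the chain rule along the trajectory, the equation of
    first variation for the differential of [phi_s], and Cartan's formula
    ([pullback_coef_time_derivative]). To pass to the limit it suffices that the
    [B^r] norm of [g phi_s^* w] is bounded uniformly in [s] by finitely many of
    the norms of [w] ([cut_pullback_bound]): then the functions
    [s |-> (g phi_s^* w)(A_i)] have second derivatives, the pairings with
    [L_V (L_V w)], bounded independently of [i], and their first-order Taylor
    estimates hold for the limit ([evolved_integral_taylor]). For a family of
    forms, write [w_s = w_t + (s - t) (dw_t + q_s)]; the norms of [q_s] tend to
    zero, and so do the integrals of [q_s] over [J_s], by the same bound.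

    The flow is only assumed to solve the differential equation pointwise, so
    its smoothness in space has to be proved. This is done with iterated
    differences rather than derivatives. A difference of order [m] of [phi_s]
    satisfies a differential equation whose right-hand side is linear in the
    differences of order [m], up to an error controlled by lower orders
    ([chain_top]); Gronwall's inequality bounds all the differences uniformly in
    [s] ([flow_diff_bounded]). Functions with bounded differences are
    differentiable, because bounds on second differences make the difference
    quotients converge ([deriv_bounded_of_diff]). The same fact shows that forms
    with finite norms have smooth coefficients with bounded derivatives; the
    converse is the mean value theorem ([deriv_bounded_convex]). The equation of
    first variation ([flow_variation]) follows from the Taylor estimates in time
    of the difference quotients in space.

    On the algebraic side, every minor of a family of vectors, seen as a function
    of the family, is a combination of the coefficients of its exterior product
    ([colminor_expand]). This gives the Cauchy-Binet formula, hence the comparison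
    of coefficients with the mass ([coef_le_mass]), the exterior derivative on
    arbitrary simple k-vectors ([ext_deriv_wedge]), and the linearity in the
    k-vector that reduces Cartan's formula to basis k-vectors
    ([derivation_expand]). Norms of forms only involve differences whose convex
    hull of support is inside [U]; cancellations do not shrink this hull
    ([convex_supp_translate]), so it contains all the vertices of the
    difference. *)

(** * Minors and the mass of k-vectors *)

(** Sort the values of [m]. *)
Lemma sorted_factor n k (m : 'I_k -> 'I_n) : injective m ->
  exists J : {ffun 'I_k -> 'I_n}, exists s : 'S_k,
    increasing J /\ forall b, m b = J (s b).
Proof.
move=> im; pose le := (fun i j : 'I_n => (i <= j)%N).
pose t := [tuple m i | i < k].
have le_tr : transitive le by move=> y x z; exact: leq_trans.
have le_tot : total le by move=> x y; exact: leq_total.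
have szs : size (sort le t) == k by rewrite size_sort size_tuple.
pose st := Tuple szs.
have /tuple_permP[s sE] : perm_eq st t by rewrite perm_sort.
have st_tnth i : tnth st i = m (s i).
  have -> : st = [tuple tnth t (s i) | i < k] by apply: val_inj.
  by rewrite !tnth_mktuple.
have sst : sorted le st by apply: sort_sorted.
exists [ffun i => tnth st i], (s^-1)%g; split; last first.
  by move=> b; rewrite ffunE st_tnth permKV.
apply/forallP => i; apply/forallP => j; apply/implyP => ij; rewrite !ffunE.
have lij : le (tnth st i) (tnth st j).
  rewrite (tnth_nth (tnth st i)) (tnth_nth (tnth st i) st j).
  apply: (sorted_ltn_nth le_tr) => //; rewrite inE size_tuple //.
rewrite ltn_neqAle (lij : (_ <= _)%N) andbT; apply: contraTneq ij => /val_inj.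
by rewrite !st_tnth => /im/perm_inj ->; rewrite ltnn.
Qed.

Lemma increasing_ltn n k (J : {ffun 'I_k -> 'I_n}) :
  increasing J -> {homo J : i j / (i < j)%N}.
Proof. by move=> /forallP iJ i j ij; have /forallP/(_ j)/implyP := iJ i; apply. Qed.

Lemma increasing_inj n k (J : {ffun 'I_k -> 'I_n}) : increasing J -> injective J.
Proof.
move=> /increasing_ltn iJ i j Jij.
case: (ltngtP i j) => [/iJ|/iJ|/val_inj //]; by rewrite Jij ltnn.
Qed.

(** The index change between the two lists is strictly increasing from ['I_k] to
    itself, hence the identity. *)
Lemma increasing_eq n k (I J : {ffun 'I_k -> 'I_n}) :
  increasing I -> increasing J -> (forall a, exists b, I a = J b) -> I = J.
Proof.
move=> iI iJ IJ; have [f fE] := choice IJ.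
have fmono : {homo f : a b / (a < b)%N}.
  move=> a b ab; have := increasing_ltn iI ab; rewrite !fE.
  case: (ltngtP (f a) (f b)) => // [/(increasing_ltn iJ)|/val_inj ->].
    by move=> h1 h2; have := ltn_trans h1 h2; rewrite ltnn.
  by rewrite ltnn.
have fge (m : nat) : forall a : 'I_k, val a = m -> (m <= f a)%N.
  elim: m => [//|m IH] a am.
  have mk : (m < k)%N by have := ltn_ord a; rewrite [X in (X < _)%N -> _]am; exact: ltnW.
  apply: leq_ltn_trans (IH (Ordinal mk) erefl) _; apply: fmono; by rewrite /= am.
have fle (m : nat) : forall a : 'I_k, (k - a)%N = m -> (f a + m <= k)%N.
  elim: m => [|m IH] a am; first by rewrite addn0 ltnW.
  have [ak|ak] := ltnP a.+1 k; last first.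
    have -> : m = 0%N.
      by apply/eqP; rewrite -leqn0 -ltnS -am leq_subLR addn1.
    by rewrite addn1.
  have /= := IH (Ordinal ak); rewrite subnS am /= => /(_ erefl).
  apply: leq_trans; rewrite addnS -addSn leq_add2r; exact: fmono.
have fid a : f a = a.
  apply: val_inj; apply/eqP; rewrite eqn_leq (fge _ a erefl) andbT.
  have := fle _ a erefl.
  by rewrite addnBA ?(ltnW (ltn_ord a)) // leq_subLR leq_add2r.
by apply/ffunP => a; rewrite fE fid.
Qed.

Section Wedges.
Variables (R : realType) (n : nat).
Local Notation E := 'rV[R]_n.

(** The columns [m] may come in any order and with repetitions, so that Laplace
    expansions and column replacements stay within this family. *)
Definition colminor k (u : 'I_k -> E) (m : 'I_k -> 'I_n) : R :=
  \det (\matrix_(i, j) u i 0 (m j)).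

Definition ebase k (J : multi_index n k) : 'I_k -> E := fun i => vbase R (val J i).

Lemma wedgeE k (u : 'I_k -> E) J : wedge u J = colminor u (val J).
Proof. by rewrite ffunE. Qed.

Lemma vbaseE (i j : 'I_n) : vbase R i 0 j = (i == j)%:R.
Proof. by rewrite mxE eqxx eq_sym. Qed.

Lemma colminor_repeat k (u : 'I_k -> E) (m : 'I_k -> 'I_n) :
  ~ injective m -> colminor u m = 0.
Proof.
move=> nim; have /existsP[a /existsP[b /andP[ab mab]]] :
    [exists a, exists b, (a != b) && (m a == m b)].
  apply: contra_notT nim => /existsPn H a b mab; apply/eqP/negPn/negP => ab.
  by have /existsPn/(_ b) := H a; rewrite ab mab eqxx.
rewrite /colminor -det_tr (determinant_alternate ab) // => j.
by rewrite !mxE (eqP mab).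
Qed.

Lemma colminor_perm k (u : 'I_k -> E) (m : 'I_k -> 'I_n) (s : 'S_k) :
  colminor u (m \o s) = (-1) ^+ s * colminor u m.
Proof.
rewrite /colminor.
have -> : \matrix_(i, j) u i 0 ((m \o s) j)
    = (\matrix_(i, j) u i 0 (m j)) *m perm_mx (s^-1)%g.
  rewrite -col_permE.
  by apply/matrixP => i j; rewrite !mxE.
by rewrite det_mulmx det_perm odd_permV mulrC.
Qed.

Lemma wedge_ebase k (J I : multi_index n k) : wedge (ebase J) I = (I == J)%:R.
Proof.
rewrite wedgeE /colminor; have [->|IJ] := eqVneq I J.
  suff -> : \matrix_(i, j) ebase J i 0 (val J j) = 1%:M by rewrite det1.
  apply/matrixP => i j; rewrite !mxE eqxx /= eq_sym.
  by rewrite (inj_eq (increasing_inj (valP J))).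
have [a Ja] : exists a, forall b, val I a != val J b.
  apply: contra_notP (negP IJ) => H; apply/eqP/val_inj.
  apply: increasing_eq; [exact: valP|exact: valP|move=> a].
  apply: contra_notP H => H; exists a => b; apply/eqP => E; apply: H.
  by exists b.
rewrite -det_tr (expand_det_row _ a) big1 // => j _.
by rewrite !mxE eqxx /= (negPf (Ja j)) mul0r.
Qed.

(** Both sides vanish when [m] repeats a column; otherwise [m] is a permutation
    of an increasing list, which multiplies all the minors by the same sign. *)
Lemma colminor_expand k (u : 'I_k -> E) (m : 'I_k -> 'I_n) :
  colminor u m = \sum_J wedge u J * colminor (ebase J) m.
Proof.
have [im|nim] := pselect (injective m); last first.
  rewrite colminor_repeat // big1 // => J _.
  by rewrite [X in _ * X]colminor_repeat // mulr0.
have [J0 [s [iJ mE]]] := sorted_factor im.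
have [J JE] : exists J : multi_index n k, val J = J0 by exists (exist _ J0 iJ).
have {mE} -> : m = val J \o s by apply/funext => b; rewrite mE JE.
have cE v : colminor v (val J \o s) = (-1) ^+ s * wedge v J.
  by rewrite wedgeE; exact: colminor_perm.
rewrite cE (bigD1 J) //= big1 ?addr0 => [|I IJ].
  by rewrite cE wedge_ebase eqxx mulr1 mulrC.
by rewrite cE wedge_ebase eq_sym (negPf IJ) !mulr0.
Qed.

(** Multilinearity of the determinant in the columns of the product. *)
Lemma det_mul_colminor k (u : 'I_k -> E) (B : 'M[R]_(n, k)) :
  \det ((\matrix_(i < k) u i) *m B)
  = \sum_(m : {ffun 'I_k -> 'I_n}) (\prod_b B (m b) b) * colminor u m.
Proof.
rewrite -det_tr /determinant.
under eq_bigr => s _.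
  under eq_bigr => i _ do rewrite !mxE.
  rewrite bigA_distr_bigA /= mulr_sumr.
  over.
rewrite exchange_big /=; apply: eq_bigr => m _.
rewrite /colminor -det_tr /determinant mulr_sumr; apply: eq_bigr => s _.
rewrite big_split /= [RHS]mulrCA; congr (_ * _); rewrite [RHS]mulrC; congr (_ * _).
by apply: eq_bigr => i _; rewrite !mxE.
Qed.

Lemma Cauchy_Binet k (u v : 'I_k -> E) :
  \det ((\matrix_(i < k) u i) *m (\matrix_(i < k) v i)^T)
  = \sum_J wedge u J * wedge v J.
Proof.
rewrite det_mul_colminor.
under eq_bigr => m _ do rewrite colminor_expand mulr_sumr.
rewrite exchange_big /=; apply: eq_bigr => J _.
under eq_bigr => m _ do rewrite mulrCA.
rewrite -mulr_sumr -det_mul_colminor; congr (_ * _).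
rewrite wedgeE /colminor -[RHS]det_tr; congr (\det _); apply/matrixP => i j.
rewrite mxE (bigD1 (val J i)) //= big1 ?addr0 => [|l lj].
 by rewrite !mxE !eqxx mul1r.
by rewrite !mxE eqxx /= (negPf lj) mul0r.
Qed.

Lemma gram_det k (u : 'I_k -> E) : \det (gram u) = \sum_J wedge u J ^+ 2.
Proof.
transitivity (\det ((\matrix_(i < k) u i) *m (\matrix_(i < k) u i)^T)).
  by congr (\det _); apply/matrixP => i j; rewrite !mxE; apply: eq_bigr => l _;
     rewrite !mxE.
by rewrite Cauchy_Binet; apply: eq_bigr => J _; rewrite expr2.
Qed.

Lemma wedge_le_gram k (u : 'I_k -> E) J : `|wedge u J| <= Num.sqrt (\det (gram u)).
Proof.
rewrite -sqrtr_sqr ler_sqrt gram_det ?sumr_ge0 // => [|I _]; last exact: sqr_ge0.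
by rewrite (bigD1 J) //= lerDl sumr_ge0 // => I _; rewrite sqr_ge0.
Qed.

Lemma kvec_expand k (a : kvec R n k) : a = \sum_J a J *: wedge (ebase J).
Proof.
apply/ffunP => I; rewrite sum_ffunE (bigD1 I) //= big1 ?addr0 => [|J JI].
  by rewrite [RHS]ffunE wedge_ebase eqxx /= [_ *: _]mulr1.
by rewrite ffunE wedge_ebase eq_sym (negPf JI) /= [_ *: _]mulr0.
Qed.

Lemma mass_set_neq0 k (a : kvec R n k) : mass_set a !=set0.
Proof.
pose s := [seq (a J, ebase J) | J <- index_enum (multi_index n k)].
exists (\sum_(c <- s) `|c.1| * Num.sqrt (\det (gram c.2))), s; split => //.
by rewrite big_map -kvec_expand.
Qed.

(** By Cauchy-Binet a coefficient of a simple k-vector is at most its norm, and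
    the mass is an infimum of sums of such norms. This is how bounds on the
    coefficients of a form become bounds in terms of the mass. *)
Lemma coef_le_mass k (a : kvec R n k) J : `|a J| <= mass a.
Proof.
apply: lb_le_inf; first exact: mass_set_neq0.
move=> _ [s [-> ->]]; rewrite sum_ffunE; apply: le_trans (ler_norm_sum _ _ _) _.
apply: ler_sum => c _; rewrite ffunE [_ *: _]/( _ * _) normrM ler_wpM2l //.
exact: wedge_le_gram.
Qed.

Lemma mass_ebase_le1 k (J : multi_index n k) : mass (wedge (ebase J)) <= 1.
Proof.
apply: ge_inf; first exact: mass_set_lb.
exists [:: (1, ebase J)]; rewrite !big_seq1 scale1r normr1 mul1r; split => //=.
rewrite gram_det (bigD1 J) //= big1 => [|I IJ]; rewrite wedge_ebase.
  by rewrite eqxx expr1n addr0 sqrtr1.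
by rewrite (negPf IJ) expr0n.
Qed.

End Wedges.

(** * Partial derivatives and differentiability *)

Section OneVariable.
Variable R : realType.

Lemma MVT_is_derive (f df : R -> R) (a b : R) : a <= b ->
  (forall x : R, a <= x <= b -> is_derive x 1 f (df x)) ->
  exists2 c, a <= c <= b & f b - f a = df c * (b - a).
Proof.
move=> ab H; have [||c] := @MVT_segment R f df a b ab.
- by move=> x; rewrite in_itv /= => /andP[? ?]; apply: H; rewrite !ltW.
- apply: derivable_within_continuous => x; rewrite in_itv /= => /H.
  by case.
by rewrite in_itv /=; exists c.
Qed.

(** The increment [b] may have any sign. *)
Lemma MVT_is_derive0 (f df : R -> R) (b : R) :
  (forall x : R, `|x| <= `|b| -> is_derive x 1 f (df x)) ->
  exists2 c, `|c| <= `|b| & f b - f 0 = df c * b.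
Proof.
move=> H; have [b0|b0] := leP 0 b.
  have [|c /andP[c0 cb] ->] := @MVT_is_derive f df 0 b b0.
    by move=> x /andP[x0 xb]; apply: H; rewrite !ger0_norm.
  by exists c; rewrite ?subr0 // !ger0_norm.
have [|c /andP[c0 cb] E] := @MVT_is_derive f df b 0 (ltW b0).
  by move=> x /andP[x0 xb]; apply: H; rewrite (ler0_norm xb) (ler0_norm (ltW b0)) lerN2.
exists c; first by rewrite (ler0_norm cb) (ler0_norm (ltW b0)) lerN2.
by rewrite -opprB E sub0r mulrN opprK.
Qed.

End OneVariable.

Section Euclid.
Variables (R : realType) (n : nat).
Local Notation E := 'rV[R]_n.

Lemma coord_le_norm (u : E) j : `|u 0 j| <= `|u|.
Proof. by rewrite [leRHS]/Num.Def.normr /= mx_normrE; exact: (le_bigmax _ _ (0, j)). Qed.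

Lemma norm_le_coord (u : E) c : 0 <= c -> (forall j, `|u 0 j| <= c) -> `|u| <= c.
Proof.
move=> c0 H; rewrite [leLHS]/Num.Def.normr /= mx_normrE; apply: bigmax_le => // -[i j] _.
by rewrite ord1.
Qed.

Lemma dotv_ge0 (u : E) : 0 <= dotv u u.
Proof. by apply: sumr_ge0 => j _; rewrite -expr2 sqr_ge0. Qed.

Lemma enorm_ge0 (u : E) : 0 <= enorm u. Proof. exact: sqrtr_ge0. Qed.

Lemma coord_le_enorm (u : E) j : `|u 0 j| <= enorm u.
Proof.
rewrite -sqrtr_sqr ler_sqrt ?dotv_ge0 // /dotv (bigD1 j) //= -expr2 lerDl.
by apply: sumr_ge0 => i _; rewrite -expr2 sqr_ge0.
Qed.

Lemma enormZ (h : R) (u : E) : enorm (h *: u) = `|h| * enorm u.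
Proof.
rewrite /enorm -[`|h|]sqrtr_sqr -sqrtrM ?sqr_ge0 //; congr Num.sqrt.
rewrite /dotv mulr_sumr; apply: eq_bigr => j _; rewrite !mxE; ring.
Qed.

Lemma enorm_le_norm (u : E) : enorm u <= n%:R * `|u|.
Proof.
rewrite -[leRHS]ger0_norm ?mulr_ge0 // -sqrtr_sqr ler_sqrt ?sqr_ge0 //.
apply: (@le_trans _ _ (\sum_(j < n) `|u| ^+ 2)).
  apply: ler_sum => j _; rewrite -expr2 -real_normK ?num_real //.
  by rewrite lerXn2r ?nnegrE // coord_le_norm.
rewrite sumr_const card_ord -[leLHS]mulr_natl exprMn; apply: ler_wpM2r; first exact: sqr_ge0.
by rewrite -natrX ler_nat; case: (n) => // m; rewrite leq_pmulr.
Qed.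

Lemma enorm_vbase (j : 'I_n) : enorm (vbase R j) = 1.
Proof.
rewrite /enorm /dotv (bigD1 j) //= big1 => [|i ij].
  by rewrite !mxE !eqxx mulr1 addr0 sqrtr1.
by rewrite !mxE eqxx (negPf ij) mulr0.
Qed.

Lemma enorm_eq0 (u : E) : enorm u = 0 -> u = 0.
Proof.
move=> u0; apply/rowP => j; rewrite mxE; apply/eqP; rewrite -normr_le0 -u0.
exact: coord_le_enorm.
Qed.

Lemma row_expand (u : E) : u = \sum_j u 0 j *: vbase R j.
Proof. exact: row_sum_delta. Qed.

Lemma ball_convex (p : E) (r : R) : convex_set (ball p r : set E).
Proof.
move=> x y l; rewrite !inE => px py.
rewrite /conv /=; rewrite -!ball_normE /ball_ /= in px py *.
have -> : p - (l%:num *: x + (1 - l%:num) *: y)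
   = l%:num *: (p - x) + (1 - l%:num) *: (p - y).
  by apply/rowP => j; rewrite !mxE; ring.
apply: le_lt_trans (ler_normD _ _) _; rewrite !normrZ.
have l0 : 0 <= l%:num by [].
have l1 : l%:num <= 1 by [].
rewrite (ger0_norm l0) ger0_norm ?subr_ge0 //.
have [->|ln] := eqVneq (l%:num) 0; first by rewrite mul0r add0r subr0 mul1r.
rewrite -[X in _ < X](_ : l%:num * r + (1 - l%:num) * r = r); last by ring.
apply: ltr_leD; first by rewrite ltr_pM2l // lt_neqAle eq_sym ln.
by rewrite ler_wpM2l ?subr_ge0 // ltW.
Qed.

End Euclid.

Section Derivatives.
Variables (R : realType) (n : nat).
Local Notation E := 'rV[R]_n.
Implicit Types (f g : E -> R) (p q u v : E).

Lemma is_derive_line (W : normedModType R) (f : E -> W) p u (t : R) :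
  derivable f (p + t *: u) u ->
  is_derive t 1 (fun s => f (p + s *: u)) ('D_u f (p + t *: u)).
Proof.
have E : (fun h : R => h^-1 *: ((fun s => f (p + s *: u)) \o shift t) (h *: 1)
                       - h^-1 *: f (p + t *: u)) =
         (fun h : R => h^-1 *: (f \o shift (p + t *: u)) (h *: u)
                       - h^-1 *: f (p + t *: u)).
  apply/funext => h /=; congr (_ *: f _ - _).
  by rewrite scalerDl addrCA [h *: 1]mulr1.
have E' : (fun h : R => h^-1 *: (((fun s => f (p + s *: u)) \o shift t) (h *: 1)
                       - f (p + t *: u))) =
         (fun h : R => h^-1 *: ((f \o shift (p + t *: u)) (h *: u)
                       - f (p + t *: u))).
  by apply/funext => h; rewrite !scalerBr; exact: (congr1 (@^~ h) E).
move=> d; apply: DeriveDef; first by rewrite /derivable E'.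
by rewrite /derive E'.
Qed.

(** Differentiability from an explicit linear approximation, which need not be
    recognized as the differential ['d f p]. *)
Lemma differentiable_linear_approx f p (L : {linear E -> R}) :
  (forall e : R, 0 < e -> \forall x \near p, `|f x - f p - L (x - p)| <= e * `|x - p|) ->
  differentiable f p.
Proof.
move=> H.
have cL : continuous L.
  have -> : (L : E -> R) = \sum_(j < n) (fun u : E => u 0 j * L (vbase R j)).
    apply/funext => u; rewrite fct_sumE [in LHS](row_expand u) linear_sum.
    by apply: eq_bigr => j _; rewrite linearZ.
  move=> u; apply: differentiable_continuous; apply: differentiable_sum => j.
  apply: differentiableM; last exact: differentiable_cst.
  exact: differentiable_coord.
apply/diffP => /=.
apply: (@getPex _ (fun (df : {linear E -> R}) => continuous df /\
  forall y, f y = f (lim (nbhs p)) + df (y - lim (nbhs p))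
                  +o_(y \near p) (y - lim (nbhs p)))).
exists L; split => // y.
have lp : lim (nbhs p) = p by exact: lim_id.
have fE := (eqaddoP (nbhs_filter_on p) f
  (fun y => f (lim (nbhs p)) + L (y - lim (nbhs p))) (fun y => y - lim (nbhs p))).2.
apply: (congr1 (@^~ y) (fE _)) => e e0; near=> x.
rewrite lp [X in `|X|](_ : _ = f x - f p - L (x - p)); last first.
  by rewrite -addrA -opprD.
by near: x; exact: H.
Unshelve. all: by end_near. Qed.

Lemma derive_expand f p v : differentiable f p ->
  'D_v f p = \sum_j v 0 j * 'D_(vbase R j) f p.
Proof.
move=> d; rewrite deriveE // [in LHS](row_expand v) linear_sum.
by apply: eq_bigr => j _; rewrite linearZ deriveE.
Qed.

(** Continuous partial derivatives suffice: move from [p] to [p + v] one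
    coordinate at a time and apply the mean value theorem on each edge. *)
Lemma differentiable_of_partials f p (df : 'I_n -> E -> R) :
  (\forall q \near p, forall j, is_derive q (vbase R j) f (df j q)) ->
  (forall j, {for p, continuous (df j)}) -> differentiable f p.
Proof.
move=> Hd Hc.
pose L0 := fun v : E => \sum_j v 0 j * df j p.
have linL : linear L0.
  move=> a u v; rewrite /L0 scaler_sumr -big_split /=; apply: eq_bigr => j _.
  by rewrite !mxE mulrDl -mulrA.
pose L1 := GRing.isLinear.Build R E R *:%R L0 linL.
pose L : {linear E -> R} := HB.pack L0 L1.
apply: (differentiable_linear_approx (L := L)) => e e0.
have n0 : 0 < e / (n%:R + 1) by rewrite divr_gt0 // ltr_wpDl.
have Hc' : \forall q \near p, forall j, `|df j q - df j p| <= e / (n%:R + 1).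
  apply: (@filter_forall _ _ (fun j q => `|df j q - df j p| <= e / (n%:R + 1)) (nbhs p)
    (nbhs_filter p)) => j.
  have /cvgrPdist_le/(_ _ n0) := Hc j.
  by apply: filterS => q; rewrite distrC.
have [r /= r0 Hr] := (nbhs_ballP _ _).1 (filterI Hd Hc').
apply/nbhs_ballP; exists r => //= x xr.
pose v := x - p.
have xE : x = p + v by rewrite /v addrC subrK.
have vr : `|v| < r by move: xr; rewrite -ball_normE /ball_ /= distrC.
change (`|f x - f p - \sum_j v 0 j * df j p| <= e * `|v|); clearbody v.
pose T (m : nat) : E := \row_j (if (j < m)%N then v 0 j else 0).
have Tn : p + T n = x.
  by rewrite xE; congr (_ + _); apply/rowP => j; rewrite mxE ltn_ord.
have T0 : p + T 0%N = p.
  by rewrite -[RHS]addr0; congr (_ + _); apply/rowP => j; rewrite !mxE.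
have TS (j : 'I_n) : T j.+1 = T j + v 0 j *: vbase R j.
  apply/rowP => i; rewrite !mxE eqxx /= ltnS leq_eqVlt (inj_eq val_inj).
  have [->|ij] := eqVneq i j; first by rewrite ltnn mulr1 add0r.
  by rewrite mulr0 addr0.
have inB (j : 'I_n) c : `|c| <= `|v 0 j| -> ball p r (p + T j + c *: vbase R j).
  move=> cv; rewrite -ball_normE /ball_ /= -addrA opprD addrA subrr sub0r normrN.
  apply: le_lt_trans vr; apply: norm_le_coord => // i; rewrite !mxE eqxx /=.
  have [->|ij] := eqVneq i j.
    by rewrite ltnn mulr1 add0r (le_trans cv) // coord_le_norm.
  by rewrite mulr0 addr0; case: ifP => _; rewrite ?normr0 // coord_le_norm.
have -> : f x - f p = \sum_(j < n) (f (p + T j.+1) - f (p + T j)).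
  rewrite -(big_mkord xpredT (fun j => f (p + T j.+1) - f (p + T j))).
  by rewrite telescope_sumr // Tn T0.
rewrite -sumrB.
apply: le_trans (ler_norm_sum _ _ _) _.
apply: (@le_trans _ _ (\sum_(j < n) (e / (n%:R + 1) * `|v|))); last first.
  rewrite sumr_const card_ord -[leLHS]mulr_natl mulrA; apply: ler_wpM2r => //.
  rewrite mulrCA; apply: ler_piMr; rewrite ?ltW //.
  by rewrite ltr_pdivrMr ?ltr_wpDl // mul1r ltrDl.
apply: ler_sum => j _.
have [|c cv] := @MVT_is_derive0 R (fun s => f (p + T j + s *: vbase R j))
   (fun s => df j (p + T j + s *: vbase R j)) (v 0 j).
  move=> s sv; have [/(_ j) [dd <-] _] := Hr _ (inB j s sv).
  exact: is_derive_line.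
rewrite scale0r addr0 -addrA -TS => ->.
rewrite mulrC -mulrBr normrM mulrC; apply: ler_pM => //; last exact: coord_le_norm.
by have [_] := Hr _ (inB j c cv).
Qed.

End Derivatives.

(** * Iterated differences *)

Section Differences.
Variables (R : realType) (n : nat).
Local Notation E := 'rV[R]_n.
Implicit Types (f g : E -> R) (p q u v : E) (s : seq E) (B : set E).

Fixpoint fdiff s f p : R :=
  if s is u :: s' then fdiff s' f (p + u) - fdiff s' f p else f p.

(** The vertices are the points [p + \sum_(u in S) u], for [S] a sublist of [s].
    They are listed with their multiplicities: cancellations in a difference
    of Dirac chains are not taken into account here. *)
Fixpoint vertices_in B s p : Prop :=
  if s is u :: s' then vertices_in B s' (p + u) /\ vertices_in B s' p else B p.

(** Where [f] and its translate by [u] are both controlled. *)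
Definition inter_shift B u : set E := [set q | B (q + u) /\ B q].

Lemma vertices_in_sub B B' s p : B `<=` B' -> vertices_in B s p -> vertices_in B' s p.
Proof. by move=> BB; elim: s p => [|u s IH] p /=; [exact: BB|case=> /IH ? /IH]. Qed.

Lemma vertices_in_shift B u s p : vertices_in [set q | B (q + u)] s p <-> vertices_in B
  s (p + u).
Proof. by elim: s p => [//|v s IH] p /=; rewrite !IH addrAC. Qed.

Lemma vertices_inI B B' s p : vertices_in [set q | B q /\ B' q] s p <-> vertices_in B s
  p /\ vertices_in B' s p.
Proof. by elim: s p => [//|v s IH] p /=; rewrite !IH; tauto. Qed.

Lemma vertices_in_cons B u s p : vertices_in B (u :: s) p <-> vertices_in (inter_shift B u) s p.
Proof.
split; first by move=> [h1 h2]; apply/vertices_inI; split => //; exact/vertices_in_shift.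
by move=> /vertices_inI[/vertices_in_shift h1 h2].
Qed.

Lemma fdiff_eq B s p f g : vertices_in B s p -> (forall q, B q -> f q = g q) ->
  fdiff s f p = fdiff s g p.
Proof.
by move=> + H; elim: s p => [|u s IH] p /=; [exact: H|case=> /IH -> /IH ->].
Qed.

Lemma fdiff_shift s f u p : fdiff s (fun q => f (q + u)) p = fdiff s f (p + u).
Proof. by elim: s p => [//|v s IH] p /=; rewrite !IH addrAC. Qed.

Lemma fdiffB s f g p : fdiff s (fun q => f q - g q) p = fdiff s f p - fdiff s g p.
Proof. by elim: s p => [//|v s IH] p /=; rewrite !IH; ring. Qed.

Lemma fdiffD s f g p : fdiff s (fun q => f q + g q) p = fdiff s f p + fdiff s g p.
Proof. by elim: s p => [//|v s IH] p /=; rewrite !IH; ring. Qed.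

Lemma fdiffZ s (c : R) f p : fdiff s (fun q => c * f q) p = c * fdiff s f p.
Proof. by elim: s p => [//|v s IH] p /=; rewrite !IH; ring. Qed.

Lemma fdiff_sum (I : Type) (r : seq I) s (F : I -> E -> R) p :
  fdiff s (fun q => \sum_(i <- r) F i q) p = \sum_(i <- r) fdiff s (F i) p.
Proof. by elim: s p => [//|v s IH] p /=; rewrite !IH sumrB. Qed.

Lemma fdiff_cons s u f p : fdiff (u :: s) f p = fdiff s (fun q => f (q + u) - f q) p.
Proof. by rewrite fdiffB fdiff_shift. Qed.

Lemma fdiff0 s f p : 0 \in s -> fdiff s f p = 0.
Proof.
elim: s p => [//|u s IH] p; rewrite inE => /orP[/eqP <- /=|s0 /=].
  by rewrite addr0 subrr.
by rewrite !IH // subrr.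
Qed.

Lemma snorm_cons u s : snorm (u :: s) = enorm u * snorm s.
Proof. by rewrite /snorm big_cons. Qed.

Lemma snorm_nil : snorm ([::] : seq E) = 1.
Proof. by rewrite /snorm big_nil. Qed.

(** A difference is a finite combination of values. *)
Lemma is_derive_fdiff (G : R -> E -> R) (G' : E -> R) (t : R) B s p :
  (forall q, B q -> is_derive t 1 (fun x => G x q) (G' q)) -> vertices_in B s p ->
  is_derive t 1 (fun x => fdiff s (G x) p) (fdiff s G' p).
Proof.
by move=> H; elim: s p => [|u s IH] p /=; [exact: H|case=> /IH ? /IH ?;
  exact: is_deriveB].
Qed.

(** The inequality on the order is strict so that [diff_bounded 0] is vacuous, which
    starts the inductions on the order. The bound is only required when all
    the vertices are in [B]. *)
Definition diff_bounded m (C : R) B f : Prop :=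
  forall s p, (size s < m)%N -> vertices_in B s p -> `|fdiff s f p| <= C * snorm s.

Lemma diff_bounded_leq m m' C C' B B' f : (m <= m')%N -> C' <= C -> B `<=` B' ->
  diff_bounded m' C' B' f -> diff_bounded m C B f.
Proof.
move=> mm CC BB H s p sm /(vertices_in_sub BB)/(H s p (leq_trans sm mm))/le_trans; apply.
by rewrite ler_wpM2r ?snorm_ge0.
Qed.

Lemma diff_bounded_eq m C B f g : (forall q, B q -> f q = g q) -> diff_bounded m C B f
  -> diff_bounded m C B g.
Proof. by move=> fg H s p sm Bp; rewrite -(fdiff_eq Bp fg) H. Qed.

Lemma diff_bounded_sum m (F : 'I_n -> E -> R) (C : R) B : (forall i, diff_bounded m C B
  (F i)) ->
  diff_bounded m (n%:R * C) B (fun q => \sum_i F i q).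
Proof.
move=> H s p sm Bp; rewrite fdiff_sum; apply: le_trans (ler_norm_sum _ _ _) _.
rewrite -mulrA mulr_natl -[X in _ *+ X](card_ord n) -sumr_const.
by apply: ler_sum => i _; exact: H.
Qed.

Lemma diff_bounded_cons m C B f u : diff_bounded m.+1 C B f ->
  diff_bounded m (C * enorm u) (inter_shift B u) (fun q => f (q + u) - f q).
Proof.
move=> H s p sm Bp; rewrite -fdiff_cons -mulrA -snorm_cons; apply: H => //.
exact/vertices_in_cons.
Qed.

Lemma diff_bounded_shift m C B f u : diff_bounded m C B f ->
  diff_bounded m C (inter_shift B u) (fun q => f (q + u)).
Proof.
by move=> H s p sm /vertices_inI[/vertices_in_shift Bp _]; rewrite fdiff_shift; exact: H.
Qed.

Let product_rule (a b : E -> R) u s p :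
  fdiff (u :: s) (fun q => a q * b q) p =
  fdiff s (fun q => (a (q + u) - a q) * b (q + u)) p
  + fdiff s (fun q => a q * (b (q + u) - b q)) p.
Proof.
rewrite fdiff_cons -fdiffD; apply: (@fdiff_eq setT) => [|q _]; last by ring.
by elim: s p => [//|v s IH] p /=.
Qed.

(** The product rule for differences: one factor is translated. *)
Lemma diff_bounded_mul m (Ca Cb : R) B a b : 0 <= Ca -> 0 <= Cb ->
  diff_bounded m.+1 Ca B a -> diff_bounded m.+1 Cb B b ->
  diff_bounded m.+1 (2 ^+ m * Ca * Cb) B (fun q => a q * b q).
Proof.
elim: m Ca Cb B a b => [|m IH] Ca Cb B a b Ca0 Cb0 Ha Hb [|u s] p sm Bp //.
- by rewrite snorm_nil mulr1 /= normrM mul1r; apply: ler_pM => //;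
    [have := Ha [::] p isT Bp|have := Hb [::] p isT Bp]; rewrite snorm_nil mulr1.
-
  rewrite snorm_nil mulr1 /= normrM -mulrA.
  have := Ha [::] p isT Bp; have := Hb [::] p isT Bp; rewrite snorm_nil !mulr1 /=.
  move=> hb ha; apply: le_trans (ler_pM (normr_ge0 _) (normr_ge0 _) ha hb) _.
  by rewrite ler_peMl ?mulr_ge0 // exprn_ege1 // ler1n.
have e0 := enorm_ge0 u.
have HaS := diff_bounded_leq (leqnSn m.+1) (lexx Ca) (@subset_refl _ B) Ha.
have HbS := diff_bounded_leq (leqnSn m.+1) (lexx Cb) (@subset_refl _ B) Hb.
have sub : inter_shift B u `<=` B by move=> q [].
have H1 := IH _ _ _ _ _ (mulr_ge0 Ca0 e0) Cb0 (diff_bounded_cons Ha)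
  (diff_bounded_shift (u := u) HbS) s p sm.
have H2 := IH _ _ _ _ _ Ca0 (mulr_ge0 Cb0 e0)
  (diff_bounded_leq (leqnn _) (lexx Ca) sub HaS) (diff_bounded_cons (u := u) Hb) s p sm.
have {}Bp := (vertices_in_cons _ _ _ _).1 Bp.
rewrite product_rule (le_trans (ler_normD _ _)) //.
apply: le_trans (lerD (H1 Bp) (H2 Bp)) _.
rewrite le_eqVlt; apply/orP; left; apply/eqP.
by rewrite snorm_cons exprS; ring.
Qed.

(** For [chain_top], where the differences of top order of [b] are not yet
    known to be bounded. *)
Lemma fdiff_mul_top (Ca Cb : R) B a b s p : 0 <= Ca -> 0 <= Cb ->
  diff_bounded (size s).+1 Ca B a -> diff_bounded (size s) Cb B b -> vertices_in B s p ->
  `|fdiff s (fun q => a q * b q) p - a p * fdiff s b p|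
    <= 2 ^+ size s * Ca * Cb * snorm s.
Proof.
elim: s Ca Cb B a b p => [|u s IH] Ca Cb B a b p Ca0 Cb0 Ha Hb Bp.
  by rewrite /= subrr normr0 snorm_nil !mulr1 expr0 mul1r mulr_ge0.
have e0 := enorm_ge0 u.
have HaS := diff_bounded_leq (leqnSn _) (lexx Ca) (@subset_refl _ B) Ha.
have sub : inter_shift B u `<=` B by move=> q [].
have {}Bp := (vertices_in_cons _ _ _ _).1 Bp.
have H1 := diff_bounded_mul (m := size s) (mulr_ge0 Ca0 e0) Cb0 (diff_bounded_cons (u := u) Ha).
have {}H1 := H1 _ (diff_bounded_shift (u := u) Hb) s p (ltnSn _) Bp.
have H2 := IH _ _ _ _ _ p Ca0 (mulr_ge0 Cb0 e0)
  (diff_bounded_leq (leqnn _) (lexx Ca) sub HaS) (diff_bounded_cons (u := u) Hb) Bp.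
rewrite product_rule (fdiff_cons _ _ b) -addrA (le_trans (ler_normD _ _)) //.
apply: le_trans (lerD H1 H2) _.
rewrite le_eqVlt; apply/orP; left; apply/eqP.
by rewrite snorm_cons /= !exprS; ring.
Qed.

End Differences.

Section Classes.
Variables (R : realType) (n : nat).
Local Notation E := 'rV[R]_n.
Implicit Types (f g : E -> R) (p q u v : E) (s : seq E) (B O : set E).

(** Partial derivatives are taken one at a time, so that products and
    compositions are treated by induction on [m]. The set [O] is arbitrary, and
    may be reduced to a point. *)
Fixpoint deriv_bounded m (L : R) O f : Prop :=
  (forall p, O p -> `|f p| <= L) /\
  (if m is m'.+1 then (forall p, O p -> differentiable f p) /\
     forall j, deriv_bounded m' L O ('D_(vbase R j) f) else True).

Lemma deriv_bounded_bound m L O f p : deriv_bounded m L O f -> O p -> `|f p| <= L.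
Proof. by case: m => [|m] /= [H _]; exact: H. Qed.

Lemma deriv_bounded_leq m m' L L' O O' f : (m <= m')%N -> L' <= L -> O `<=` O' ->
  deriv_bounded m' L' O' f -> deriv_bounded m L O f.
Proof.
move=> + LL OO; elim: m m' f => [|m IH] [|m'] f //= mm [H1 H2];
  (split; first by move=> p /OO/H1/le_trans; apply) => //.
case: H2 => H2 H3; split; first by move=> p /OO/H2.
by move=> j; apply: IH (H3 j).
Qed.

Lemma segment_convex (K : set E) (x y : E) (t : R) : convex_set K ->
  K x -> K y -> 0 <= t <= 1 -> K (x + t *: (y - x)).
Proof.
move=> cK Kx Ky /andP[t0 t1].
have t01 : (Itv.spec (@Itv.num_sem R) (Itv.Real `[0, 1]%Z) t).
  by rewrite /Itv.spec /Itv.num_sem /= num_real /= in_itv /= t0.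
have := cK y x (Itv.mk t01); rewrite !inE => /(_ Ky Kx).
rewrite /conv /=; congr (K _).
by apply/rowP => j; rewrite !mxE /= /unstable.onem; ring.
Qed.

(** Interpolate between [f \o X] at [q] and at [q + u] along the segments from
    [X q] to [X (q + u)], and use the mean value theorem. *)
Lemma chain_mvt B K f (X : E -> E) u s p : convex_set K ->
  (forall q, K q -> differentiable f q) -> (forall q, B q -> K (X q)) ->
  vertices_in B (u :: s) p ->
  exists2 t : R, 0 <= t <= 1 &
    fdiff (u :: s) (fun q => f (X q)) p = \sum_i fdiff s (fun q =>
      'D_(vbase R i) f (X q + t *: (X (q + u) - X q)) * (X (q + u) 0 i - X q 0 i)) p.
Proof.
move=> cK df XK Bp; have {}Bp := (vertices_in_cons _ _ _ _).1 Bp.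
pose psi (t : R) := fdiff s (fun q => f (X q + t *: (X (q + u) - X q))) p.
have [|t t01 psiE] := @MVT_is_derive R psi (fun t => fdiff s (fun q =>
    'D_(X (q + u) - X q) f (X q + t *: (X (q + u) - X q))) p) 0 1 ler01.
  move=> t t01; apply: is_derive_fdiff Bp => q [Bqu Bq].
  apply: is_derive_line; apply: diff_derivable; apply: df.
  exact: segment_convex (XK _ Bq) (XK _ Bqu) t01.
exists t => //.
transitivity (psi 1 - psi 0).
  rewrite fdiff_cons fdiffB /psi; congr (_ - _).
    by congr fdiff; apply/funext => q; rewrite scale1r subrKC.
  by congr fdiff; apply/funext => q; rewrite scale0r addr0.
rewrite psiE subr0 mulr1 -fdiff_sum; apply: (fdiff_eq Bp) => q [Bqu Bq].
rewrite derive_expand; last first.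
  by apply: df; exact: segment_convex (XK _ Bq) (XK _ Bqu) t01.
by apply: eq_bigr => i _; rewrite !mxE mulrC.
Qed.

Lemma vertices_in_convex (K : set E) u s p (t : R) : convex_set K -> 0 <= t <= 1 ->
  vertices_in K (u :: s) p -> vertices_in K s (p + t *: u).
Proof.
move=> cK t01 /vertices_in_cons Kp; apply/vertices_in_shift; apply: vertices_in_sub Kp
  => q [Kqu Kq] /=.
have -> : q + t *: u = q + t *: (q + u - q) by rewrite [q + u]addrC addrK.
exact: segment_convex.
Qed.

(** By [chain_mvt] for the identity map, a difference of [f] along [u] is a
    derivative of [f] at an intermediate point, which is in [K] by convexity. *)
Lemma deriv_bounded_convex m L O K f s p : deriv_bounded m L O f -> convex_set K -> K `<=` O ->
  (size s <= m)%N -> vertices_in K s p -> `|fdiff s f p| <= n%:R ^+ size s * L * snorm s.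
Proof.
move=> + cK KO; elim: s m f p => [|u s IH] [|m] f p //.
- by move=> [H _] _ /KO/H; rewrite expr0 mul1r snorm_nil mulr1.
- by move=> [H _] _ /KO/H; rewrite expr0 mul1r snorm_nil mulr1.
move=> [_ [Hd HD]] sm Kp.
have [t t01 ->] := @chain_mvt K K f id u s p cK (fun q Kq => Hd q (KO q Kq))
  (fun q => id) Kp.
apply: le_trans (ler_norm_sum _ _ _) _.
apply: (@le_trans _ _ (\sum_(i < n) (n%:R ^+ size s * L * snorm s) * enorm u)).
  apply: ler_sum => i _.
  have -> : fdiff s (fun q => 'D_(vbase R i) f (q + t *: (q + u - q))
      * ((q + u) 0 i - q 0 i)) p = u 0 i * fdiff s ('D_(vbase R i) f) (p + t *: u).
    rewrite -fdiff_shift -fdiffZ; congr fdiff; apply/funext => q.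
    by rewrite [q + u]addrC addrK !mxE addrK mulrC.
  rewrite normrM mulrC; apply: ler_pM => //; last exact: coord_le_enorm.
  by apply: IH (HD i) sm _; exact: vertices_in_convex t01 Kp.
rewrite sumr_const card_ord -mulr_natl snorm_cons /= exprS le_eqVlt.
by apply/orP; left; apply/eqP; ring.
Qed.

(** The interpolated map in [chain_mvt] is a convex combination of a map and its
    translate. *)
Lemma diff_bounded_interpolate m C B f u (t : R) : 0 <= t <= 1 -> diff_bounded m C B f ->
  diff_bounded m C (inter_shift B u) (fun q => f q + t * (f (q + u) - f q)).
Proof.
move=> /andP[t0 t1] H s p sm /vertices_inI[/vertices_in_shift Bpu Bp].
rewrite fdiffD fdiffZ fdiffB fdiff_shift.
have -> : fdiff s f p + t * (fdiff s f (p + u) - fdiff s f p)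
   = (1 - t) * fdiff s f p + t * fdiff s f (p + u) by ring.
apply: le_trans (ler_normD _ _) _; rewrite !normrM (ger0_norm t0) ger0_norm ?subr_ge0 //.
have -> : C * snorm s = (1 - t) * (C * snorm s) + t * (C * snorm s) by ring.
by apply: lerD; rewrite ler_wpM2l ?subr_ge0 //; exact: H.
Qed.

(** Induction on the order: [chain_mvt] replaces one difference by a product of
    a derivative of [f], composed with an interpolated map, and of a difference
    of [X]. *)
Lemma chain_diff_bounded m (L C : R) : 0 <= L -> 0 <= C -> exists2 C', 0 <= C' &
  forall O B f (X : E -> E), convex_set O -> deriv_bounded m L O f ->
    (forall q, B q -> O (X q)) -> (forall i, diff_bounded m.+1 C B (fun q => X q 0 i)) ->
    diff_bounded m.+1 C' B (fun q => f (X q)).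
Proof.
move=> L0 C0; elim: m => [|m [C' C'0 IH]].
  exists L => // O B f X _ [H _] BO _ [|//] p _ Bp.
  by rewrite snorm_nil mulr1; exact/H/BO.
pose D := n%:R * (2 ^+ m * C' * C).
have D0 : 0 <= D by rewrite /D !mulr_ge0 ?exprn_ge0.
exists (L + D) => [|O B f X cO [fL [df HD]] BO HX [|u s] p sm Bp].
- by rewrite addr_ge0.
- by rewrite snorm_nil mulr1 ler_wpDr //; exact/fL/BO.
have [t t01 ->] := chain_mvt cO df BO Bp.
have {}Bp := (vertices_in_cons _ _ _ _).1 Bp.
apply: (@le_trans _ _ (D * enorm u * snorm s)); last first.
  by rewrite -mulrA -snorm_cons ler_wpM2r ?snorm_ge0 // lerDr.
rewrite -fdiff_sum.
have e0 := enorm_ge0 u.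
suff H : diff_bounded m.+1 (n%:R * (2 ^+ m * C' * (C * enorm u))) (inter_shift B u)
   (fun q => \sum_i 'D_(vbase R i) f (X q + t *: (X (q + u) - X q))
      * (X (q + u) 0 i - X q 0 i)).
  apply: le_trans (H _ _ sm Bp) _; rewrite le_eqVlt; apply/orP; left; apply/eqP.
  by rewrite /D; ring.
apply: diff_bounded_sum => i.
apply: (diff_bounded_mul (a := fun q => 'D_(vbase R i) f (X q + t *: (X (q + u) - X q)))
  (b := fun q => X (q + u) 0 i - X q 0 i)) => //.
- by rewrite mulr_ge0.
- apply: (IH O _ ('D_(vbase R i) f) (fun q => X q + t *: (X (q + u) - X q))) => //.
  + exact: HD.
  + by move=> q [Bqu Bq]; apply: segment_convex; rewrite ?t01 //; exact: BO.
  + move=> j; have HXj := diff_bounded_leq (leqnSn _) (lexx C) (@subset_refl _ B) (HX j).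
    apply: diff_bounded_eq (diff_bounded_interpolate (u := u) t01 HXj) => q _.
    by rewrite !mxE.
- exact: diff_bounded_cons (HX i).
Qed.

(** The differences of [X] of the same order enter linearly, which is what makes
    Gronwall's inequality applicable to the differences of a flow. *)
Lemma chain_top m (L C : R) : 0 <= L -> 0 <= C -> exists2 C', 0 <= C' &
  forall O B f (X : E -> E) u s p, convex_set O -> deriv_bounded m.+1 L O f ->
    (forall q, B q -> O (X q)) -> (forall i, diff_bounded m.+1 C B (fun q => X q 0 i)) ->
    size s = m -> vertices_in B (u :: s) p ->
    `|fdiff (u :: s) (fun q => f (X q)) p|
      <= L * (\sum_i `|fdiff (u :: s) (fun q => X q 0 i) p|) + C' * snorm (u :: s).
Proof.
move=> L0 C0; have [C' C'0 HC'] := chain_diff_bounded m L0 C0.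
exists (n%:R * (2 ^+ m * C' * C)); first by rewrite !mulr_ge0 ?exprn_ge0.
move=> O B f X u s p cO [fL [df HD]] BO HX sm Bp.
have [t t01 ->] := chain_mvt cO df BO Bp.
have {}Bp := (vertices_in_cons _ _ _ _).1 Bp.
have e0 := enorm_ge0 u.
apply: le_trans (ler_norm_sum _ _ _) _.
have -> : n%:R * (2 ^+ m * C' * C) * snorm (u :: s)
  = \sum_(i < n) (2 ^+ m * C' * (C * enorm u) * snorm s).
  by rewrite sumr_const card_ord -[RHS]mulr_natl snorm_cons; ring.
rewrite mulr_sumr -big_split /=; apply: ler_sum => i _.
set a := fun q => 'D_(vbase R i) f (X q + t *: (X (q + u) - X q)).
set b := fun q => X (q + u) 0 i - X q 0 i.
have Ba : diff_bounded (size s).+1 C' (inter_shift B u) a.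
  rewrite sm /a.
  apply: (HC' O _ ('D_(vbase R i) f) (fun q => X q + t *: (X (q + u) - X q))) => //.
  + exact: HD.
  + by move=> q [Bqu Bq]; apply: segment_convex; rewrite ?t01 //; exact: BO.
  + move=> j.
    apply: diff_bounded_eq (diff_bounded_interpolate (u := u) t01 (HX j)) => q _.
    by rewrite !mxE.
have Bb : diff_bounded (size s) (C * enorm u) (inter_shift B u) b.
  by rewrite sm; exact: diff_bounded_cons (HX i).
have := fdiff_mul_top C'0 (mulr_ge0 C0 e0) Ba Bb Bp; rewrite sm => H.
have -> : fdiff s (fun q => a q * b q) p
  = (fdiff s (fun q => a q * b q) p - a p * fdiff s b p) + a p * fdiff s b p by rewrite subrK.
rewrite addrC; apply: le_trans (ler_normD _ _) _; apply: lerD => //.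
have -> : fdiff s b p = fdiff (u :: s) (fun q => X q 0 i) p by rewrite fdiff_cons.
rewrite normrM; apply: ler_wpM2r => //.
have Op : O (X p + t *: (X (p + u) - X p)).
  have [Bpu Bp'] : inter_shift B u p.
    elim: (s) Bp => [//|v s' IH] /=; by case.
  by apply: segment_convex; rewrite ?t01 //; exact: BO.
exact: deriv_bounded_bound (HD i) Op.
Qed.

End Classes.

(** * From bounded differences to derivatives *)

Section OneVariableDifferences.
Variable R : realType.

(** Divide [b] by [a] with remainder: [G] is additive up to second differences,
    and the remainder contributes a multiple of [a]. *)
Lemma slope_compare (G : R -> R) (C r a b : R) : 0 <= C ->
  (forall x y, `|x| < r -> `|y| < r -> `|x + y| < r ->
     `|G (x + y) - G x - G y| <= C * `|x| * `|y|) ->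
  (forall x, `|x| < r -> `|G x| <= C * `|x|) ->
  0 < a -> a <= b -> b < r ->
  `|G b / b - G a / a| <= 2 * C * b + 2 * C * a / b.
Proof.
move=> C0 H2 H1 a0 ab br.
have b0 : 0 < b by apply: lt_le_trans ab.
pose m := Num.trunc (b / a).
have /andP[m1 m2] : m%:R <= b / a < m.+1%:R.
  by apply: truncn_itv; rewrite divr_ge0 // ltW.
have ma : m%:R * a <= b by rewrite -ler_pdivlMr.
pose r' := b - m%:R * a.
have r'0 : 0 <= r' by rewrite subr_ge0.
have r'a : r' < a.
  by rewrite ltrBlDl -[X in _ + X]mul1r -mulrDl natr1 -ltr_pdivrMr.
have small x : 0 <= x -> x <= b -> `|x| < r.
  by move=> x0 xb; rewrite ger0_norm //; apply: le_lt_trans br.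
have multiples (j : nat) : (j <= m)%N ->
    `|G (j%:R * a) - j%:R * G a| <= C * a * a * j%:R * m%:R.
  elim: j => [_|j IH jm].
    rewrite !mul0r subr0 mulr0 mul0r normr_le0.
    have := H1 0; rewrite normr0 mulr0 normr_le0; apply.
    by apply: lt_trans br.
  have ja0 (i : nat) : 0 <= i%:R * a by rewrite mulr_ge0 // ltW.
  have jab (i : nat) : (i <= m)%N -> i%:R * a <= b.
    by move=> im; apply: le_trans ma; rewrite ler_pM2r // ler_nat.
  have /IH {}IH : (j <= m)%N by exact: ltnW.
  have jS : j.+1%:R * a = j%:R * a + a by rewrite -natr1 mulrDl mul1r.
  have := H2 (j%:R * a) a; rewrite -jS.
  rewrite !small ?ja0 ?jab // ?(ltnW jm) ?(ltW a0) // => /(_ isT isT isT) h.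
  rewrite (ger0_norm (ja0 j)) (gtr0_norm a0) in h.
  have -> : G (j.+1%:R * a) - j.+1%:R * G a
     = (G (j.+1%:R * a) - G (j%:R * a) - G a) + (G (j%:R * a) - j%:R * G a).
    by rewrite -natr1; ring.
  apply: le_trans (ler_normD _ _) _; apply: le_trans (lerD h IH) _.
  have -> : C * a * a * j.+1%:R * m%:R = C * a * a * m%:R + C * a * a * j%:R * m%:R.
    by rewrite -natr1; ring.
  rewrite lerD2r; have -> : C * (j%:R * a) * a = C * a * a * j%:R by ring.
  by rewrite ler_wpM2l ?mulr_ge0 ?ler_nat ?(ltnW jm) // ltW.
have hm := multiples m (leqnn m).
have hb := H2 (m%:R * a) r'.
rewrite [m%:R * a + r']subrKC in hb.
have ma0 : 0 <= m%:R * a by rewrite mulr_ge0 // ltW.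
rewrite !small // ?(ltW b0) // ?(le_trans (ltW r'a)) // in hb.
have {}hb := hb isT isT isT.
have hr := H1 r' (small _ r'0 (le_trans (ltW r'a) ab)).
have ha := H1 a (small _ (ltW a0) ab).
rewrite (ger0_norm ma0) (ger0_norm r'0) in hb.
rewrite (ger0_norm r'0) in hr; rewrite (gtr0_norm a0) in ha.
have E : G b / b - G a / a = ((G b - G (m%:R * a) - G r')
   + (G (m%:R * a) - m%:R * G a) + G r' - r' / a * G a) / b.
  by rewrite /r'; field; rewrite !gt_eqF.
rewrite E normrM normfV (gtr0_norm b0) ler_pdivrMr // [leRHS]mulrDl.
have -> : 2 * C * a / b * b = C * a + C * a by field; rewrite gt_eqF.
have -> : 2 * C * b * b = C * b * b + C * b * b by ring.
rewrite [leRHS]addrA; apply: le_trans (ler_normB _ _) _; apply: lerD; last first.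
  rewrite normrM normrM normfV (ger0_norm r'0) (gtr0_norm a0).
  rewrite mulrAC ler_pdivrMr // mulrC [X in _ <= X](_ : _ = C * a * a) //.
  by apply: ler_pM => //; exact: ltW.
apply: le_trans (ler_normD _ _) _; apply: lerD; last first.
  by apply: le_trans hr _; rewrite ler_wpM2l // ltW.
apply: le_trans (ler_normD _ _) _; apply: lerD.
  apply: le_trans hb _; rewrite -[leLHS]mulrA -[leRHS]mulrA ler_wpM2l //; apply: ler_pM => //.
  exact: le_trans (ltW r'a) ab.
apply: le_trans hm _.
have -> : C * a * a * m%:R * m%:R = C * (m%:R * a * (m%:R * a)) by ring.
by rewrite -[leRHS]mulrA ler_wpM2l //; apply: ler_pM.
Qed.

(** For [h] much smaller than [b] the slopes at [h] and at [b] differ by a small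
    multiple of [b], so that the slopes form a Cauchy filter. *)
Lemma derivable_of_differences (F : R -> R) (C r : R) : 0 <= C -> 0 < r ->
  (forall x y, `|x| < r -> `|y| < r -> `|x + y| < r ->
     `|F (x + y) - F x - F y + F 0| <= C * `|x| * `|y|) ->
  (forall x, `|x| < r -> `|F x - F 0| <= C * `|x|) ->
  cvg (h^-1 * (F h - F 0) @[h --> 0^']).
Proof.
move=> C0 r0 H2 H1.
pose G x := F x - F 0.
have {}H2 x y : `|x| < r -> `|y| < r -> `|x + y| < r ->
    `|G (x + y) - G x - G y| <= C * `|x| * `|y|.
  move=> ? ? ?; rewrite [X in `|X|](_ : _ = F (x + y) - F x - F y + F 0); last first.
    by rewrite /G; ring.
  exact: H2.
have {}H1 x : `|x| < r -> `|G x| <= C * `|x| by exact: H1.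
apply: cauchy_cvg; apply: cauchy_exP => e e0.
pose b := Num.min (r / 2) (e / (8 * (C + 1))).
have C1 : 0 < C + 1 by rewrite ltr_wpDl.
have b0 : 0 < b by rewrite lt_min !divr_gt0 // mulr_gt0.
have br : b < r by rewrite gt_min ltr_pdivrMr // ltr_pMr // ltr1n.
have be : C * b <= e / 8.
  have : b <= e / (8 * (C + 1)) by rewrite ge_min lexx orbT.
  rewrite ler_pdivlMr ?mulr_gt0 // => h; rewrite ler_pdivlMr //.
  by apply: le_trans h; nra.
exists (G b / b).
have d0 : 0 < Num.min b (b * (e / (8 * (C + 1)))).
  by rewrite lt_min b0 mulr_gt0 // divr_gt0 // mulr_gt0.
suff : \forall h \near (0 : R)^', ball (G b / b) e (h^-1 * G h) by [].
near=> h.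
have h0 : h != 0 by near: h; exact: nbhs_dnbhs_neq.
have : `|h| < Num.min b (b * (e / (8 * (C + 1)))).
  by near: h; exact: dnbhs0_lt.
rewrite lt_min => /andP[hb hbe].
have nh0 : 0 < `|h| by rewrite normr_gt0.
have Chb : C * `|h| / b <= e / 8.
  rewrite ler_pdivrMr //; have : `|h| <= b * (e / (8 * (C + 1))) by exact: ltW.
  rewrite mulrA ler_pdivlMr ?mulr_gt0 //; nra.
have Ch : C * `|h| <= e / 8 by apply: le_trans be; rewrite ler_wpM2l // ltW.
have q1 : `|G b / b - G `|h| / `|h| | <= e / 2.
  apply: le_trans (slope_compare C0 H2 H1 nh0 (ltW hb) br) _.
  rewrite -!mulrA -mulrDr [X in 2 * X](_ : _ = C * b + C * `|h| / b); last by ring.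
  by move: be Chb; move: (C * `|h| / b) (C * b) => x y; lra.
have q2 : `|G `|h| / `|h| - h^-1 * G h| <= e / 8.
  have [hp|hn] := leP 0 h.
    by rewrite (ger0_norm hp) [h^-1 * _]mulrC subrr normr0 divr_ge0 // ltW.
  rewrite (ltr0_norm hn) in hb hbe nh0 Chb Ch *.
  have := H2 h (- h); rewrite subrr normr0 normrN ltr0_norm // => H2h.
  have hr : - h < r by exact: lt_trans hb br.
  have {}H2h := H2h hr hr r0.
  have G0 : G 0 = 0 by rewrite /G subrr.
  rewrite [X in `|X|](_ : _ = (G 0 - G h - G (- h)) / h); last by rewrite G0; field.
  rewrite normrM normfV (ltr0_norm hn) ler_pdivrMr //.
  apply: le_trans H2h _; rewrite ler_wpM2r // ltW //.
rewrite /ball /= -(subrKA (G `|h| / `|h|)).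
apply: le_lt_trans (ler_normD _ _) _; apply: le_lt_trans (lerD q1 q2) _; lra.
Unshelve. all: by end_near. Qed.

End OneVariableDifferences.

Section DifferencesToDerivatives.
Variables (R : realType) (n : nat).
Local Notation E := 'rV[R]_n.
Implicit Types (f g : E -> R) (p q u v : E) (s : seq E) (B O : set E).

Lemma norm_vbase (j : 'I_n) : `|vbase R j| <= 1.
Proof.
apply: norm_le_coord => // i; rewrite vbaseE; case: eqP; rewrite ?normr1 ?normr0 //.
Qed.

Lemma diff_bounded_derivable B f (C : R) p j : 0 <= C -> open B -> diff_bounded 3 C B f
  -> B p ->
  derivable f p (vbase R j).
Proof.
move=> C0 oB H Bp.
have [r /= r0 Br] := (nbhs_ballP _ _).1 (open_nbhs_nbhs (conj oB Bp)).
have inB (x : R) : `|x| < r -> B (p + x *: vbase R j).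
  move=> xr; apply: Br; rewrite -ball_normE /ball_ /= opprD addrA subrr sub0r normrN.
  by rewrite normrZ; apply: le_lt_trans xr; rewrite ler_piMr // norm_vbase.
pose F x := f (p + x *: vbase R j).
have e1 (x : R) : enorm (x *: vbase R j) = `|x| by rewrite enormZ enorm_vbase mulr1.
have [||l Hl] := (cvg_ex _).1 (@derivable_of_differences R F C r C0 r0 _ _).
- move=> x y xr yr xyr.
  have Bv : vertices_in B [:: x *: vbase R j; y *: vbase R j] p.
    rewrite /= -addrA -scalerDl; split; split; try exact: inB.
    by have := inB 0; rewrite normr0 scale0r addr0; exact.
  have := H [:: x *: vbase R j; y *: vbase R j] p isT Bv.
  rewrite !snorm_cons snorm_nil mulr1 !e1 mulrA.
  rewrite /= /F scale0r addr0 scalerDl addrA [X in `|X| <= _ -> _](_ : _ =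
    f (p + x *: vbase R j + y *: vbase R j) - f (p + x *: vbase R j)
    - f (p + y *: vbase R j) + f p) //; ring.
- move=> x xr.
  have Bv : vertices_in B [:: x *: vbase R j] p.
    split; first exact: inB.
    by have := inB 0; rewrite normr0 scale0r addr0; exact.
  have := H [:: x *: vbase R j] p isT Bv; rewrite !snorm_cons snorm_nil mulr1 e1 /=.
  by rewrite /F scale0r addr0.
apply/cvg_ex; exists l; move: Hl; rewrite /F scale0r addr0.
by under eq_fun do rewrite [p + _]addrC.
Qed.

Lemma vertices_in_open B s p (v : E) : open B -> vertices_in B s p ->
  \forall h \near (0 : R)^', vertices_in B s (p + h *: v).
Proof.
move=> oB; elim: s p => [|u s IH] p /=.
  move=> Bp; have [r /= r0 Br] := (nbhs_ballP _ _).1 (open_nbhs_nbhs (conj oB Bp)).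
  have v1 : 0 < `|v| + 1 by rewrite ltr_wpDl.
  near=> h; apply: Br; rewrite -ball_normE /ball_ /= opprD addrA subrr sub0r normrN.
  rewrite normrZ.
  have : `|h| < r / (`|v| + 1) by near: h; apply: dnbhs0_lt; rewrite divr_gt0.
  rewrite ltr_pdivlMr //; apply: le_lt_trans; rewrite ler_wpM2l // lerDl //.
move=> [/IH h1 /IH h2]; near=> h; split; last by near: h.
by rewrite addrAC; near: h.
Unshelve. all: by end_near. Qed.

Lemma fdiff_cvg (s : seq E) (G : R -> E -> R) (g : E -> R) (p : E) B :
  (forall q, B q -> G h q @[h --> 0^'] --> g q) -> vertices_in B s p ->
  fdiff s (G h) p @[h --> 0^'] --> fdiff s g p.
Proof.
move=> H; elim: s p => [|u s IH] p /=; first exact: H.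
by move=> [/IH h1 /IH h2]; exact: cvgB.
Qed.

(** A difference of a derivative is a limit of differences of one order more. *)
Lemma diff_bounded_derive B f (C : R) m j : open B -> diff_bounded m.+1 C B f ->
  (forall q, B q -> derivable f q (vbase R j)) ->
  diff_bounded m C B ('D_(vbase R j) f).
Proof.
move=> oB H df s p sm Bp.
pose G (h : R) q := h^-1 * (f (q + h *: vbase R j) - f q).
have GE : fdiff s (G h) p @[h --> 0^'] --> fdiff s ('D_(vbase R j) f) p.
  apply: fdiff_cvg Bp => q Bq; have := df q Bq; rewrite /derivable /derive.
  have -> : G ^~ q = (fun h => h^-1 *: ((f \o shift q) (h *: vbase R j) - f q)).
    by apply/funext => h; rewrite /G /= [q + _]addrC.
  by [].
have nGE : `|fdiff s (G h) p| @[h --> 0^'] --> `|fdiff s ('D_(vbase R j) f) p|.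
  exact: cvg_norm.
apply: (cvgr_to_le nGE).
near=> h.
have h0 : h != 0 by near: h; exact: nbhs_dnbhs_neq.
have Bph : vertices_in B ((h *: vbase R j) :: s) p.
  by split => //; near: h; exact: vertices_in_open.
have := H ((h *: vbase R j) :: s) p sm Bph; rewrite fdiff_cons snorm_cons enormZ
  enorm_vbase mulr1.
rewrite /G fdiffZ normrM normfV mulrCA ler_pdivrMl ?normr_gt0 //.
Unshelve. all: by end_near. Qed.

Lemma diff_bounded_continuous B g (C : R) p : 0 <= C -> open B -> diff_bounded 2 C B g -> B p ->
  {for p, continuous g}.
Proof.
move=> C0 oB H Bp; apply/(@cvgrPdist_le _ _ _ _ (nbhs_filter p)) => e e0.
have [r /= r0 Br] := (nbhs_ballP _ _).1 (open_nbhs_nbhs (conj oB Bp)).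
have K0 : 0 < C * n%:R + 1 by rewrite ltr_wpDl // mulr_ge0.
apply/nbhs_ballP; exists (Num.min r (e / (C * n%:R + 1))) => /=.
  by rewrite lt_min r0 divr_gt0.
move=> q; rewrite -ball_normE /ball_ /= lt_min => /andP[qr qe].
have Bv : vertices_in B [:: q - p] p.
  by split => //=; rewrite subrKC; apply: Br; rewrite -ball_normE.
have := H [:: q - p] p isT Bv; rewrite snorm_cons snorm_nil mulr1 /= subrKC distrC.
move/le_trans; apply; apply: le_trans (ler_wpM2l C0 (enorm_le_norm _)) _.
move: qe; rewrite ltr_pdivlMr // distrC => qe; have := ltW qe.
have := normr_ge0 (q - p); move: (`|q - p|) => x x0.
rewrite mulrA; move: (C * n%:R) => y; nra.
Qed.

(** The second differences bound the variation of the partial derivatives. *)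
Lemma diff_bounded_differentiable B f (C : R) p : 0 <= C -> open B -> diff_bounded 3 C
  B f -> B p ->
  differentiable f p.
Proof.
move=> C0 oB H Bp.
have df j q : B q -> derivable f q (vbase R j).
  by move=> Bq; apply: diff_bounded_derivable Bq; [exact: C0|exact: oB|exact: H].
apply: (differentiable_of_partials (df := fun j => 'D_(vbase R j) f)) => [|j].
  apply: filterS (open_nbhs_nbhs (conj oB Bp)) => q Bq j.
  by apply: derivableP; exact: df.
apply: (@diff_bounded_continuous B _ C) => //.
by apply: diff_bounded_derive => // q Bq; exact: df.
Qed.

(** One order is lost, because the differences of order [m + 1] are what makes
    the difference quotients of the derivatives of order [m - 1] converge. *)
Lemma deriv_bounded_of_diff m (C : R) B f : 0 <= C -> open B -> diff_bounded m.+2 C B f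
  -> deriv_bounded m C B f.
Proof.
move=> C0 oB; elim: m f => [|m IH] f H /=; (split; [move=> p Bp|]) => //.
- by have := H [::] p isT Bp; rewrite snorm_nil mulr1.
- by have := H [::] p isT Bp; rewrite snorm_nil mulr1.
have H3 : diff_bounded 3 C B f by exact: diff_bounded_leq H.
split=> [p Bp|j]; first exact: (diff_bounded_differentiable C0 oB H3).
by apply: IH; apply: diff_bounded_derive => // q Bq; by apply: diff_bounded_derivable
  Bq; [exact: C0|exact: oB|exact: H3].
Qed.

End DifferencesToDerivatives.

(** * Functions with bounded derivatives *)

Section Calculus.
Variables (R : realType) (n : nat).
Local Notation E := 'rV[R]_n.
Implicit Types (f g : E -> R) (p q u v : E) (B O : set E).

Lemma compact_uniform (K : set E) (P : E -> R -> Prop) : compact K ->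
  (forall x, K x -> exists M, \forall y \near x, P y M) ->
  (forall x M M', M <= M' -> P x M -> P x M') ->
  exists2 M, 0 <= M & forall x, K x -> P x M.
Proof.
move=> cK H mono.
have := (compact_near_coveringP K).1 cK R (+oo)%R (fun M x => P x M).
case=> [x /H[M HM]|M0 [_ HM0]].
  exists ([set y | P y M], [set M' | M < M']) => /=; last first.
    by move=> [y M'] /= [Py MM']; apply: mono Py; exact: ltW.
  by split => //; exists M; split; first exact: num_real.
exists (`|M0| + 1); first by rewrite addr_ge0.
move=> x Kx; apply: HM0 => //; apply: le_lt_trans (ler_norm _) _.
by rewrite ltrDl.
Qed.


Lemma near_eq_differentiable f g p : (\near p, f p = g p) ->
  differentiable f p -> differentiable g p.
Proof.
move=> fg [[_ fE]]; apply: (@differentiable_linear_approx R n g p ('d f p)) => e e0.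
have H := eqadd_some_oP fE e0.
have lp : lim (nbhs p) = p by exact: lim_id.
near=> x.
have -> : g x = f x by symmetry; near: x.
have -> : g p = f p by symmetry; exact: nbhs_singleton fg.
have : `|f x - (f (lim (nbhs p)) + 'd f p (x - lim (nbhs p)))| <= e * `|x - lim (nbhs p)|.
  by near: x; exact: H.
rewrite lp; congr (`| _ | <= _).
by rewrite -addrA -opprD.
Unshelve. all: by end_near. Qed.

Lemma deriv_bounded_eq m (L : R) O f g : open O -> (forall p, O p -> f p = g p) ->
  deriv_bounded m L O f -> deriv_bounded m L O g.
Proof.
move=> oO; elim: m f g => [|m IH] f g fg [Hf H] /=;
  (split; first by move=> p Op; rewrite -fg //; exact: Hf) => //.
have nfg p : O p -> \near p, f p = g p.
  by move=> Op; apply: filterS (open_nbhs_nbhs (conj oO Op)) => q; exact: fg.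
case: H => Hd HD; split=> [p Op|j].
  exact: near_eq_differentiable (nfg p Op) (Hd p Op).
apply: IH (HD j) => p Op; exact: near_eq_derive (nfg p Op).
Qed.

Lemma deriv_bounded_cst m c O : deriv_bounded m `|c| O (fun _ : E => c).
Proof.
have cst0 (m' : nat) : deriv_bounded m' `|c| O (fun _ : E => 0).
  elim: m' => [|m' IH] /=; (split; first by move=> p _; rewrite normr0) => //.
  split=> [p _|j]; first exact: differentiable_cst.
  have -> : 'D_(vbase R j) (fun _ : E => 0) = (fun _ => 0 : R).
    by apply/funext => p; exact: derive_cst.
  exact: IH.
case: m => [|m] /=; (split; first by []) => //.
split=> [p _|j]; first exact: differentiable_cst.
have -> : 'D_(vbase R j) (fun _ : E => c) = (fun _ => 0 : R).
  by apply/funext => p; exact: derive_cst.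
exact: cst0.
Qed.

Lemma deriv_bounded_add m (L L' : R) O f g : open O -> deriv_bounded m L O f ->
  deriv_bounded m L' O g ->
  deriv_bounded m (L + L') O (fun p => f p + g p).
Proof.
move=> oO; elim: m f g => [|m IH] f g [Hf Df] [Hg Dg] /=; (split;
  first by move=> p Op; apply: le_trans (ler_normD _ _) _; apply: lerD;
    [exact: Hf|exact: Hg]) => //.
case: Df Dg => [df Df] [dg Dg]; split=> [p Op|j].
  by apply: differentiableD; [exact: df|exact: dg].
apply: deriv_bounded_eq (IH _ _ (Df j) (Dg j)) => // p Op.
by rewrite deriveD //; apply: diff_derivable; [exact: df|exact: dg].
Qed.

Lemma deriv_bounded_sum (I : Type) (r : seq I) m (L : I -> R) O (F : I -> E -> R) : open O ->
  (forall i, deriv_bounded m (L i) O (F i)) ->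
  deriv_bounded m (\sum_(i <- r) L i) O (fun p => \sum_(i <- r) F i p).
Proof.
move=> oO H; elim: r => [|i r IH].
  have := deriv_bounded_cst m 0 O; rewrite normr0 big_nil.
  by apply: deriv_bounded_eq => // p _; rewrite big_nil.
rewrite big_cons; apply: deriv_bounded_eq (deriv_bounded_add oO (H i) IH) => // p _.
by rewrite big_cons.
Qed.

Lemma deriv_bounded_mul m (La Lb : R) O f g : open O -> 0 <= La -> 0 <= Lb ->
  deriv_bounded m La O f -> deriv_bounded m Lb O g -> deriv_bounded m (2 ^+ m * La *
    Lb) O (fun p => f p * g p).
Proof.
move=> oO La0 Lb0.
have bound m' (a b : E -> R) : deriv_bounded m' La O a -> deriv_bounded m' Lb O b ->
   forall p, O p -> `|a p * b p| <= 2 ^+ m' * La * Lb.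
  move=> /deriv_bounded_bound Ha /deriv_bounded_bound Hb p Op; rewrite normrM -mulrA.
  apply: le_trans (ler_pM (normr_ge0 _) (normr_ge0 _) (Ha _ Op) (Hb _ Op)) _.
  by rewrite ler_peMl ?mulr_ge0 // exprn_ege1 // ler1n.
elim: m f g => [|m IH] f g Hf Hg; (split; first exact: (bound _ _ _ Hf Hg)) => //.
have Hf' := deriv_bounded_leq (leqnSn m) (lexx La) (@subset_refl _ O) Hf.
have Hg' := deriv_bounded_leq (leqnSn m) (lexx Lb) (@subset_refl _ O) Hg.
case: Hf Hg => _ [df Df] [_ [dg Dg]]; split=> [p Op|j].
  by apply: differentiableM; [exact: df|exact: dg].
rewrite exprS -!mulrA mulr_natl mulr2n !mulrA.
apply: deriv_bounded_eq (deriv_bounded_add oO (IH _ _ (Df j) Hg') (IH _ _ Hf' (Dg j)))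
  => // p Op.
rewrite deriveM; last 2 first.
- by apply: diff_derivable; exact: df.
- by apply: diff_derivable; exact: dg.
by rewrite addrC [X in _ + X = _]mulrC.
Qed.

Lemma deriv_bounded_prod (I : Type) (r : seq I) m (M : R) : 0 <= M ->
  exists2 C, 0 <= C & forall O (F : I -> E -> R), open O ->
    (forall i, deriv_bounded m M O (F i)) -> deriv_bounded m C O (fun p => \prod_(i <-
      r) F i p).
Proof.
move=> M0; elim: r => [|i r [C C0 IH]].
  exists 1 => // O F oO _; have := deriv_bounded_cst m 1 O; rewrite normr1.
  by apply: deriv_bounded_eq => // p _; rewrite big_nil.
exists (2 ^+ m * M * C); first by rewrite !mulr_ge0 ?exprn_ge0.
move=> O F oO HF; apply: deriv_bounded_eq (deriv_bounded_mul oO M0 C0 (HF i) (IH O F oO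
  HF)) => // p _.
by rewrite big_cons.
Qed.

Lemma deriv_bounded_det k m (M : R) : 0 <= M -> exists2 C, 0 <= C &
  forall O (F : 'I_k -> 'I_k -> E -> R), open O ->
    (forall i j, deriv_bounded m M O (F i j)) -> deriv_bounded m C O (fun p => \det
      (\matrix_(i, j) F i j p)).
Proof.
move=> M0; have [C C0 HC] := deriv_bounded_prod (index_enum 'I_k) m M0.
exists (\sum_(s : 'S_k) 2 ^+ m * 1 * C).
  by apply: sumr_ge0 => s _; rewrite !mulr_ge0 ?exprn_ge0.
move=> O F oO HF.
have H (s : 'S_k) : deriv_bounded m (2 ^+ m * 1 * C) O
    (fun p => (-1) ^+ s * \prod_(i <- index_enum 'I_k) F i (s i) p).
  have sgn1 := deriv_bounded_cst m ((-1) ^+ s) O.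
  rewrite normrX normrN1 expr1n in sgn1.
  exact: deriv_bounded_mul oO ler01 C0 sgn1 (HC O (fun i => F i (s i)) oO _).
apply: deriv_bounded_eq (deriv_bounded_sum _ oO H) => // p _; apply: eq_bigr => s _;
  congr (_ * _).
by apply: eq_bigr => i _; rewrite mxE.
Qed.

Lemma differentiable_coords (X : E -> E) p :
  (forall i, differentiable (fun q => X q 0 i) p) -> differentiable X p.
Proof.
move=> H; have -> : X = \sum_(i < n) (fun q => X q 0 i *: vbase R i).
  by apply/funext => q; rewrite fct_sumE; exact: row_expand.
by apply: differentiable_sum => i; exact: differentiableZl.
Qed.

Lemma derive_coord (W : normedModType R) (X : W -> E) (p v : W) i : derivable X p v ->
  'D_v X p 0 i = 'D_v (fun x : W => X x 0 i) p.
Proof. by move=> dX; rewrite derive_mx // mxE. Qed.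

Lemma derive_comp f (X : E -> E) p v :
  (forall i, differentiable (fun q => X q 0 i) p) -> differentiable f (X p) ->
  'D_v (fun q => f (X q)) p
    = \sum_i 'D_(vbase R i) f (X p) * 'D_v (fun q => X q 0 i) p.
Proof.
move=> HX df; have dX := differentiable_coords HX.
rewrite deriveE; last exact: differentiable_comp.
rewrite (diff_comp dX df) /= -deriveE // derive_expand //; apply: eq_bigr => i _.
by rewrite mulrC -deriveE // derive_coord //; exact: diff_derivable.
Qed.

(** The constant does not depend on [f], and the bound is linear in that of [f]:
    it will be applied to pullbacks of arbitrary forms by a fixed flow. *)
Lemma deriv_bounded_comp m (M : R) : 0 <= M -> exists2 C, 0 <= C &
  forall O B f (X : E -> E) L, 0 <= L -> open B -> (forall p, B p -> O (X p)) ->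
    deriv_bounded m L O f -> (forall i, deriv_bounded m M B (fun p => X p 0 i)) ->
    deriv_bounded m (C * L) B (fun p => f (X p)).
Proof.
move=> M0; elim: m => [|m [C C0 IH]].
  exists 1 => // O B f X L L0 oB BO [Hf _] _; split => // p Bp.
  by rewrite mul1r; exact/Hf/BO.
pose D := n%:R * (2 ^+ m * C * M).
have D0 : 0 <= D by rewrite !mulr_ge0 ?exprn_ge0.
exists (1 + D) => [|O B f X L L0 oB BO [Hf [df Df]] HX]; first by rewrite addr_ge0.
split=> [p Bp|].
  by apply: le_trans (Hf _ (BO _ Bp)) _; rewrite ler_peMl // lerDl.
have dX p i : B p -> differentiable (fun q => X q 0 i) p.
  by move=> Bp; have [_ [+ _]] := HX i; apply.
split=> [p Bp|j].
  apply: (differentiable_comp (f := X)); last exact/df/BO.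
  by apply: differentiable_coords => i; exact: dX.
have HX' i := deriv_bounded_leq (leqnSn m) (lexx M) (@subset_refl _ B) (HX i).
have H i : deriv_bounded m (2 ^+ m * (C * L) * M) B (fun p =>
    'D_(vbase R i) f (X p) * 'D_(vbase R j) (fun q => X q 0 i) p).
  apply: deriv_bounded_mul => //; first by rewrite mulr_ge0.
    exact: (IH O B ('D_(vbase R i) f) X L L0 oB BO (Df i) HX').
  by have [_ [_ +]] := HX i; apply.
apply: (@deriv_bounded_leq _ _ m m ((1 + D) * L) (\sum_(i < n) 2 ^+ m * (C * L) * M) B B) => //.
  rewrite sumr_const card_ord -[leLHS]mulr_natl mulrDl mul1r /D.
  have -> : n%:R * (2 ^+ m * (C * L) * M) = n%:R * (2 ^+ m * C * M) * L by ring.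
  by rewrite lerDr.
apply: deriv_bounded_eq (deriv_bounded_sum _ oB H) => // p Bp.
by rewrite derive_comp //; [move=> i; exact: dX|exact/df/BO].
Qed.

(** Here [F s] stands for the iterated partial derivative along [s]. At each
    order, total differentiability comes from the continuity of the next one. *)
Lemma smooth_deriv_bounded O (F : seq 'I_n -> E -> R) : open O ->
  (forall s, exists M : R, forall p, O p -> `|F s p| <= M) ->
  (forall s p, O p -> {for p, continuous (F s)}) ->
  (forall s p j, O p -> is_derive p (vbase R j) (F s) (F (j :: s) p)) ->
  forall m s, exists2 L, 0 <= L & deriv_bounded m L O (F s).
Proof.
move=> oO HM HC HF; elim=> [|m IH] s.
  have [M HMs] := HM s; exists `|M| => //; split => // p /HMs/le_trans; apply.
  exact: ler_norm.
have [M HMs] := HM s.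
have /choice[L HL] : forall j, exists L, 0 <= L /\ deriv_bounded m L O (F (j :: s)).
  by move=> j; have [L ? ?] := IH (j :: s); exists L.
have L0 : 0 <= \sum_j L j by apply: sumr_ge0 => j _; case: (HL j).
exists (`|M| + \sum_j L j); first by rewrite addr_ge0.
split=> [p Op|]; first by rewrite (le_trans (HMs p Op)) // (le_trans (ler_norm _)) // lerDl.
split=> [p Op|j].
  apply: (differentiable_of_partials (df := fun j => F (j :: s))) => [|j].
    apply: filterS (open_nbhs_nbhs (conj oO Op)) => q Oq j.
    exact: HF.
  exact: HC.
apply: (@deriv_bounded_eq _ _ _ (F (j :: s))) => // [p Op|].
  by have [_ ->] := HF s p j Op.
apply: deriv_bounded_leq (HL j).2 => //; rewrite (bigD1 j) //= addrCA lerDl addr_ge0 //.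
by apply: sumr_ge0 => i _; case: (HL i).
Qed.

End Calculus.

(** * Derivatives in time and Gronwall's inequality *)

Section TimeDerivatives.
Variable R : realType.
Implicit Types (f g z : R -> R) (a b t T : R).

(** Derivatives on the half-open interval [0, T[ : at the endpoint only
    continuity is recorded, which is all that the mean value theorem uses. *)
Definition time_derivative T f f' : Prop :=
  (forall t, 0 < t < T -> is_derive t 1 f (f' t)) /\ f x @[x --> 0^'+] --> f 0.

Lemma time_derivative_eqr T f f' g' : (forall t, 0 < t < T -> f' t = g' t) ->
  time_derivative T f f' -> time_derivative T f g'.
Proof. by move=> E [H1 H2]; split => // t tT; rewrite -E //; exact: H1. Qed.

Lemma time_derivative_eql T f g f' : 0 < T -> (forall t, 0 <= t < T -> f t = g t) ->
  time_derivative T f f' -> time_derivative T g f'.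
Proof.
move=> T0 E [H1 H2]; split=> [t /andP[t0 tT]|].
  apply: near_eq_is_derive (H1 _ _); last by rewrite t0.
  near=> s; apply: E; apply/andP; split.
    by apply: ltW; near: s; exact: lt_nbhsr.
  by near: s; exact: lt_nbhsl.
rewrite -E ?lexx //; apply: cvg_trans H2; apply: near_eq_cvg.
near=> s; apply: E; apply/andP; split.
  by apply: ltW; near: s; exact: nbhs_right_gt.
by near: s; exact: nbhs_right_lt.
Unshelve. all: by end_near. Qed.

Lemma time_derivative_cst T c : time_derivative T (fun=> c) (fun=> 0).
Proof. by split=> [t _|]; [exact: is_derive_cst|exact: cvg_cst]. Qed.

Lemma time_derivative_id T : time_derivative T id (fun=> 1).
Proof.
split=> [t _|]; first exact: is_derive_id.
exact: cvg_at_right_filter cvg_id.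
Qed.

Lemma time_derivative_add T f f' g g' : time_derivative T f f' -> time_derivative T g g' ->
  time_derivative T (fun t => f t + g t) (fun t => f' t + g' t).
Proof.
move=> [f1 f2] [g1 g2]; split=> [t tT|]; last exact: cvgD.
by apply: is_deriveD; [exact: f1|exact: g1].
Qed.

Lemma time_derivative_mul T f f' g g' : time_derivative T f f' -> time_derivative T g g' ->
  time_derivative T (fun t => f t * g t) (fun t => f' t * g t + f t * g' t).
Proof.
move=> [f1 f2] [g1 g2]; split=> [t tT|]; last exact: cvgM.
apply: is_derive_eq; first by apply: is_deriveM; [exact: f1|exact: g1].
by rewrite addrC [X in X + _ = _]mulrC.
Qed.

Lemma time_derivative_scale T c f f' : time_derivative T f f' -> time_derivative T (fun
  t => c * f t) (fun t => c * f' t).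
Proof.
move=> H; apply: time_derivative_eqr (time_derivative_mul (time_derivative_cst T c) H)
  => t _ /=.
by rewrite mul0r add0r.
Qed.

Lemma time_derivative_sub T f f' g g' : time_derivative T f f' -> time_derivative T g g' ->
  time_derivative T (fun t => f t - g t) (fun t => f' t - g' t).
Proof.
move=> [f1 f2] [g1 g2]; split=> [t tT|]; last exact: cvgB.
by apply: is_deriveB; [exact: f1|exact: g1].
Qed.

Lemma time_derivative_sum (I : Type) (r : seq I) T (F F' : I -> R -> R) :
  (forall i, time_derivative T (F i) (F' i)) ->
  time_derivative T (fun t => \sum_(i <- r) F i t) (fun t => \sum_(i <- r) F' i t).
Proof.
move=> H; elim: r => [|i r IH].
  have -> : (fun t => \sum_(i <- [::]) F i t) = (fun=> 0).
    by apply/funext => t; rewrite big_nil.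
  by apply: time_derivative_eqr (time_derivative_cst T 0) => t _; rewrite big_nil.
have -> : (fun t => \sum_(i <- i :: r) F i t) = (fun t => F i t + \sum_(i <- r) F i t).
  by apply/funext => t; rewrite big_cons.
by apply: time_derivative_eqr (time_derivative_add (H i) IH) => t _; rewrite big_cons.
Qed.

Lemma time_derivative_prod (I : eqType) (r : seq I) T (F F' : I -> R -> R) : uniq r ->
  (forall i, time_derivative T (F i) (F' i)) ->
  time_derivative T (fun t => \prod_(i <- r) F i t)
    (fun t => \sum_(i <- r) \prod_(j <- r) (if j == i then F' j t else F j t)).
Proof.
move=> + H; elim: r => [_|i r IH /= /andP[ir ur]].
  have -> : (fun t => \prod_(i <- [::]) F i t) = (fun=> 1).
    by apply/funext => t; rewrite big_nil.
  by apply: time_derivative_eqr (time_derivative_cst T 1) => t _; rewrite big_nil.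
have -> : (fun t => \prod_(i <- i :: r) F i t) = (fun t => F i t * \prod_(i <- r) F i t).
  by apply/funext => t; rewrite big_cons.
apply: time_derivative_eqr (time_derivative_mul (H i) (IH ur)) => t _; rewrite
  big_cons; congr (_ + _).
  rewrite big_cons eqxx; congr (_ * _); apply: eq_big_seq => j jr.
  by case: eqP => // ji; rewrite -ji jr in ir.
rewrite mulr_sumr; apply: eq_big_seq => j jr.
by rewrite big_cons; case: eqP => // ij; rewrite ij jr in ir.
Qed.

(** Leibniz' formula and the product rule. *)
Lemma time_derivative_det k T (F F' : 'I_k -> 'I_k -> R -> R) :
  (forall i j, time_derivative T (F i j) (F' i j)) ->
  time_derivative T (fun t => \det (\matrix_(i, j) F i j t))
    (fun t => \sum_a \det (\matrix_(i, j) (if i == a then F' i j t else F i j t))).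
Proof.
move=> H.
pose P (s : 'S_k) t := \prod_(i <- index_enum 'I_k) F i (s i) t.
pose P' (s : 'S_k) t := \sum_(a <- index_enum 'I_k) \prod_(i <- index_enum 'I_k)
  (if i == a then F' i (s i) t else F i (s i) t).
have HP (s : 'S_k) : time_derivative T (fun t => (-1) ^+ s * P s t) (fun t => (-1) ^+ s
  * P' s t).
  by apply: time_derivative_scale; apply: time_derivative_prod => // ; exact: index_enum_uniq.
have := time_derivative_sum (index_enum 'S_k) HP.
have -> : (fun t => \sum_(s : 'S_k) (-1) ^+ s * P s t) =
    (fun t => \det (\matrix_(i, j) F i j t)).
  apply/funext => t; apply: eq_bigr => s _; congr (_ * _).
  by apply: eq_bigr => i _; rewrite mxE.
apply: time_derivative_eqr => t _; rewrite /determinant exchange_big /=; apply: eq_bigr => s _.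
rewrite mulr_sumr; apply: eq_bigr => a _; congr (_ * _).
by apply: eq_bigr => i _; rewrite mxE.
Qed.

Lemma time_derivative_cvg T f f' t : time_derivative T f f' -> 0 <= t < T -> forall e, 0 < e ->
  \forall s \near t, 0 <= s -> `|f s - f t| < e.
Proof.
move=> [H1 H2] /andP[]; rewrite le_eqVlt => /orP[/eqP <- _ e e0|t0 tT e e0].
  have /cvgrPdist_lt/(_ e e0) := H2.
  rewrite near_withinE => H; near=> s; rewrite le_eqVlt => /orP[/eqP <-|s0].
    by rewrite subrr normr0.
  by rewrite distrC; move: s0; near: s; exact: H.
have dft : derivable f t 1 by case: (H1 t); rewrite ?t0.
have ct : {for t, continuous f}.
  by apply: differentiable_continuous; exact/derivable1_diffP.
have /cvgrPdist_lt/(_ e e0) := ct.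
by apply: filterS => s + _; rewrite distrC.
Unshelve. all: by end_near. Qed.

Lemma time_derivative_MVT T f f' a b : time_derivative T f f' -> 0 <= a -> a < b -> b < T ->
  exists2 c, a < c < b & f b - f a = f' c * (b - a).
Proof.
move=> H a0 ab bT; have [|//|c] := @MVT R f f' a b ab.
- move=> x; rewrite in_itv /= => /andP[ax xb]; apply: H.1.
  by rewrite (le_lt_trans a0 ax) (lt_trans xb bT).
- apply/continuous_within_itvP => //; split.
  + move=> x; rewrite in_itv /= => /andP[ax xb].
    apply/cvgrPdist_lt => e e0.
    have xT : 0 <= x < T by rewrite (ltW (le_lt_trans a0 ax)) (lt_trans xb bT).
    have := time_derivative_cvg H xT e0; apply: filter_app; near=> s => + .
    rewrite distrC; apply; apply: le_trans a0 _; apply: ltW; near: s.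
    exact: lt_nbhsr.
  + apply/cvgrPdist_lt => e e0; rewrite near_withinE.
    have aT : 0 <= a < T by rewrite a0 (lt_trans ab bT).
    have := time_derivative_cvg H aT e0; apply: filterS => s + sa.
    by rewrite distrC; apply; rewrite (le_trans a0) // ltW.
  + apply/cvgrPdist_lt => e e0; rewrite near_withinE.
    have bT' : 0 <= b < T by rewrite bT (le_trans a0 (ltW ab)).
    have b0 : 0 < b by apply: le_lt_trans ab.
    have := time_derivative_cvg H bT' e0; apply: filter_app; near=> s => + _.
    by rewrite distrC; apply; apply: ltW; near: s; exact: lt_nbhsr.
- by rewrite in_itv /= => cab E; exists c.
Unshelve. all: by end_near. Qed.

Lemma time_derivative_lipschitz T f f' (M b s t : R) : time_derivative T f f' -> b < T ->
  (forall c, 0 <= c <= b -> `|f' c| <= M) -> 0 <= s <= b -> 0 <= t <= b ->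
  `|f s - f t| <= M * `|s - t|.
Proof.
move=> H bT HM; wlog st : s t / t <= s.
  have [ts|st] := leP t s; first by apply.
  by move=> W hs ht; rewrite distrC (distrC s); apply: W => //; exact: ltW.
move=> /andP[s0 sb] /andP[t0 tb]; move: st; rewrite le_eqVlt => /orP[/eqP ->|ts].
  by rewrite !subrr normr0 mulr0.
have [c /andP[tc cs] ->] := time_derivative_MVT H t0 ts (le_lt_trans sb bT).
rewrite normrM ler_wpM2r //; apply: HM.
by rewrite (le_trans t0 (ltW tc)) (le_trans (ltW cs) sb).
Qed.

(** A first-order Taylor bound, which survives pointwise limits of [f] and
    [f'] under a uniform bound on [f'']. *)
Lemma time_derivative_taylor T f f' f'' (M b s t : R) : time_derivative T f f' ->
  time_derivative T f' f'' -> b < T ->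
  (forall c, 0 <= c <= b -> `|f'' c| <= M) -> 0 <= s <= b -> 0 <= t <= b ->
  `|f s - f t - (s - t) * f' t| <= M * `|s - t| ^+ 2.
Proof.
move=> H H' bT HM hs ht.
have [s0 sb] := andP hs; have [t0 tb] := andP ht.
have M0 : 0 <= M by apply: le_trans (normr_ge0 _) (HM 0 _); rewrite lexx (le_trans s0).
have [c [cb cst E]] : exists c, [/\ 0 <= c <= b, `|c - t| <= `|s - t| &
    f s - f t = f' c * (s - t)].
  have [st|ts|->] := ltgtP s t; last first.
  - by exists t; rewrite !subrr mulr0; split.
  - have [c /andP[tc cs] E] := time_derivative_MVT H t0 ts (le_lt_trans sb bT).
    exists c; split => //; first by rewrite (le_trans t0 (ltW tc)) (le_trans (ltW cs)).
    by rewrite !ger0_norm ?subr_ge0 ?(ltW ts) ?(ltW tc) // lerD2r ltW.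
  - have [c /andP[sc ct] E] := time_derivative_MVT H s0 st (le_lt_trans tb bT).
    exists c; split; first by rewrite (le_trans s0 (ltW sc)) (le_trans (ltW ct)).
      by rewrite !ler0_norm ?subr_le0 ?(ltW st) ?(ltW ct) // lerN2 lerD2r ltW.
    by rewrite -opprB E -mulrN opprB.
rewrite E mulrC -mulrBr normrM mulrC expr2 mulrA ler_wpM2r //.
apply: le_trans (time_derivative_lipschitz H' bT HM cb ht) _.
by rewrite ler_wpM2l.
Qed.

Lemma has_time_deriv_taylor T f f' (t b M : R) : 0 <= t < b -> b < T ->
  (forall s, 0 <= s <= b -> `|f s - f t - (s - t) * f' t| <= M * `|s - t| ^+ 2) ->
  has_time_deriv T (f : R -> R^o) t (f' t).
Proof.
move=> /andP[t0 tb] bT H; rewrite /has_time_deriv; apply/cvgrPdist_le => e e0.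
rewrite near_withinE; near=> s => /andP[s0 _].
have st : s != t by near: s; exact: nbhs_dnbhs_neq.
have sb : s <= b by apply: ltW; near: s; apply: nbhs_dnbhs; exact: lt_nbhsl.
have st0 : s - t != 0 by rewrite subr_eq0.
have := H s; rewrite s0 sb => /(_ isT) {}H.
have ns : 0 < `|s - t| by rewrite normr_gt0.
rewrite distrC [_ *: _]/(_ * _).
have -> : (s - t)^-1 * (f s - f t) - f' t = (f s - f t - (s - t) * f' t) / (s - t).
  by field.
rewrite normrM normfV ler_pdivrMr //; apply: le_trans H _.
rewrite expr2 mulrA ler_wpM2r //.
have M1 : 0 < `|M| + 1 by rewrite ltr_wpDl.
have : `|s - t| < e / (`|M| + 1).
  near: s; apply: nbhs_dnbhs; apply/nbhs_ballP; exists (e / (`|M| + 1)) => /=.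
    by rewrite divr_gt0.
  by move=> s; rewrite -ball_normE /ball_ /= distrC.
rewrite ltr_pdivlMr // => h.
have h1 : M * `|s - t| <= `|M| * `|s - t| by rewrite ler_wpM2r // ler_norm.
apply: le_trans h1 _; nra.
Unshelve. all: by end_near. Qed.

Lemma time_derivative_of_has T f f' : 0 < T ->
  (forall t, 0 <= t < T -> has_time_deriv T (f : R -> R^o) t (f' t)) -> time_derivative T f f'.
Proof.
move=> T0 H; split=> [t /andP[t0 tT]|].
  have tT' : 0 <= t < T by rewrite ltW.
  have Hq : h^-1 *: ((f \o shift t) (h *: 1) - f t) @[h --> 0^'] --> (f' t : R^o).
    have /cvgrPdist_le Ht := H t tT'.
    apply/cvgrPdist_le => e e0; have := Ht e e0.
    rewrite near_withinE => /nbhs_ballP[d /= d0 Hd].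
    have d'0 : 0 < Num.min d (Num.min t (T - t)) by rewrite !lt_min d0 t0 subr_gt0.
    near=> h.
    have h0 : h != 0 by near: h; exact: nbhs_dnbhs_neq.
    have : `|h| < Num.min d (Num.min t (T - t)) by near: h; exact: dnbhs0_lt.
    rewrite !lt_min => /and3P[hd ht hT].
    have := Hd (h + t); rewrite /= addrK [h *: 1]mulr1; apply => //.
    - by rewrite -ball_normE /ball_ /= opprD addrCA subrr addr0 normrN.
    - by rewrite -subr_eq0 addrK.
    - move: ht hT; rewrite !ltr_norml => /andP[h1 _] /andP[_ h2]; lra.
  apply: DeriveDef; first by apply/cvg_ex; exists (f' t).
  exact: cvg_lim Hq.
have T0' : 0 <= (0 : R) < T by apply/andP.
have /cvgrPdist_le/(_ 1 ltr01) := H 0 T0'.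
rewrite near_withinE => /nbhs_ballP[d /= d0 Hd].
apply/cvgrPdist_le => e e0; rewrite near_withinE.
have K0 : 0 < `|f' 0| + 1 by rewrite ltr_wpDl.
near=> s => s0.
have : s < Num.min d (Num.min T (e / (`|f' 0| + 1))).
  by near: s; apply: lt_nbhsl; rewrite !lt_min d0 T0 divr_gt0.
rewrite !lt_min => /and3P[sd sT]; rewrite ltr_pdivlMr // => se.
have := Hd s; rewrite /= subr0 [_ *: _]/(_ * _) => h.
have {}h : `|f' 0 - s^-1 * (f s - f 0)| <= 1.
  apply: h; rewrite ?gt_eqF ?(ltW s0) //.
  by rewrite -ball_normE /ball_ /= sub0r normrN gtr0_norm.
have -> : f 0 - f s = s * (f' 0 - s^-1 * (f s - f 0)) - s * f' 0.
  by field; rewrite gt_eqF.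
apply: le_trans (ler_normB _ _) _; rewrite !normrM (gtr0_norm s0) -mulrDr.
apply: le_trans (ltW se); rewrite ler_wpM2l ?(ltW s0) // addrC lerD2l //.
Unshelve. all: by end_near. Qed.


(** The function [z s * exp (- K * s) - c * s] is nonincreasing. *)
Lemma gronwall T z z' (K c b : R) : time_derivative T z z' -> 0 <= K -> 0 <= c -> 0 <= b < T ->
  (forall s, 0 < s < b -> z' s <= K * z s + c) ->
  z b <= (z 0 + c * b) * expR (K * b).
Proof.
move=> H K0 c0 /andP[]; rewrite le_eqVlt => /orP[/eqP <- _ _|b0 bT Hz].
  by rewrite !mulr0 addr0 expR0 mulr1.
pose ex (s : R) := expR (- K * s).
have dex (s : R) : is_derive s 1 ex (- K * ex s).
  have dK : is_derive s 1 (fun x : R => - K * x) (- K).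
    have := is_deriveZ (- K) (is_derive_id s (1 : R)).
    by rewrite [_ *: 1]mulr1.
  rewrite mulrC.
  exact: (@is_derive1_comp R expR (fun x => - K * x) s _ _ (is_derive_expR _) dK).
have Tex : time_derivative T ex (fun s => - K * ex s).
  split=> [t _|]; first exact: dex.
  apply: cvg_at_right_filter.
  by apply: differentiable_continuous; apply/derivable1_diffP; case: (dex 0).
have Th := time_derivative_sub (time_derivative_mul H Tex) (time_derivative_scale c
  (time_derivative_id T)).
have [s /andP[s0 sb]] := time_derivative_MVT Th (lexx 0) b0 bT.
have ex0E : ex 0 = 1 by rewrite /ex mulr0 expR0.
rewrite /= ex0E mulr0 !mulr1 !subr0 => E.
have hs : z' s * ex s + z s * (- K * ex s) - c <= 0.
  have ex0 : 0 < ex s by exact: expR_gt0.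
  have ex1 : ex s <= 1 by rewrite /ex -expR0 ler_expR mulNr oppr_le0 mulr_ge0 // ltW.
  have := Hz s; rewrite s0 sb => /(_ isT) h.
  have : (z' s - K * z s) * ex s <= c * ex s by rewrite ler_pM2r // lerBlDl.
  have : c * ex s <= c by rewrite ler_piMr.
  by move=> h1 h2; nra.
have : z b * ex b - c * b - z 0 <= 0.
  by rewrite E; apply: mulr_le0_ge0 => //; exact: ltW.
rewrite subr_le0 lerBlDr => h.
have := ler_wpM2r (ltW (expR_gt0 (K * b))) h.
by rewrite -mulrA /ex -expRD mulNr addNr expR0 mulr1.
Qed.

(** Before the first time at which [z] reaches [D] the differential inequality
    holds, and Gronwall's inequality keeps [z] below [D] at that time too. *)
Lemma gronwall_bootstrap T z z' (K D b : R) : time_derivative T z z' -> 0 <= K -> 0 <= b < T ->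
  0 <= z 0 -> z 0 * expR (K * b) < D ->
  (forall s, 0 <= s <= b -> z s < D -> z' s <= K * z s) ->
  forall s, 0 <= s <= b -> z s < D.
Proof.
move=> H K0 /andP[b0 bT] z0 zD Hz s1 s1b; rewrite ltNge; apply/negP => Ds1.
pose A := [set s | 0 <= s <= b /\ D <= z s].
have A1 : A s1 by split.
have lbA : has_lbound A by exists 0 => s [/andP[]].
have iA : has_inf A by split => //; exists s1.
pose t := inf A.
have t0 : 0 <= t by apply: lb_le_inf; [exists s1|move=> s [/andP[]]].
have tb : t <= b by apply: le_trans (ge_inf lbA A1) _; case/andP: s1b.
have tT : 0 <= t < T by rewrite t0 (le_lt_trans tb).
have below s : 0 <= s < t -> z s < D.
  move=> /andP[s0 st]; rewrite ltNge; apply/negP => Ds.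
  have : A s by split => //; rewrite s0 (le_trans (ltW st)).
  by move=> /(ge_inf lbA); rewrite leNgt st.
have [Dt|tD] := leP D (z t).
  have : z t <= (z 0 + 0 * t) * expR (K * t).
    apply: gronwall H K0 (lexx 0) tT _ => s /andP[s0 st]; rewrite addr0.
    apply: Hz; first by rewrite (ltW s0) (le_trans (ltW st)).
    by apply: below; rewrite ltW.
  rewrite mul0r addr0 leNgt => /negP; apply; apply: lt_le_trans Dt.
  by apply: le_lt_trans zD; rewrite ler_wpM2l // ler_expR ler_wpM2l.
have e0 : 0 < D - z t by rewrite subr_gt0.
have /nbhs_ballP[d /= d0 Hd] := time_derivative_cvg H tT e0.
have [s [sb Ds] std] := inf_adherent d0 iA.
have As : A s by split.
have ts : t <= s := ge_inf lbA As.
have := Hd s; rewrite -ball_normE /ball_ /= distrC ger0_norm ?subr_ge0 //.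
rewrite ltrBlDl => /(_ std); case/andP: (sb) => s0 _ => /(_ s0).
by move=> /(le_lt_trans (ler_norm _)); rewrite ltrD2r ltNge Ds.
Qed.

End TimeDerivatives.

(** * The flow of a bounded smooth field *)

Section SmoothData.
Variables (R : realType) (n : nat).
Local Notation E := 'rV[R]_n.

Lemma bounded_smooth_deriv_bounded (U : set E) (V : E -> E) : open U -> bounded_smooth U V ->
  forall m, exists2 L : R, 0 <= L & forall i, deriv_bounded m L U (fun p => V p 0 i).
Proof.
move=> oU [sV bV] m.
have H i : exists2 L, 0 <= L & deriv_bounded m L U (fun p => V p 0 i).
  apply: (smooth_deriv_bounded (F := fun s p => partials s V p 0 i) oU _ _ _ m [::]).
  - move=> s; have [M HM] := bV s; exists M => p /HM; apply: le_trans.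
    exact: coord_le_norm.
  - move=> s p Up; have [c _] := sV s p Up.
    have dc : differentiable (fun u : E => u 0 i : R) (partials s V p).
      exact: differentiable_coord.
    exact: (@continuous_comp _ _ _ (partials s V) (fun u : E => u 0 i : R) p c
      (differentiable_continuous dc)).
  - move=> s p j Up; have [_ /(_ j) d] := sV s p Up.
    apply: DeriveDef; last by rewrite /= derive_coord.
    by have /derivable_mxP/(_ 0 i) := d.
have /choice[L HL] : forall i, exists L, 0 <= L /\ deriv_bounded m L U (fun p => V p 0 i).
  by move=> i; have [L ? ?] := H i; exists L.
exists (\sum_i L i) => [|i]; first by apply: sumr_ge0 => i _; case: (HL i).
apply: deriv_bounded_leq (HL i).2 => //; rewrite (bigD1 i) //= lerDl.
by apply: sumr_ge0 => j _; case: (HL j).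
Qed.

(** Outside the support, all the partial derivatives vanish. *)
Lemma cutoff_deriv_bounded (g : E -> R) : smooth_on [set: E] (g : E -> R^o) ->
  compact (closure [set p | g p != 0]) ->
  forall m, exists2 L, 0 <= L & deriv_bounded m L [set: E] g.
Proof.
move=> sg cg m; set K := closure _ in cg.
apply: (smooth_deriv_bounded (F := fun s => partials s (g : E -> R^o)) openT _ _ _ m [::]).
- move=> s.
  have [M M0 HM] : exists2 M, 0 <= M & forall p, K p -> `|partials s (g : E -> R^o) p| <= M.
    apply: compact_uniform => // [x Kx|x M M' MM /le_trans]; last exact.
    have [/cvgrPdist_lt/(_ 1 ltr01) c _] := sg s x I.
    exists (`|partials s (g : E -> R^o) x| + 1).
    apply: filterS c => y h; rewrite -lerBlDl.
    by apply: le_trans (lerB_dist _ _) _; rewrite distrC ltW.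
  exists M => p _; have [Kp|nKp] := pselect (K p); first exact: HM.
  have oK : open (~` K) by apply: closed_openC; exact: closed_closure.
  have zero : forall q, (~` K) q -> partials s (g : E -> R^o) q = 0.
    elim: (s) => [|j s' IH] q Kq /=.
      apply/eqP; apply: contra_notT Kq => gq; exact: subset_closure.
    rewrite (@near_eq_derive _ _ _ _ (fun _ => 0)) ?derive_cst //.
    by apply: filterS (open_nbhs_nbhs (conj oK Kq)) => y; exact: IH.
  by rewrite zero // normr0.
- by move=> s p _; have [] := sg s p I.
- by move=> s p j _; have [_ /(_ j)] := sg s p I; exact: derivableP.
Qed.

Lemma has_time_deriv_coord (T : R) (f : R -> E) t l i :
  has_time_deriv T f t l -> has_time_deriv T (fun s => f s 0 i : R^o) t (l 0 i).
Proof.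
move=> /cvgrPdist_le H; apply/cvgrPdist_le => e /H; apply: filterS => s.
by apply: le_trans; apply: le_trans (coord_le_norm _ i); rewrite !mxE.
Qed.

End SmoothData.

Section Flow.
Variables (R : realType) (n : nat).
Local Notation E := 'rV[R]_n.
Variables (U N : set E) (V : E -> E) (T : R) (phi : R -> E -> E).
Hypotheses (oU : open U) (oN : open N) (T0 : 0 < T).
Hypothesis V_deriv_bounded :
  forall m, exists2 L : R, 0 <= L & forall i, deriv_bounded m L U (fun p => V p 0 i).
Hypothesis flow : is_flow U V N T phi.

Lemma flow0 p : N p -> phi 0 p = p.
Proof. by move=> /flow[]. Qed.

Lemma flow_in p t : N p -> 0 <= t < T -> U (phi t p).
Proof. by move=> /flow[_ H] /H[]. Qed.

Lemma flow_time_derivative p i : N p -> time_derivative T (fun t => phi t p 0 i) (fun t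
  => V (phi t p) 0 i).
Proof.
move=> /flow[_ H]; apply: time_derivative_of_has => // t /H[_].
exact: has_time_deriv_coord.
Qed.

Lemma flow_cvg p t : N p -> 0 <= t < T -> forall e, 0 < e ->
  \forall s \near t, 0 <= s -> `|phi s p - phi t p| < e.
Proof.
move=> Np tT e e0; have e2 : 0 < e / 2 by rewrite divr_gt0.
have := filter_forall (F := nbhs t)
  (f := fun i s => 0 <= s -> `|phi s p 0 i - phi t p 0 i| < e / 2) _.
move=> /(_ _ (fun i => time_derivative_cvg (flow_time_derivative i Np) tT e2)).
apply: filterS => s H s0; apply: le_lt_trans (_ : e / 2 < e).
  apply: norm_le_coord => [|i]; first exact: ltW.
  by rewrite !mxE ltW // H.
by rewrite ltr_pdivrMr // ltr_pMr // ltr1n.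
Qed.

(** The chain rule along a trajectory. *)
Lemma flow_time_derivative_comp f p : (forall q, U q -> differentiable f q) -> N p ->
  time_derivative T (fun t => f (phi t p))
    (fun t => \sum_i V (phi t p) 0 i * 'D_(vbase R i) f (phi t p)).
Proof.
move=> df Np; split=> [t tT|].
  have tT' : 0 <= t < T by case/andP: tT => /ltW -> ->.
  have dfq := df _ (flow_in Np tT').
  have dphi : derivable (phi^~ p) t 1.
    by apply/derivable_mxP => i j; rewrite ord1; case: ((flow_time_derivative j Np).1 t tT).
  have dphi' : differentiable (phi^~ p) t by exact/derivable1_diffP.
  apply: DeriveDef.
    by apply/derivable1_diffP; exact: (differentiable_comp dphi' dfq).
  rewrite deriveE; last exact: (differentiable_comp dphi' dfq).
  rewrite (diff_comp dphi' dfq) /= -deriveE // -deriveE // derive_expand //.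
  apply: eq_bigr => i _; congr (_ * _); rewrite derive_coord //.
  by case: ((flow_time_derivative i Np).1 t tT).
have T00 : 0 <= (0 : R) < T by rewrite lexx T0.
have cf : {for phi 0 p, continuous f}.
  by apply: differentiable_continuous; exact/df/flow_in.
have cphi : phi x p @[x --> 0^'+] --> phi 0 p.
  apply/cvgrPdist_lt => e e0; rewrite near_withinE.
  by apply: filterS (flow_cvg Np T00 e0) => s H s0; rewrite distrC H // ltW.
exact: (cvg_comp _ _ cphi cf).
Qed.

(** By compactness. The balls of the tube are convex subsets of [U], on which
    bounds on derivatives of [V] are Lipschitz bounds. *)
Lemma flow_tube p b : N p -> 0 <= b < T ->
  exists2 d, 0 < d & forall s, 0 <= s <= b -> ball (phi s p) d `<=` U.
Proof.
move=> Np /andP[b0 bT].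
have cI : compact (`[0, b]%classic : set R) by exact: segment_compact.
pose P (s M : R) := 0 <= s <= b -> 0 < M /\ ball (phi s p) M^-1 `<=` U.
have := (compact_near_coveringP _).1 cI R (+oo)%R (fun M s => P s M).
case=> [s|M0 [_ HM0]]; last first.
  exists (`|M0| + 1)^-1 => [|s sb]; first by rewrite invr_gt0 ltr_wpDl.
  have : P s (`|M0| + 1).
    apply: HM0; last by rewrite /= in_itv.
    by apply: le_lt_trans (ler_norm _) _; rewrite ltrDl.
  by move=> /(_ sb)[].
rewrite /= in_itv /= => /andP[s0 sb].
have sT : 0 <= s < T by rewrite s0 (le_lt_trans sb).
have [r /= r0 Hr] := (nbhs_ballP _ _).1 (open_nbhs_nbhs (conj oU (flow_in Np sT))).
have r2 : 0 < r / 2 by rewrite divr_gt0.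
exists ([set y | 0 <= y -> `|phi y p - phi s p| < r / 2],
        [set M | 2 / r < M]) => /=.
  by split; [exact: flow_cvg|exists (2 / r); split => //; exact: num_real].
move=> [y M] /= [Hy HM] /andP[y0 yb].
have M0 : 0 < M by apply: lt_trans HM; rewrite divr_gt0.
split=> // q; rewrite -ball_normE /ball_ /= => hq; apply: Hr.
rewrite -ball_normE /ball_ /= -(subrKA (phi y p)).
apply: le_lt_trans (ler_normD _ _) _; rewrite [r]splitr; apply: ltrD.
  by rewrite distrC Hy.
apply: lt_trans hq _; rewrite -[r / 2]invrK ltf_pV2 ?posrE ?invr_gt0 //.
by rewrite invf_div.
Qed.

Let sumsq (y : 'I_n -> R) := \sum_i y i ^+ 2.

Lemma sumsq_norm (u : E) : sumsq (fun i => u 0 i) = enorm u ^+ 2.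
Proof.
rewrite sqr_sqrtr ?dotv_ge0 //; apply: eq_bigr => i _; exact: expr2.
Qed.

Lemma sumsq_coord (y : 'I_n -> R) i : y i ^+ 2 <= sumsq y.
Proof.
by rewrite /sumsq (bigD1 i) //= lerDl sumr_ge0 // => j _; exact: sqr_ge0.
Qed.

(** The Cauchy-Schwarz inequality, for the comparison of norms. *)
Lemma sumsq_l1 (y : 'I_n -> R) : (\sum_i `|y i|) ^+ 2 <= n%:R * sumsq y.
Proof.
rewrite expr2 mulr_suml.
apply: (@le_trans _ _ (\sum_i \sum_j (y i ^+ 2 + y j ^+ 2) / 2)).
  apply: ler_sum => i _; rewrite mulr_sumr; apply: ler_sum => j _.
  rewrite ler_pdivlMr // -subr_ge0.
  have -> : y i ^+ 2 + y j ^+ 2 - `|y i| * `|y j| * 2 = (`|y i| - `|y j|) ^+ 2.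
    by rewrite sqrrB !real_normK ?num_real // -mulr_natr; ring.
  exact: sqr_ge0.
have E1 (i : 'I_n) : \sum_j (y i ^+ 2 + y j ^+ 2) / 2
   = (n%:R * y i ^+ 2 + sumsq y) / 2.
  by rewrite -mulr_suml big_split /= sumr_const card_ord -[X in X + _]mulr_natl.
under eq_bigr => i _ do rewrite E1.
rewrite -mulr_suml big_split /= sumr_const card_ord -mulr_sumr -[X in _ + X]mulr_natl.
by rewrite -/(sumsq y) le_eqVlt; apply/orP; left; apply/eqP; field.
Qed.

Lemma time_derivative_sumsq (y y' : 'I_n -> R -> R) : (forall i, time_derivative T (y
  i) (y' i)) ->
  time_derivative T (fun t => sumsq (fun i => y i t)) (fun t => \sum_i 2 * (y i t * y' i t)).
Proof.
move=> H; apply: time_derivative_sum => i; have E := time_derivative_mul (H i) (H i).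
have -> : (fun t => y i t ^+ 2) = (fun t => y i t * y i t).
  by apply/funext => t; rewrite expr2.
by apply: time_derivative_eqr E => t _; ring.
Qed.

(** As long as the trajectories of [p] and [p0] are [d]-close, the Lipschitz
    bound of [V] applies, and Gronwall's inequality bounds their distance by a
    fixed multiple of the initial one: they remain [d]-close. *)
Lemma flow_stays p0 (b d : R) : N p0 -> 0 <= b < T -> 0 < d ->
  (forall s, 0 <= s <= b -> ball (phi s p0) d `<=` U) ->
  exists2 r, 0 < r & ball p0 r `<=` N /\
    forall s p, 0 <= s <= b -> ball p0 r p -> ball (phi s p0) d (phi s p).
Proof.
move=> Np0 bT d0 Hd.
have [b0 bT'] := andP bT.
have [L L0 HL] := V_deriv_bounded 1.
have [r1 /= r10 Hr1] := (nbhs_ballP _ _).1 (open_nbhs_nbhs (conj oN Np0)).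
pose K := 2 * n%:R * (n%:R * L).
have K0 : 0 <= K by rewrite /K !mulr_ge0.
pose eb := expR (K * b).
have eb0 : 0 < eb by exact: expR_gt0.
have eb1 : 1 <= eb by rewrite /eb -expR0 ler_expR mulr_ge0.
have n1 : 0 < n%:R + 1 :> R by rewrite ltr_wpDl.
pose r := Num.min r1 (d / ((n%:R + 1) * eb)).
have r0 : 0 < r by rewrite lt_min r10 divr_gt0 // mulr_gt0.
have Br1 p : ball p0 r p -> ball p0 r1 p.
  by apply: le_ball; rewrite ge_min lexx.
exists r => //; split=> [p /Br1/Hr1 //|s p sb /[dup] /Br1/Hr1 Np pr].
pose y i t := phi t p 0 i - phi t p0 0 i.
pose y' i t := V (phi t p) 0 i - V (phi t p0) 0 i.
have Ty := time_derivative_sumsq (fun i => time_derivative_sub (flow_time_derivative i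
  Np) (flow_time_derivative i Np0)).
have coords t : sumsq (fun i => y i t) < d ^+ 2 -> ball (phi t p0) d (phi t p).
  move=> zt; rewrite -ball_normE /ball_ /= distrC.
  have [n0|/existsNP[i _]] := pselect (forall i : 'I_n, False).
    by apply: le_lt_trans d0; apply: norm_le_coord => // i; case: (n0 i).
  rewrite [ltLHS]/Num.Def.normr /= mx_normrE; apply: bigmax_lt => // -[j l] _ /=.
  rewrite ord1 !mxE -ltr_sqr ?nnegrE ?(ltW d0) // real_normK ?num_real //.
  by apply: le_lt_trans zt; exact: (sumsq_coord (fun i => y i t)).
apply: (coords); move: s sb; apply: (gronwall_bootstrap Ty K0 bT).
- by apply: sumr_ge0 => i _; exact: sqr_ge0.
- have -> : (fun i : 'I_n => phi 0 p 0 i - phi 0 p0 0 i) = (fun i => (p - p0) 0 i).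
    by apply/funext => i; rewrite !flow0 // !mxE.
  rewrite sumsq_norm -/eb.
  have : enorm (p - p0) * eb < d.
    apply: le_lt_trans (_ : n%:R * `|p - p0| * eb < d).
      by rewrite ler_wpM2r ?(ltW eb0) // enorm_le_norm.
    have : `|p - p0| < d / ((n%:R + 1) * eb).
      move: pr; rewrite -ball_normE /ball_ /= distrC => /lt_le_trans; apply.
      by rewrite ge_min lexx orbT.
    rewrite ltr_pdivlMr ?mulr_gt0 //; apply: le_lt_trans.
    rewrite [n%:R * _]mulrC -mulrA; apply: ler_wpM2l => //.
    by apply: ler_wpM2r; [exact: ltW|rewrite lerDl].
  move: (enorm_ge0 (p - p0)); move: (enorm (p - p0)) => x x0 xd.
  have h1 : x * eb * (x * eb) < d * d by apply: ltr_pM; rewrite ?mulr_ge0 // ltW.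
  rewrite !expr2; apply: le_lt_trans h1.
  by rewrite mulrACA; apply: ler_wpM2l; [exact: mulr_ge0|rewrite ler_peMr // ltW].
- move=> s sb /coords sd.
  have Vb i : `|y' i s| <= n%:R * L * enorm (phi s p - phi s p0).
    have pE : phi s p = phi s p0 + (phi s p - phi s p0) by rewrite subrKC.
    have vs : vertices_in (ball (phi s p0) d) [:: phi s p - phi s p0] (phi s p0).
      by split; rewrite /= ?subrKC //; exact: ballxx.
    have := deriv_bounded_convex (s := [:: phi s p - phi s p0]) (HL i)
      (@ball_convex R n (phi s p0) d) (Hd s sb) isT vs.
    by rewrite /= subrKC snorm_cons snorm_nil mulr1 expr1.
  have yb i : `|y i s| <= enorm (phi s p - phi s p0).
    by have := coord_le_enorm (phi s p - phi s p0) i; rewrite !mxE.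
  have -> : (fun i : 'I_n => phi s p 0 i - phi s p0 0 i)
     = (fun i => (phi s p - phi s p0) 0 i) by apply/funext => i; rewrite !mxE.
  rewrite sumsq_norm.
  have -> : K * enorm (phi s p - phi s p0) ^+ 2 = \sum_(i < n)
     2 * (enorm (phi s p - phi s p0) * (n%:R * L * enorm (phi s p - phi s p0))).
    by rewrite sumr_const card_ord -[RHS]mulr_natl /K; ring.
  apply: ler_sum => i _; apply: ler_wpM2l => //.
  apply: le_trans (ler_norm _) _; rewrite normrM.
  by apply: ler_pM => //; [exact: yb|exact: Vb].
Qed.

End Flow.

(** * Regularity of the flow in space *)

Section FlowRegularity.
Variables (R : realType) (n : nat).
Local Notation E := 'rV[R]_n.
Variables (U N : set E) (V : E -> E) (T : R) (phi : R -> E -> E).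
Hypotheses (oU : open U) (oN : open N) (T0 : 0 < T).
Hypothesis V_deriv_bounded :
  forall m, exists2 L : R, 0 <= L & forall i, deriv_bounded m L U (fun p => V p 0 i).
Hypothesis flow : is_flow U V N T phi.

(** The initial condition for the differences of the flow. *)
Lemma fdiff_coord s (p : E) i : (0 < size s)%N ->
  `|fdiff s (fun q => q 0 i) p| <= (if s is [:: u] then `|u 0 i| else 0).
Proof.
case: s => [//|u [|v s]] _; first by rewrite /= !mxE [_ + u 0 i]addrC addrK.
suff -> : fdiff [:: u, v & s] (fun q : E => q 0 i) p = 0 by rewrite normr0.
rewrite fdiff_cons.
have -> : (fun q : E => (q + u) 0 i - q 0 i) = (fun=> u 0 i).
  by apply/funext => q; rewrite !mxE [_ + u 0 i]addrC addrK.
rewrite fdiff_cons; under eq_fun do rewrite subrr.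
by elim: s p => [//|w s IH] p /=; rewrite !IH subrr.
Qed.

(** Differences of every order of the time-[s] maps are bounded uniformly for
    [s] in [0, b]: those of top order satisfy a linear differential inequality
    whose source term only involves the lower orders. *)
Lemma flow_diff_bounded (b d r : R) p0 m : N p0 -> 0 <= b < T -> 0 < r ->
  (forall s, 0 <= s <= b -> ball (phi s p0) d `<=` U) ->
  ball p0 r `<=` N ->
  (forall s p, 0 <= s <= b -> ball p0 r p -> ball (phi s p0) d (phi s p)) ->
  exists2 C, 0 <= C & forall s i, 0 <= s <= b ->
    diff_bounded m C (ball p0 r) (fun p => phi s p 0 i).
Proof.
move=> Np0 bT r0 Hd Hr Hs; have [b0 bT'] := andP bT.
elim: m => [|[|m] [C C0 HC]]; first by exists 0.
  have [L L0 HL] := V_deriv_bounded 0.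
  exists (`|p0| + r + L * b) => [|s i sb [|//] p _ Bp].
    by rewrite !addr_ge0 ?mulr_ge0 // ltW.
  have Np := Hr _ Bp; rewrite snorm_nil mulr1 /=.
  have -> : phi s p 0 i = p0 0 i - (p0 - p) 0 i + (phi s p 0 i - phi 0 p 0 i).
    by rewrite (flow0 flow Np) !mxE; ring.
  apply: le_trans (ler_normD _ _) _; apply: lerD.
    apply: le_trans (ler_normB _ _) _; apply: lerD; first exact: coord_le_norm.
    by apply: le_trans (coord_le_norm _ _) _; move: Bp; rewrite -ball_normE => /ltW.
  have [s0 sb'] := andP sb.
  apply: le_trans (time_derivative_lipschitz (flow_time_derivative T0 flow i Np) bT' _ sb _) _.
  - move=> c cb; apply: (deriv_bounded_bound (HL i)); apply: (flow_in flow Np).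
    by case/andP: cb => -> /= cb; apply: le_lt_trans bT'.
  - by rewrite lexx b0.
  - by rewrite subr0 ger0_norm // ler_wpM2l.
have [L L0 HL] := V_deriv_bounded m.+1.
have [C' C'0 chain] := chain_top n m L0 C0.
pose K := (2 * L + 1) * n%:R.
have K0 : 0 <= K by rewrite mulr_ge0 // addr_ge0 // mulr_ge0.
pose D := (1 + C' ^+ 2 * b) * expR (K * b).
have C'b : 0 <= C' ^+ 2 * b by rewrite mulr_ge0 // sqr_ge0.
have D1 : 1 <= D.
  apply: (@le_trans _ _ (1 * 1)); first by rewrite mulr1.
  apply: ler_pM => //; first by rewrite lerDl.
  by rewrite -expR0 ler_expR mulr_ge0.
exists (Num.max C D) => [|s i sb sigma p sz Bp]; first by rewrite le_max C0.
have [sm|] := ltnP (size sigma) m.+1.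
  apply: le_trans (HC s i sb sigma p sm Bp) _.
  by rewrite ler_wpM2r ?snorm_ge0 // le_max lexx.
rewrite leq_eqVlt => /orP[/eqP szE|]; last first.
  by rewrite ltnNge (_ : (size sigma <= m.+1)%N).
case: sigma => [//|u tau] in sz Bp szE *; case: szE => szE.
set sigma := u :: tau in Bp sz *.
pose y i t := fdiff sigma (fun q => phi t q 0 i) p.
pose y' i t := fdiff sigma (fun q => V (phi t q) 0 i) p.
have Ty l : time_derivative T (y l) (y' l).
  split=> [t tT|].
    by apply: is_derive_fdiff Bp => q /Hr Nq; exact: (flow_time_derivative T0 flow l Nq).1.
  rewrite /y; elim: sigma p Bp {y y' sz} => [|v s' IH] q /=.
    by move=> /Hr Nq; exact: (flow_time_derivative T0 flow l Nq).2.
  by move=> [/IH h1 /IH h2]; exact: cvgB.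
have S0 : 0 <= snorm sigma by exact: snorm_ge0.
have Tz := time_derivative_sumsq Ty.
have [s0 sb'] := andP sb.
have sT : 0 <= s < T by rewrite s0 (le_lt_trans sb').
have z0 : \sum_l y l 0 ^+ 2 <= snorm sigma ^+ 2.
  apply: (@le_trans _ _ (\sum_(l < n) (if tau is [::] then u 0 l ^+ 2 else 0))).
    apply: ler_sum => l _.
    have -> : y l 0 = fdiff sigma (fun q => q 0 l) p.
      by apply: (fdiff_eq Bp) => q /Hr Nq; rewrite (flow0 flow Nq).
    have := @fdiff_coord sigma p l isT; rewrite /sigma; case: (tau) => [|v s'] h.
      rewrite -real_normK ?num_real // -[leRHS]real_normK ?num_real //.
      by rewrite lerXn2r ?nnegrE.
    by move: h; rewrite normr_le0 => /eqP ->; rewrite expr0n.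
  rewrite /sigma; case: (tau) => [|v s']; last by rewrite big1 ?sqr_ge0.
  by rewrite snorm_cons snorm_nil mulr1 -(sumsq_norm u).
have z' t : 0 < t < s ->
    \sum_l 2 * (y l t * y' l t) <= K * (\sum_l y l t ^+ 2) + (C' * snorm sigma) ^+ 2.
  move=> /andP[t0 ts].
  have tb : 0 <= t <= b by rewrite (ltW t0) (le_trans (ltW ts)).
  have y'b l : `|y' l t| <= L * (\sum_l `|y l t|) + C' * snorm sigma.
    apply: (chain (ball (phi t p0) d) (ball p0 r) (fun q => V q 0 l) (phi t)) => //.
    - exact: ball_convex.
    - by apply: deriv_bounded_leq (HL l) => //; exact: Hd.
    - by move=> q Bq; exact: Hs.
    - by move=> j; exact: HC.
  set S := \sum_l `|y l t| in y'b.
  have S'0 : 0 <= S by apply: sumr_ge0.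
  have c0 : 0 <= C' * snorm sigma by rewrite mulr_ge0.
  apply: (@le_trans _ _ (\sum_l 2 * (`|y l t| * (L * S + C' * snorm sigma)))).
    apply: ler_sum => l _; apply: ler_wpM2l => //.
    apply: le_trans (ler_norm _) _; rewrite normrM.
    by apply: ler_wpM2l => //; exact: y'b.
  rewrite -mulr_sumr -mulr_suml -/S.
  have S2 : S ^+ 2 <= n%:R * \sum_l y l t ^+ 2 := sumsq_l1 (fun l => y l t).
  move: (C' * snorm sigma) c0 => c c0.
  apply: (@le_trans _ _ ((2 * L + 1) * S ^+ 2 + c ^+ 2)).
    have := sqr_ge0 (S - c); rewrite -subr_ge0 => h; rewrite -subr_ge0.
    suff -> : (2 * L + 1) * S ^+ 2 + c ^+ 2 - 2 * (S * (L * S + c)) = (S - c) ^+ 2.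
      exact: sqr_ge0.
    by ring.
  rewrite lerD2r /K -mulrA; apply: ler_wpM2l => //.
  by rewrite addr_ge0 // mulr_ge0.
have := gronwall Tz K0 (sqr_ge0 (C' * snorm sigma)) sT z'.
move=> zs; have {}zs : \sum_l y l s ^+ 2 <= (D * snorm sigma) ^+ 2.
  apply: le_trans zs _.
  apply: (@le_trans _ _ (D * snorm sigma ^+ 2)); last first.
    rewrite exprMn; apply: ler_wpM2r; first exact: sqr_ge0.
    by rewrite expr2 ler_peMl // (le_trans ler01).
  rewrite /D [leRHS]mulrAC; apply: ler_pM.
  - apply: addr_ge0; first by apply: sumr_ge0 => l _; exact: sqr_ge0.
    by rewrite mulr_ge0 ?sqr_ge0.
  - exact: expR_ge0.
  - rewrite mulrDl mul1r; apply: lerD => //.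
    rewrite exprMn mulrAC; apply: ler_wpM2r; first exact: sqr_ge0.
    by apply: ler_wpM2l => //; exact: sqr_ge0.
  - by rewrite ler_expR ler_wpM2l.
have DS : 0 <= D * snorm sigma by rewrite mulr_ge0 // (le_trans ler01).
have : y i s ^+ 2 <= (D * snorm sigma) ^+ 2.
  exact: le_trans (sumsq_coord (fun l => y l s) i) zs.
rewrite -real_normK ?num_real // ler_sqr ?nnegrE // => /le_trans; apply.
by rewrite ler_wpM2r // le_max lexx orbT.
Qed.

Lemma flow_deriv_bounded p0 b m : N p0 -> 0 <= b < T ->
  exists2 r, 0 < r /\ ball p0 r `<=` N & exists2 C, 0 <= C &
    forall s i, 0 <= s <= b -> deriv_bounded m C (ball p0 r) (fun p => phi s p 0 i).
Proof.
move=> Np0 bT; have [d d0 Hd] := flow_tube oU T0 flow Np0 bT.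
have [r r0 [rN Hs]] := flow_stays oN T0 V_deriv_bounded flow Np0 bT d0 Hd.
have [C C0 HC] := flow_diff_bounded m.+2 Np0 bT r0 Hd rN Hs.
exists r => //; exists C => // s i sb; apply: deriv_bounded_of_diff => //; last exact: HC.
exact: ball_open.
Qed.

Lemma flow_differentiable p t i : N p -> 0 <= t < T ->
  differentiable (fun q => phi t q 0 i) p.
Proof.
move=> Np tT; have [r [r0 _] [C C0 HC]] := flow_deriv_bounded 1 Np tT.
have tt : 0 <= t <= t by case/andP: tT => -> _; rewrite lexx.
by have [_ [+ _]] := HC t i tt; apply; exact: ballxx.
Qed.

(** The equation of first variation. The difference quotients in space have
    bounded second derivatives in time, so that their first-order Taylor bounds
    pass to the limit. *)
Lemma flow_variation p i j : N p ->
  time_derivative T (fun t => 'D_(vbase R j) (fun q => phi t q 0 i) p)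
    (fun t => \sum_l 'D_(vbase R l) (fun q => V q 0 i) (phi t p)
       * 'D_(vbase R j) (fun q => phi t q 0 l) p).
Proof.
move=> Np; apply: time_derivative_of_has => // t tT.
have [t0 tT'] := andP tT.
pose b := (t + T) / 2.
have tb : t < b by rewrite /b; lra.
have bT : 0 <= b < T by rewrite /b; apply/andP; split; lra.
have [b0 bT'] := andP bT.
have [d d0 Hd] := flow_tube oU T0 flow Np bT.
have [r r0 [rN Hs]] := flow_stays oN T0 V_deriv_bounded flow Np bT d0 Hd.
have [C C0 HC] := flow_diff_bounded 2 Np bT r0 Hd rN Hs.
have [L L0 HL] := V_deriv_bounded 2.
pose W x := \sum_l V x 0 l * 'D_(vbase R l) (fun q => V q 0 i) x.
have dV q : U q -> differentiable (fun q => V q 0 i) q.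
  by have [_ [+ _]] := HL i; apply.
have HW : deriv_bounded 1 (\sum_(l < n) 2 ^+ 1 * L * L) U W.
  apply: deriv_bounded_sum => // l; apply: (deriv_bounded_mul (f := fun x => V x 0 l)) => //.
    exact: deriv_bounded_leq (HL l).
  by have [_ [_ +]] := HL i; apply.
pose LW := \sum_(l < n) 2 ^+ 1 * L * L.
have LW0 : 0 <= LW by apply: sumr_ge0 => l _; rewrite !mulr_ge0.
pose M := n%:R * LW * (n%:R * C).
apply: (@has_time_deriv_taylor R T (fun s => 'D_(vbase R j) (fun q => phi s q 0 i) p)
  (fun s => \sum_l 'D_(vbase R l) (fun q => V q 0 i) (phi s p)
       * 'D_(vbase R j) (fun q => phi s q 0 l) p) t b M) => //; first by rewrite t0.
move=> s sb.
have quotient_cvg (f : E -> R) : differentiable f p ->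
    h^-1 * (f (p + h *: vbase R j) - f p) @[h --> 0^'] --> 'D_(vbase R j) f p.
  move=> df; have -> : (fun h : R => h^-1 * (f (p + h *: vbase R j) - f p))
      = (fun h => h^-1 *: ((f \o shift p) (h *: vbase R j) - f p)).
    by apply/funext => h; rewrite /= [p + _]addrC.
  exact: diff_derivable df.
have sT : 0 <= s < T.
  by case/andP: sb => -> /= sb; apply: le_lt_trans bT'.
have tb' : 0 <= t <= b by rewrite t0 ltW.
have dVphi : differentiable (fun q => V (phi t q) 0 i) p.
  apply: (differentiable_comp (f := phi t) (g := fun q => V q 0 i)).
    by apply: differentiable_coords => l; exact: flow_differentiable.
  by apply: dV; exact: (flow_in flow Np).
have Fs := quotient_cvg _ (flow_differentiable i Np sT).
have Ft := quotient_cvg _ (flow_differentiable i Np tT).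
have Vt := quotient_cvg _ dVphi.
rewrite (derive_comp (f := fun q => V q 0 i) (X := phi t)) in Vt; last first.
- by apply: dV; exact: (flow_in flow Np).
- by move=> l; exact: flow_differentiable.
have Vt' : (s - t) * (h^-1 * (V (phi t (p + h *: vbase R j)) 0 i - V (phi t p) 0 i))
    @[h --> 0^'] --> (s - t) * (\sum_l 'D_(vbase R l) (fun q => V q 0 i) (phi t p)
       * 'D_(vbase R j) (fun q => phi t q 0 l) p) by apply: cvgMr Vt.
apply: (cvgr_to_le (cvg_norm (cvgB (cvgB Fs Ft) Vt'))); near=> h.
have h0 : h != 0 by near: h; exact: nbhs_dnbhs_neq.
have Bh : ball p r (p + h *: vbase R j).
  have : vertices_in (ball p r) [::] (p + h *: vbase R j).
    by near: h; apply: vertices_in_open; [exact: ball_open|exact: ballxx].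
  by [].
have Nh := rN _ Bh.
have F1 := time_derivative_scale h^-1 (time_derivative_sub (flow_time_derivative T0
  flow i Nh) (flow_time_derivative T0 flow i Np)).
have F2 := time_derivative_scale h^-1 (time_derivative_sub (flow_time_derivative_comp
  T0 flow dV Nh) (flow_time_derivative_comp T0 flow dV Np)).
apply: (time_derivative_taylor F1 F2 bT' _ sb tb') => c cb.
set u := phi c (p + h *: vbase R j) - phi c p.
have vu : vertices_in (ball (phi c p) d) [:: u] (phi c p).
  by split; rewrite /= /u ?subrKC; [exact: Hs|exact: ballxx].
have := deriv_bounded_convex (s := [:: u]) HW (@ball_convex R n (phi c p) d) (Hd c cb) isT vu.
rewrite /= /u subrKC -/u snorm_cons snorm_nil mulr1 expr1 => hW.
rewrite normrM normfV ler_pdivrMl ?normr_gt0 //; apply: le_trans hW _.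
rewrite -/LW /M [leRHS]mulrC -[leRHS]mulrA; apply: ler_wpM2l; first exact: mulr_ge0.
apply: le_trans (enorm_le_norm _) _; rewrite -[leRHS]mulrA; apply: ler_wpM2l => //.
apply: norm_le_coord => [|l]; first by rewrite mulr_ge0.
have vh : vertices_in (ball p r) [:: h *: vbase R j] p by split => //; exact: ballxx.
have := HC c l cb [:: h *: vbase R j] p isT vh.
by rewrite /= snorm_cons snorm_nil mulr1 enormZ enorm_vbase mulr1 !mxE.
Unshelve. all: by end_near. Qed.

End FlowRegularity.

(** * Forms, their coefficients and their norms *)

Section FormsOnChains.
Variables (R : realType) (n k : nat) (U : set 'rV[R]_n).
Local Notation E := 'rV[R]_n.
Local Notation L := (kvec R n k).
Local Notation chain := (Defs.dirac k U).
Implicit Types (w : kform U k) (A B : chain) (s : seq E) (p q : E) (a : L).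

Definition coef w (J : multi_index n k) p : R := w (dpoint U p (wedge (ebase R J))).

Lemma dpointE p a : U p -> dpoint U p a = simplep p a :> (E -> L).
Proof.
move=> Up; apply/funext => q; rewrite /= /simplep; case: eqP => // _.
by case: asboolP.
Qed.

Lemma chainP A (B : chain) : (A : E -> L) = B -> A = B.
Proof. exact: val_inj. Qed.

Lemma chain_sumE (I : Type) (r : seq I) (F : I -> chain) q :
  (\sum_(i <- r) F i) q = \sum_(i <- r) F i q.
Proof. by elim/big_rec2: _ => // i x y _ <-. Qed.

Lemma form_dpoint w p a : U p -> w (dpoint U p a) = \sum_J a J * coef w J p.
Proof.
move=> Up; have -> : dpoint U p a = \sum_J a J *: dpoint U p (wedge (ebase R J)).
  apply: chainP; apply/funext => q; rewrite chain_sumE dpointE //.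
  transitivity (\sum_J a J *: simplep p (wedge (ebase R J)) q); last first.
    by apply: eq_bigr => J _; rewrite -(dpointE _ Up).
  rewrite /simplep; case: eqP => _; first exact: kvec_expand.
  by rewrite big1 // => J _; rewrite scaler0.
by rewrite linear_sum; apply: eq_bigr => J _; rewrite linearZ.
Qed.

Lemma form_of_dpoint (c : E -> multi_index n k -> R) p a : U p ->
  form_of U c (dpoint U p a) = \sum_J c p J * a J.
Proof.
move=> Up; transitivity (\sum_(q \in [set p]) \sum_J c q J * (dpoint U p a) q J).
  apply: fsbig_widen => q.
    change (dpoint U p a q != 0 -> q = p).
    by rewrite dpointE // /simplep; case: (q =P p) => [->|_] //; rewrite eqxx.
  move=> [_ /negP/negPn/eqP q0]; apply: big1 => J _.
  by rewrite [dpoint U p a q]q0 ffunE mulr0.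
by rewrite fsbig_set1; apply: eq_bigr => J _; rewrite dpointE // /simplep eqxx.
Qed.

Lemma coef_form_of (c : E -> multi_index n k -> R) J p : U p ->
  coef (form_of U c) J p = c p J.
Proof.
move=> Up; rewrite /coef form_of_dpoint // (bigD1 J) //= big1 => [|I IJ].
  by rewrite wedge_ebase eqxx mulr1 addr0.
by rewrite wedge_ebase (negPf IJ) mulr0.
Qed.

Lemma translate_Delta u s p a : translate u (Delta s p a) = Delta s (p + u) a.
Proof.
elim: s p => [|v s IH] p /=.
  apply/funext => q; rewrite /translate /simplep.
  by rewrite -(inj_eq (addIr u)) subrK.
rewrite -!IH; apply/funext => q; set F := Delta s p a.
by transitivity (F (q - u - v) - F (q - u)); rewrite // addrAC.
Qed.

Lemma Delta_cons u s p a : Delta (u :: s) p a = Delta s (p + u) a - Delta s p a.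
Proof. by rewrite /= translate_Delta. Qed.

Lemma Delta_supp (K : set E) s p a : vertices_in K s p -> chain_support (Delta s p a) `<=` K.
Proof.
elim: s p => [|u s IH] p.
  move=> Kp q; rewrite /chain_support /= /simplep; case: (q =P p) => [-> //|_].
  by rewrite eqxx.
move=> [/IH h1 /IH h2] q; rewrite Delta_cons /chain_support /=.
have [E1|/h1 //] := eqVneq (Delta s (p + u) a q) 0.
have [E2|/h2 //] := eqVneq (Delta s p a q) 0.
have -> : (Delta s (p + u) a - Delta s p a) q = Delta s (p + u) a q - Delta s p a q by [].
by rewrite E1 E2 subrr eqxx.
Qed.

(** The pairing of a form with a difference of a Dirac chain is a difference of
    its coefficients. *)
Lemma form_Delta w s p a : vertices_in U s p -> exists2 A : chain, (A : E -> L) = Delta s p a &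
  w A = \sum_J a J * fdiff s (coef w J) p.
Proof.
elim: s p => [|u s IH] p.
  by move=> Up; exists (dpoint U p a); [exact: dpointE|exact: form_dpoint].
move=> [/IH[A AE wA] /IH[B BE wB]]; exists (A - B).
  by rewrite Delta_cons -AE -BE.
by rewrite linearB /= wA wB -sumrB; apply: eq_bigr => J _; rewrite mulrBr.
Qed.

Lemma Delta_finite s p a : finite_set (chain_support (Delta s p a)).
Proof.
elim: s p => [|u s IH] p.
  apply: sub_finite_set (finite_set1 p) => q; rewrite /chain_support /= /simplep.
  by case: (q =P p) => // _; rewrite eqxx.
rewrite Delta_cons; apply: sub_finite_set (_ : finite_set
  (chain_support (Delta s (p + u) a) `|` chain_support (Delta s p a))).
  move=> q; rewrite /chain_support /=.
  have [E1|] := eqVneq (Delta s (p + u) a q) 0; last by left.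
  have [E2|] := eqVneq (Delta s p a q) 0; last by right.
  have -> : (Delta s (p + u) a - Delta s p a) q
     = Delta s (p + u) a q - Delta s p a q by [].
  by rewrite E1 E2 subrr eqxx.
by rewrite finite_setU.
Qed.

(** Cancellations cannot remove the extreme points: on each line in the
    direction [u], the first and the last point of the support of
    [translate u F - F] enclose the supports of [F] and [translate u F]. *)
Lemma convex_supp_translate (F : E -> L) (u : E) (K : set E) : u != 0 ->
  finite_set (chain_support F) -> convex_set K ->
  chain_support (translate u F - F) `<=` K ->
  forall q, F q != 0 -> K q /\ K (q + u).
Proof.
move=> u0 fF cK sK q Fq.
have ends (v : E) : v != 0 -> exists m, F (q + m%:R *: v) != 0 /\
    F (q + m.+1%:R *: v) = 0.
  move=> v0.
  have [M FM] : exists M : nat, F (q + M%:R *: v) == 0.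
    apply: contrapT => /forallNP H.
    pose f (m : nat) := q + m%:R *: v.
    have injf : injective f.
      move=> a b /addrI/eqP; rewrite -subr_eq0 -scalerBl scaler_eq0 (negPf v0) orbF.
      by rewrite subr_eq0 eqr_nat => /eqP.
    have := @finite_preimage _ _ _ f (in2W injf) fF.
    have -> : f @^-1` chain_support F = setT.
      by apply/seteqP; split => // m _; apply/negP; exact: H.
    exact: infinite_nat.
  have ex : exists M : nat, F (q + M%:R *: v) == 0 by exists M.
  case: (ex_minnP ex) => -[|m] /eqP Fm Hm.
    by move: Fq Fm; rewrite scale0r addr0 => /eqP.
  exists m; split => //; apply/negP => /Hm; by rewrite ltnn.
have [M [M1 M2]] := ends u u0.
have nu0 : - u != 0 by rewrite oppr_eq0.
have [M' [M1' M2']] := ends (- u) nu0.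
have Kx : K (q + M.+1%:R *: u).
  apply: sK; rewrite /chain_support /=.
  have -> : (translate u F - F) (q + M.+1%:R *: u)
    = F (q + M.+1%:R *: u - u) - F (q + M.+1%:R *: u) by [].
  rewrite M2 subr0; suff -> : q + M.+1%:R *: u - u = q + M%:R *: u by [].
  by rewrite -natr1 scalerDl scale1r addrA addrK.
have Ky : K (q + M'%:R *: - u).
  apply: sK; rewrite /chain_support /=.
  have -> : (translate u F - F) (q + M'%:R *: - u)
    = F (q + M'%:R *: - u - u) - F (q + M'%:R *: - u) by [].
  suff -> : q + M'%:R *: - u - u = q + M'.+1%:R *: - u by rewrite M2' sub0r oppr_eq0.
  by rewrite -natr1 scalerDl scale1r addrA.
have D0 : 0 < M.+1%:R + M'%:R :> R by rewrite ltr_wpDr ?ltr0n.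
have line (c : R) : 0 <= M'%:R + c -> c <= M.+1%:R -> K (q + c *: u).
  move=> c0 c1.
  have t01 : 0 <= (M'%:R + c) / (M.+1%:R + M'%:R) <= 1.
    by rewrite divr_ge0 ?(ltW D0) //= ler_pdivrMr // mul1r addrC lerD2r.
  have := segment_convex cK Ky Kx t01; congr K.
  rewrite opprD addrACA subrr add0r scalerN opprK -scalerDl scalerA.
  by rewrite divfK ?gt_eqF // -addrA -scaleNr -scalerDl addrA addNr add0r.
split; first by have := line 0; rewrite addr0 scale0r addr0; exact.
have := line 1; rewrite scale1r; apply; first by rewrite addr_ge0.
by rewrite ler1n.
Qed.

(** By [convex_supp_translate], no vertex lies outside the hull of the support. *)
Lemma vertices_in_hull (K : set E) s p a : convex_set K -> a != 0 -> 0 \notin s ->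
  chain_support (Delta s p a) `<=` K -> vertices_in K s p.
Proof.
move=> cK a0; elim: s p => [|u s IH] p.
  by move=> _ H; apply: H; rewrite /chain_support /= /simplep eqxx.
rewrite inE negb_or eq_sym => /andP[u0 s0] H.
have key := convex_supp_translate u0 (Delta_finite s p a) cK H.
split; last by apply: IH => // q /key[].
apply: IH => // q; rewrite -translate_Delta /chain_support /= /translate => /key[_].
by rewrite subrK.
Qed.

Lemma convex_hull_convex (X : set E) : convex_set (convex_hull X).
Proof.
move=> x y t; rewrite !inE => hx hy Z [cZ XZ].
have := cZ x y t; rewrite !inE; apply; [apply: hx|apply: hy]; by split.
Qed.

Lemma Delta_degenerate s p a : a = 0 \/ 0 \in s -> Delta s p a = 0.
Proof.
case=> [->|]; first by rewrite -(scale0r (0 : L)) DeltaZ scale0r.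
elim: s p => [//|u s IH] p; rewrite inE Delta_cons => /orP[/eqP <-|s0].
  by rewrite addr0 subrr.
by rewrite !IH // subrr.
Qed.

Lemma inside_vertices_in s p a : a != 0 -> 0 \notin s -> inside U (Delta s p a) ->
  exists K, [/\ convex_set K, K `<=` U & vertices_in K s p].
Proof.
move=> a0 s0 iU; exists (convex_hull (chain_support (Delta s p a))); split => //.
  exact: convex_hull_convex.
apply: vertices_in_hull a0 s0 _; first exact: convex_hull_convex.
by move=> q sq Z [_]; apply.
Qed.

Lemma snorm_gt0 s : 0 \notin s -> 0 < snorm s.
Proof.
move=> s0; rewrite /snorm big_seq; apply: prodr_gt0 => u us.
rewrite lt_neqAle enorm_ge0 andbT eq_sym; apply: contraNneq s0 => /enorm_eq0 u0.
by rewrite -u0.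
Qed.

Lemma massZ (c : R) a : mass (c *: a) = `|c| * mass a.
Proof.
apply/eqP; rewrite eq_le massZ_le /=; have [->|c0] := eqVneq c 0.
  by rewrite normr0 mul0r mass_ge0.
rewrite -ler_pdivlMl ?normr_gt0 // -normfV.
by have := massZ_le c^-1 (c *: a); rewrite scalerA mulVf // scale1r.
Qed.

(** The convex sets come from the condition that a term of a chain be inside
    [U], which is about the convex hull of its support. *)
Definition form_bounded (r : nat) (C : R) w : Prop :=
  forall J K s p, convex_set K -> K `<=` U -> (size s <= r)%N -> vertices_in K s p ->
    `|fdiff s (coef w J) p| <= C * snorm s.

Definition num_multi_index : R := #|{: multi_index n k}|%:R.

Lemma form_bounded_Delta r C w s p a : form_bounded r C w -> 0 <= C -> (size s <= r)%N ->
  inside U (Delta s p a) ->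
  exists2 A : chain, (A : E -> L) = Delta s p a & `|w A| <= num_multi_index * C *
    (snorm s * mass a).
Proof.
move=> HC C0 sr iU.
have [deg|] := pselect (a = 0 \/ 0 \in s).
  exists 0; first by rewrite Delta_degenerate.
  rewrite linear0 normr0 !mulr_ge0 ?snorm_ge0 ?mass_ge0 //; exact: ler0n.
move=> /not_orP[/eqP a0 /negP s0].
have [K [cK KU Kp]] := inside_vertices_in a0 s0 iU.
have [A AE wA] := form_Delta w a (vertices_in_sub KU Kp); exists A => //; rewrite wA.
apply: le_trans (ler_norm_sum _ _ _) _.
have -> : num_multi_index * C * (snorm s * mass a)
    = \sum_(J : multi_index n k) mass a * (C * snorm s).
  by rewrite sumr_const -mulr_natl /num_multi_index; ring.
apply: ler_sum => J _; rewrite normrM; apply: ler_pM => //.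
  exact: coef_le_mass.
exact: (HC J K).
Qed.

(** Estimate [w] on each term of a decomposition of [A]. The terms that
    degenerate, with a zero difference vector or a zero k-vector, vanish. *)
Lemma form_bounded_eval r C w A : form_bounded r C w -> 0 <= C -> `|w A| <=
  num_multi_index * C * bnorm r A.
Proof.
move=> HC C0; have nC0 : 0 <= num_multi_index * C by rewrite mulr_ge0 // ler0n.
have key x : bnorm_set r A x -> `|w A| <= num_multi_index * C * x.
  case=> t [Ht AE ->].
  have [B BE wB] : exists2 B : chain,
      (B : E -> L) = \sum_(c <- t) Delta c.1.1 c.1.2 c.2 &
      `|w B| <= num_multi_index * C * \sum_(c <- t) snorm c.1.1 * mass c.2.
    elim: t Ht {AE} => [_|c t IH Ht].
      by exists 0; rewrite !big_nil // linear0 normr0 mulr0.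
    have [|B BE wB] := IH; first by move=> c' c't; apply: Ht; rewrite inE c't orbT.
    have [sr iU] := Ht c (mem_head _ _).
    have [D DE wD] := form_bounded_Delta HC C0 sr iU.
    exists (D + B); first by rewrite big_cons -BE -DE.
    rewrite linearD big_cons mulrDr; apply: le_trans (ler_normD _ _) _.
    exact: lerD.
  by have -> : A = B by apply: chainP; rewrite AE BE.
have [nC|nC] := eqVneq (num_multi_index * C) 0.
  by have [x /key] := bnorm_set_neq0 r A; rewrite nC !mul0r.
have nCp : 0 < num_multi_index * C by rewrite lt_neqAle eq_sym nC.
rewrite -ler_pdivrMl //; apply: lb_le_inf; first exact: bnorm_set_neq0.
by move=> x /key; rewrite ler_pdivrMl.
Qed.

Lemma form_bounded_form_norm r C w : form_bounded r C w -> 0 <= C ->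
  (form_norm w r <= (num_multi_index * C)%:E)%E.
Proof.
move=> HC C0; apply: bigmax_le => [|j _].
  by rewrite lee_fin mulr_ge0 // ler0n.
apply: ge_ereal_sup => _ [s [p [a [A [sj iU nrm AE ->]]]]].
have sr : (size s <= r)%N by rewrite sj -ltnS.
have [B BE wB] := form_bounded_Delta HC C0 sr iU.
have -> : A = B by apply: chainP; rewrite AE BE.
by rewrite lee_fin (le_trans wB) // nrm mulr1.
Qed.

(** Test the norm on a normalized basis k-vector. The function [f] may
    be a difference quotient of forms, not presented as a form. *)
Lemma form_norm_form_bounded r (C : R) w (f : chain -> R) : (forall A, f A = w A) ->
  (form_norm f r <= C%:E)%E -> form_bounded r C w.
Proof.
move=> fw H J K s p cK KU sr Kp.
have C0 : 0 <= C.
  by rewrite -lee_fin; apply: le_trans H; exact: bigmax_ge_id.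
have [s0|s0] := boolP (0 \in s).
  by rewrite fdiff0 // normr0 mulr_ge0 ?snorm_ge0.
have sp := snorm_gt0 s0; pose e : L := wedge (ebase R J).
have e0 : 0 < mass e.
  apply: lt_le_trans (coef_le_mass e J).
  by rewrite /e wedge_ebase eqxx normr1.
have m0 : 0 < snorm s * mass e by rewrite mulr_gt0.
pose a := (snorm s * mass e)^-1 *: e.
have [A AE wA] := form_Delta w a (vertices_in_sub KU Kp).
have wAE : w A = (snorm s * mass e)^-1 * fdiff s (coef w J) p.
  rewrite wA (bigD1 J) //= big1 ?addr0 => [|I IJ]; rewrite /a /e ffunE wedge_ebase.
    by rewrite eqxx [_ *: _]mulr1.
  by rewrite (negPf IJ) [_ *: _]mulr0 mul0r.
have szr : (size s < r.+1)%N by rewrite ltnS.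
have : (`|w A|%:E <= C%:E)%E.
  apply: le_trans H; apply: le_trans (le_bigmax _ _ (Ordinal szr)).
  apply: ereal_sup_ubound; exists s, p, a, A; split => //.
  - move=> q hq; apply: KU; apply: (hq K); split => //; exact: Delta_supp.
  - rewrite /a massZ gtr0_norm ?invr_gt0 // mulrCA mulVf ?gt_eqF //.
  - by rewrite fw.
rewrite lee_fin wAE normrM normfV (gtr0_norm m0) ler_pdivrMl //.
move/le_trans; apply.
have -> : snorm s * mass e * C = C * snorm s * mass e by ring.
by apply: ler_piMr; [rewrite mulr_ge0 // ltW|exact: mass_ebase_le1].
Qed.

(** The condition is pointwise. *)
Lemma deriv_bounded_local m (M : R) (X : set E) f :
  (forall p, X p -> exists2 Y : set E, Y p & deriv_bounded m M Y f) -> deriv_bounded m M X f.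
Proof.
elim: m f => [|m IH] f H /=; (split; [move=> p /H[Y Yp]|]) => //.
- by move=> [h _]; exact: h.
- by move=> [h _]; exact: h.
split=> [p /H[Y Yp [_ [h _]]]|j]; first exact: h.
by apply: IH => p /H[Y Yp [_ [_ h]]]; exists Y => //; exact: h.
Qed.

(** Balls inside [U] are convex, and [deriv_bounded_of_diff] applies on each of
    them with the same constant. *)
Lemma form_bounded_deriv m C w J : open U -> 0 <= C -> form_bounded m.+1 C w ->
  deriv_bounded m C U (coef w J).
Proof.
move=> oU C0 HC; apply: deriv_bounded_local => p Up.
have [r /= r0 Hr] := (nbhs_ballP _ _).1 (open_nbhs_nbhs (conj oU Up)).
exists (ball p r); first exact: ballxx.
apply: deriv_bounded_of_diff => //; first exact: ball_open.
by move=> s q ss Bq; apply: (HC J (ball p r)) => //; exact: ball_convex.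
Qed.

Lemma deriv_bounded_form m M w : 0 <= M -> (forall J, deriv_bounded m M U (coef w J)) ->
  form_bounded m (n.+1%:R ^+ m * M) w.
Proof.
move=> M0 HM J K s p cK KU sm Kp.
apply: le_trans (deriv_bounded_convex (HM J) cK KU sm Kp) _.
rewrite ler_wpM2r ?snorm_ge0 // ler_wpM2r //.
apply: (@le_trans _ _ (n.+1%:R ^+ size s)).
  by rewrite lerXn2r ?nnegrE ?ler_nat.
by rewrite -!natrX ler_nat leq_pexp2l.
Qed.

Lemma Bform_deriv_bounded w : open U -> Bform w ->
  forall m, exists2 M, 0 <= M & forall J, deriv_bounded m M U (coef w J).
Proof.
move=> oU bw m; have := bw m.+1; case E : (form_norm w m.+1) => [c| |] // _.
  have c0 : 0 <= c.
    by rewrite -lee_fin -E; exact: bigmax_ge_id.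
  by exists c => // J; apply: form_bounded_deriv => //; apply: (@form_norm_form_bounded
    _ _ _ w); rewrite ?E.
have : (0 <= form_norm w m.+1)%E by exact: bigmax_ge_id.
by rewrite E.
Qed.

Lemma deriv_bounded_Bform w : (forall m, exists2 M, 0 <= M & forall J, deriv_bounded m
  M U (coef w J)) ->
  Bform w.
Proof.
move=> H r; have [M M0 HM] := H r.
apply: le_lt_trans (form_bounded_form_norm (deriv_bounded_form M0 HM) _) (ltry _).
by rewrite mulr_ge0 // exprn_ge0.
Qed.

End FormsOnChains.

(** * Cartan's formula *)

Section MinorIdentities.
Variables (R : realType) (n : nat).
Local Notation E := 'rV[R]_n.

Definition set_slot k (v : 'I_k -> E) (a : 'I_k) (x : E) : 'I_k -> E :=
  fun i => if i == a then x else v i.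

Lemma vcons0 k (x : E) (u : 'I_k -> E) : vcons x u ord0 = x.
Proof. by rewrite /vcons unlift_none. Qed.

Lemma vcons_lift0 k (x : E) (u : 'I_k -> E) i : vcons x u (lift ord0 i) = u i.
Proof. by rewrite /vcons liftK. Qed.

Lemma wedge_vcons k (x : E) (u : 'I_k -> E) (I : multi_index n k.+1) :
  wedge (vcons x u) I
  = \sum_b x 0 (val I b) * ((-1) ^+ b * colminor u (val I \o lift b)).
Proof.
rewrite wedgeE /colminor (expand_det_row _ ord0); apply: eq_bigr => b _.
rewrite mxE vcons0; congr (_ * _); rewrite /cofactor add0n; congr (_ * \det _).
by apply/matrixP => i j; rewrite !mxE vcons_lift0.
Qed.

Lemma wedge_set_slot k (v : 'I_k -> E) a (x : E) (I : multi_index n k) :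
  wedge (set_slot v a x) I = \sum_b x 0 (val I b) *
    ((-1) ^+ (a + b) * colminor (v \o lift a) (val I \o lift b)).
Proof.
rewrite wedgeE /colminor (expand_det_row _ a); apply: eq_bigr => b _.
rewrite mxE /set_slot eqxx; congr (_ * _); rewrite /cofactor; congr (_ * \det _).
by apply/matrixP => i j; rewrite !mxE eq_sym (negPf (neq_lift _ _)).
Qed.

(** The two determinants have the same Laplace expansion along the row [x], up
    to the sign of the cyclic permutation that moves this row. *)
Lemma wedge_vcons_lift k (v : 'I_k.+1 -> E) (a : 'I_k.+1) (x : E) (I : multi_index n k.+1) :
  (-1) ^+ a * wedge (vcons x (v \o lift a)) I = wedge (set_slot v a x) I.
Proof.
rewrite wedge_vcons wedge_set_slot mulr_sumr; apply: eq_bigr => b _.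
by rewrite exprD; ring.
Qed.

Lemma wedge_vcons_expand k (x : E) (u : 'I_k -> E) (I : multi_index n k.+1) :
  wedge (vcons x u) I = \sum_K wedge u K * wedge (vcons x (ebase R K)) I.
Proof.
rewrite wedge_vcons; under [RHS]eq_bigr => K _ do rewrite wedge_vcons mulr_sumr.
rewrite exchange_big /=; apply: eq_bigr => b _.
rewrite colminor_expand !mulr_sumr; apply: eq_bigr => K _; ring.
Qed.

Let cofactor_row k (X Y : 'M[R]_k) a b :
  cofactor (\matrix_(i, j) (if i == a then Y i j else X i j)) a b = cofactor X a b.
Proof.
rewrite /cofactor; congr (_ * \det _); apply/matrixP => i j.
by rewrite !mxE eq_sym (negPf (neq_lift _ _)).
Qed.

Let cofactor_col k (X Y : 'M[R]_k) a b :
  cofactor (\matrix_(i, j) (if j == b then Y i j else X i j)) a b = cofactor X a b.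
Proof.
rewrite /cofactor; congr (_ * \det _); apply/matrixP => i j.
by rewrite !mxE eq_sym (negPf (neq_lift _ _)).
Qed.

(** Both sides are the derivative of the determinant at [X] along [Y]. *)
Lemma det_rows_cols k (X Y : 'M[R]_k) :
  \sum_a \det (\matrix_(i, j) (if i == a then Y i j else X i j))
  = \sum_b \det (\matrix_(i, j) (if j == b then Y i j else X i j)).
Proof.
transitivity (\sum_a \sum_b Y a b * cofactor X a b).
  apply: eq_bigr => a _; rewrite (expand_det_row _ a); apply: eq_bigr => b _.
  by rewrite mxE eqxx cofactor_row.
rewrite exchange_big /=; apply: eq_bigr => b _.
rewrite (expand_det_col _ b); apply: eq_bigr => a _.
by rewrite mxE eqxx cofactor_col.
Qed.

(** The derivation of the exterior algebra extending a linear map is linear in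
    the k-vector: its coefficients are determined by the basis k-vectors. *)
Lemma derivation_expand k (A : 'M[R]_n) (v : 'I_k -> E) (I : multi_index n k) :
  \sum_a wedge (set_slot v a (v a *m A)) I
  = \sum_J wedge v J * \sum_a wedge (set_slot (ebase R J) a (ebase R J a *m A)) I.
Proof.
have key (u : 'I_k -> E) : \sum_a wedge (set_slot u a (u a *m A)) I =
    \sum_b \sum_l A l (val I b) *
      colminor u (fun j => if j == b then l else val I j).
  transitivity (\sum_a \det (\matrix_(i, j)
      (if i == a then (\matrix_(i, j) (u i *m A) 0 (val I j)) i j
       else (\matrix_(i, j) u i 0 (val I j)) i j))).
    apply: eq_bigr => a _; rewrite wedgeE; congr (\det _).
    by apply/matrixP => i j; rewrite !mxE /set_slot; case: eqP => // ->; rewrite mxE.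
  rewrite det_rows_cols; apply: eq_bigr => b _.
  rewrite (expand_det_col _ b).
  under [RHS]eq_bigr => l _ do rewrite /colminor (expand_det_col _ b) mulr_sumr.
  rewrite exchange_big /=; apply: eq_bigr => i _.
  rewrite mxE eqxx 2!mxE mulr_suml; apply: eq_bigr => l _.
  rewrite mxE eqxx cofactor_col -mulrA mulrCA; congr (_ * (_ * _)).
  rewrite /cofactor; congr (_ * \det _); apply/matrixP => i' j.
  by rewrite !mxE [_ == b]eq_sym (negPf (neq_lift _ _)).
rewrite key.
under [RHS]eq_bigr => J _ do rewrite key mulr_sumr.
rewrite [RHS]exchange_big /=; apply: eq_bigr => b _.
under [RHS]eq_bigr => J _ do rewrite mulr_sumr.
rewrite exchange_big /=; apply: eq_bigr => l _.
by rewrite colminor_expand mulr_sumr; apply: eq_bigr => J _; rewrite mulrCA.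
Qed.

End MinorIdentities.

Section Cartan.
Variables (R : realType) (n : nat) (U : set 'rV[R]_n).
Local Notation E := 'rV[R]_n.
Hypothesis oU : open U.

Let near_U q : U q -> \forall x \near q, U x.
Proof. by move=> Uq; apply: open_nbhs_nbhs. Qed.

Lemma is_derive_bigsum (W : normedModType R) (I : Type) (r : seq I)
    (F : I -> W -> R) (q e : W) :
  (forall i, derivable (F i) q e) ->
  is_derive q e (fun x => \sum_(i <- r) F i x) (\sum_(i <- r) 'D_e (F i) q).
Proof.
move=> H; elim: r => [|i r IH].
  rewrite big_nil (_ : (fun x => _) = (fun=> 0)); last first.
    by apply/funext => x; rewrite big_nil.
  exact: is_derive_cst.
rewrite big_cons (_ : (fun x => _) = (fun x => F i x + \sum_(i <- r) F i x)).
  by apply: is_deriveD => //; exact: derivableP.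
by apply/funext => x; rewrite big_cons.
Qed.

Lemma derive_form_dpoint k (w : kform U k) (a : kvec R n k) q e : U q ->
  (forall K, differentiable (coef w K) q) ->
  'D_e (fun x => w (dpoint U x a) : R^o) q = \sum_K a K * 'D_e (coef w K) q.
Proof.
move=> Uq dw.
have dK K : derivable (coef w K) q e by exact: diff_derivable.
rewrite (@near_eq_derive _ _ _ _ (fun x => \sum_K a K * coef w K x)); last first.
  by apply: filterS (near_U Uq) => x Ux; rewrite form_dpoint.
have H := @is_derive_bigsum E _ (index_enum (multi_index n k))
  (fun K x => a K * coef w K x) q e (fun K => derivableM (derivable_cst _ _ _) (dK K)).
rewrite (@derive_val _ _ _ _ _ _ _ H); apply: eq_bigr => K _.
by rewrite deriveM // derive_cst scaler0 addr0.
Qed.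

(** The defining formula of the exterior derivative on basis k-vectors holds
    for arbitrary ones: both sides are combinations of minors. *)
Lemma ext_deriv_wedge k (w : kform U k) (u : 'I_k.+1 -> E) q : U q ->
  (forall K, differentiable (coef w K) q) ->
  ext_deriv w (dpoint U q (wedge u)) = \sum_(i < k.+1) (-1) ^+ i *
    \sum_K wedge (u \o lift i) K * 'D_(u i) (coef w K) q.
Proof.
move=> Uq dw.
pose cons (l : 'I_n) (K : multi_index n k) : 'I_k.+1 -> 'I_n :=
  fun b => oapp (val K) l (unlift ord0 b).
have FE (v : 'I_k.+1 -> E) : \sum_(i < k.+1) (-1) ^+ i *
    \sum_K wedge (v \o lift i) K * 'D_(v i) (coef w K) q
   = \sum_K \sum_l 'D_(vbase R l) (coef w K) q * colminor v (cons l K).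
  under eq_bigr => i _ do rewrite mulr_sumr.
  rewrite exchange_big /=; apply: eq_bigr => K _.
  under eq_bigr => i _ do rewrite derive_expand // !mulr_sumr.
  rewrite exchange_big /=; apply: eq_bigr => l _.
  rewrite /colminor (expand_det_col _ ord0) mulr_sumr; apply: eq_bigr => i _.
  rewrite mxE /cons unlift_none /= /cofactor addn0.
  rewrite wedgeE /colminor.
  have -> : row' i (col' ord0 (\matrix_(i0, j) v i0 0 (oapp (val K) l (unlift ord0 j))))
     = \matrix_(i0, j) (v \o lift i) i0 0 (val K j).
    by apply/matrixP => i' j; rewrite !mxE liftK.
  by ring.
rewrite FE form_dpoint //.
have -> : \sum_J wedge u J * coef (ext_deriv w) J q = \sum_J wedge u J *
   \sum_K \sum_l 'D_(vbase R l) (coef w K) q * colminor (ebase R J) (cons l K).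
  apply: eq_bigr => J _; rewrite coef_form_of // -FE; congr (_ * _).
  by apply: eq_bigr => i _; rewrite derive_form_dpoint.
under eq_bigr => J _ do rewrite mulr_sumr.
rewrite exchange_big /=; apply: eq_bigr => K _.
under eq_bigr => J _ do rewrite mulr_sumr.
rewrite exchange_big /=; apply: eq_bigr => l _.
by rewrite colminor_expand mulr_sumr; apply: eq_bigr => J _; rewrite mulrCA.
Qed.

Variable V : E -> E.

(** The transpose of the usual Jacobian matrix, since vectors are rows. *)
Definition jacobian (q : E) : 'M[R]_n :=
  \matrix_(l, c) 'D_(vbase R l) (fun x => V x 0 c) q.

Lemma jacobian_ebase k (J : multi_index n k) a q c :
  (ebase R J a *m jacobian q) 0 c = 'D_(vbase R (val J a)) (fun x => V x 0 c) q.
Proof.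
rewrite mxE (bigD1 (val J a)) //= big1 => [|l lJ].
  by rewrite vbaseE eqxx mul1r addr0 mxE.
by rewrite vbaseE eq_sym (negPf lJ) mul0r.
Qed.

(** The derivative of [w] on a k-vector dragged along by the flow of [V]. *)
Definition flow_rate k (w : kform U k) (v : 'I_k -> E) (q : E) : R :=
  (\sum_K wedge v K * \sum_l V q 0 l * 'D_(vbase R l) (coef w K) q)
  + \sum_I (\sum_a wedge (set_slot v a (v a *m jacobian q)) I) * coef w I q.

Let derive_V k (w : kform U k) K q : differentiable (coef w K) q ->
  \sum_l V q 0 l * 'D_(vbase R l) (coef w K) q = 'D_(V q) (coef w K) q.
Proof. by move=> d; rewrite derive_expand. Qed.

Lemma coef_interior_ext_deriv k (w : kform U k) (J : multi_index n k) q : U q ->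
  (forall K, differentiable (coef w K) q) ->
  coef (interior_prod V (ext_deriv w)) J q = 'D_(V q) (coef w J) q
  - \sum_(a < k) (-1) ^+ a * \sum_K
     wedge (vcons (V q) (ebase R J) \o lift (lift ord0 a)) K
        * 'D_(ebase R J a) (coef w K) q.
Proof.
move=> Uq dw; rewrite coef_form_of // ext_deriv_wedge // big_ord_recl /= expr0 mul1r.
congr (_ + _).
  rewrite vcons0 (bigD1 J) //= big1 ?addr0.
    have -> : vcons (V q) (ebase R J) \o lift ord0 = ebase R J.
      by apply/funext => i; rewrite /= vcons_lift0.
    by rewrite wedge_ebase eqxx mul1r.
  move=> K KJ; have -> : vcons (V q) (ebase R J) \o lift ord0 = ebase R J.
    by apply/funext => i; rewrite /= vcons_lift0.
  by rewrite wedge_ebase (negPf KJ) mul0r.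
rewrite -sumrN; apply: eq_bigr => a _.
by rewrite vcons_lift0 /bump add1n exprS mulN1r mulNr.
Qed.

(** Cartan's formula on basis k-vectors. In [i_V d + d i_V] the terms where the
    coefficients of [w] are differentiated in the direction of a factor of the
    k-vector cancel. *)
Lemma coef_lie_deriv k (w : kform U k) J q : U q ->
  (forall x K, U x -> differentiable (coef w K) x) ->
  (forall c, differentiable (fun x => V x 0 c) q) ->
  coef (lie_deriv V w) J q = flow_rate w (ebase R J) q.
Proof.
move=> Uq dw dV; rewrite /flow_rate (bigD1 J) //= [X in _ + X + _]big1 ?addr0; last first.
  by move=> K KJ; rewrite wedge_ebase (negPf KJ) mul0r.
rewrite wedge_ebase eqxx mul1r derive_V; last exact: dw.
case: k w J dw => [|k] w J dw.
  rewrite coef_interior_ext_deriv //; last by move=> K; exact: dw.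
  rewrite big_ord0 subr0 big1 ?addr0 // => I _.
  by rewrite big_ord0 mul0r.
transitivity (coef (interior_prod V (ext_deriv w)) J q
  + coef (ext_deriv (interior_prod V w)) J q); first by [].
rewrite coef_interior_ext_deriv //; last by move=> K; exact: dw.
rewrite -addrA; congr (_ + _).
have vl a : vcons (V q) (ebase R J) \o lift (lift ord0 a)
    = vcons (V q) (ebase R J \o lift a).
  apply/funext => b /=; case: (unliftP ord0 b) => [c|] ->.
    have -> : lift (lift ord0 a) (lift ord0 c) = lift ord0 (lift a c).
      by apply: val_inj; rewrite /= /bump /= !add1n ltnS addnS.
    by rewrite !vcons_lift0.
  have -> : lift (lift ord0 a) ord0 = ord0 by apply: val_inj.
  by rewrite !vcons0.
have dV' e b : derivable (fun x => V x 0 b) q e by exact: diff_derivable.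
have dw' e I : derivable (coef w I) q e by apply: diff_derivable; exact: dw.
(* Here the first factor [V x] of the k-vector varies with the point. *)
have iV (u : 'I_k -> E) e : 'D_e (fun x => interior_prod V w (dpoint U x (wedge u)) : R^o) q
   = \sum_I (wedge (vcons (V q) u) I * 'D_e (coef w I) q
         + wedge (vcons (\row_c 'D_e (fun x => V x 0 c) q) u) I * coef w I q).
  pose G (I : multi_index n k.+1) x := \sum_(b < k.+1) V x 0 (val I b) * ((-1) ^+ b *
    colminor u (val I \o lift b)).
  rewrite (@near_eq_derive _ _ _ _ (fun x => \sum_I G I x * coef w I x)); last first.
    apply: filterS (near_U Uq) => x Ux; rewrite form_dpoint //.
    under eq_bigr => K _ do rewrite coef_form_of // form_dpoint // mulr_sumr.
    rewrite exchange_big /=; apply: eq_bigr => I _.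
    rewrite /G -wedge_vcons wedge_vcons_expand mulr_suml.
    by apply: eq_bigr => K _; rewrite mulrA.
  have dG I : is_derive q e (G I)
      (wedge (vcons (\row_c 'D_e (fun x => V x 0 c) q) u) I).
    rewrite wedge_vcons.
    have HG := @is_derive_bigsum E _ (index_enum 'I_k.+1) (fun b x => V x 0 (val I b) *
       ((-1) ^+ b * colminor u (val I \o lift b))) q e
       (fun b => derivableM (dV' e _) (derivable_cst _ _ _)).
    apply: (is_derive_eq HG); apply: eq_bigr => b _.
    rewrite (deriveM (dV' e _) (derivable_cst _ _ _)) derive_cst scaler0 add0r mxE.
    by rewrite mulrC.
  have dG' I : derivable (G I) q e by case: (dG I).
  have H := @is_derive_bigsum E _ (index_enum (multi_index n k.+1))
    (fun I x => G I x * coef w I x) q e (fun I => derivableM (dG' I) (dw' e I)).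
  rewrite (@derive_val _ _ _ _ _ _ _ H); apply: eq_bigr => I _.
  rewrite deriveM // (@derive_val _ _ _ _ _ _ _ (dG I)); congr (_ + _).
    by rewrite wedge_vcons.
  exact: mulrC.
rewrite coef_form_of //.
rewrite -sumrN -big_split /=.
under eq_bigr => a _.
  rewrite vl (iV (ebase R J \o lift a)) big_split /= mulrDr addrA addNr add0r mulr_sumr.
  over.
rewrite exchange_big /=; apply: eq_bigr => I _; rewrite mulr_suml.
apply: eq_bigr => a _; rewrite mulrA -wedge_vcons_lift; congr (_ * wedge (vcons _ _) _ * _).
by apply/rowP => c; rewrite mxE jacobian_ebase.
Qed.

(** Both sides are linear in the k-vector, by [derivation_expand]. *)
Lemma lie_deriv_wedge k (w : kform U k) (v : 'I_k -> E) q : U q ->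
  (forall x K, U x -> differentiable (coef w K) x) ->
  (forall c, differentiable (fun x => V x 0 c) q) ->
  lie_deriv V w (dpoint U q (wedge v)) = flow_rate w v q.
Proof.
move=> Uq dw dV; rewrite form_dpoint // /flow_rate.
under eq_bigr => J _ do rewrite coef_lie_deriv // /flow_rate mulrDr.
rewrite big_split /=; congr (_ + _).
  apply: eq_bigr => J _; congr (_ * _); rewrite (bigD1 J) //= [X in _ + X]big1 ?addr0.
    by rewrite wedge_ebase eqxx mul1r.
  by move=> K KJ; rewrite wedge_ebase (negPf KJ) mul0r.
under eq_bigr => J _ do rewrite mulr_sumr.
rewrite exchange_big /=; apply: eq_bigr => I _.
rewrite derivation_expand mulr_suml; apply: eq_bigr => J _.
by rewrite mulrA.
Qed.

(** By Cartan's formula the coefficients are polynomials in the partial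
    derivatives of order at most one of [V] and of the coefficients of [w]. *)
Lemma Bform_lie_deriv k (w : kform U k) :
  (forall m, exists2 L : R, 0 <= L & forall i, deriv_bounded m L U (fun p => V p 0 i)) ->
  Bform w -> Bform (lie_deriv V w).
Proof.
move=> HV bw; apply: deriv_bounded_Bform => m.
have [M M0 HM] := Bform_deriv_bounded oU bw m.+1.
have [L L0 HL] := HV m.+1.
have HM' J := deriv_bounded_leq (leqnSn m) (lexx M) (@subset_refl _ U) (HM J).
have HL' i := deriv_bounded_leq (leqnSn m) (lexx L) (@subset_refl _ U) (HL i).
have dw x K : U x -> differentiable (coef w K) x.
  by move=> Ux; have [_ [+ _]] := HM K; apply.
have dV x c : U x -> differentiable (fun y => V y 0 c) x.
  by move=> Ux; have [_ [+ _]] := HL c; apply.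
pose kap (J I : multi_index n k) (a b : 'I_k) : R :=
  (-1) ^+ (a + b) * colminor (ebase R J \o lift a) (val I \o lift b).
pose C1 := \sum_(l < n) 2 ^+ m * L * M.
pose C2 J := \sum_I 2 ^+ m * (\sum_a \sum_b 2 ^+ m * L * `|kap J I a b|) * M.
have C10 : 0 <= C1 by apply: sumr_ge0 => l _; rewrite !mulr_ge0 ?exprn_ge0.
have C3 J I : 0 <= \sum_a \sum_b 2 ^+ m * L * `|kap J I a b|.
  by apply: sumr_ge0 => a _; apply: sumr_ge0 => b _; rewrite !mulr_ge0 ?exprn_ge0.
have C20 J : 0 <= C2 J.
  by apply: sumr_ge0 => I _; rewrite !mulr_ge0 ?exprn_ge0.
exists (C1 + \sum_J C2 J) => [|J]; first by rewrite addr_ge0 // sumr_ge0.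
apply: (@deriv_bounded_leq _ _ m m _ (C1 + C2 J) U U) => //.
  by rewrite lerD2l (bigD1 J) //= lerDl sumr_ge0.
pose f (q : E) : R := (\sum_l V q 0 l * 'D_(vbase R l) (coef w J) q)
  + \sum_(I : multi_index n k)
    (\sum_(a < k) \sum_(b < k) 'D_(vbase R (val J a)) (fun x => V x 0 (val I b)) q
       * kap J I a b) * coef w I q.
apply: (@deriv_bounded_eq R n m (C1 + C2 J) U f (coef (lie_deriv V w) J) oU).
  move=> q Uq; rewrite coef_lie_deriv //; last by move=> c; exact: dV.
  rewrite /flow_rate; congr (_ + _).
    rewrite (bigD1 J) //= [X in _ + X]big1 ?addr0; first by rewrite wedge_ebase eqxx mul1r.
    by move=> K KJ; rewrite wedge_ebase (negPf KJ) mul0r.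
  apply: eq_bigr => I _; congr (_ * _); apply: eq_bigr => a _.
  rewrite wedge_set_slot; apply: eq_bigr => b _; congr (_ * _).
  by rewrite jacobian_ebase.
apply: deriv_bounded_add => //.
  apply: deriv_bounded_sum => // l; apply: (deriv_bounded_mul (f := fun q => V q 0 l)) => //.
  by have [_ [_ +]] := HM J; apply.
apply: deriv_bounded_sum => // I; apply: deriv_bounded_mul => //.
apply: deriv_bounded_sum => // a; apply: deriv_bounded_sum => // b.
apply: (deriv_bounded_mul (f := 'D_(vbase R (val J a)) (fun x => V x 0 (val I b)))) => //.
  by have [_ [_ +]] := HL (val I b); apply.
exact: deriv_bounded_cst.
Qed.

End Cartan.

(** * Pullback of forms by the flow *)

Section Pullback.
Variables (R : realType) (n : nat).
Local Notation E := 'rV[R]_n.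
Variables (U N : set E) (V : E -> E) (T : R) (phi : R -> E -> E) (g : E -> R).
Hypotheses (oU : open U) (oN : open N) (T0 : 0 < T).
Hypothesis V_deriv_bounded :
  forall m, exists2 L : R, 0 <= L & forall i, deriv_bounded m L U (fun p => V p 0 i).
Hypothesis flow : is_flow U V N T phi.
Hypothesis g_deriv_bounded : forall m, exists2 L : R, 0 <= L & deriv_bounded m L [set: E] g.
Hypothesis g_compact : compact (closure [set p | g p != 0]).
Hypothesis g_supp : closure [set p | g p != 0] `<=` N.

(** The coefficients of [cut_pullback g (phi s) w], also outside [U]. *)
Definition pullback_coef k (s : R) (w : kform U k) (J : multi_index n k) (p : E) : R :=
  g p * w (dpoint U (phi s p) (wedge (fun i => 'd (phi s) p (vbase R (val J i))))).

Lemma pullback_coef_out k s (w : kform U k) J p :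
  ~ closure [set p | g p != 0] p -> pullback_coef s w J p = 0.
Proof.
move=> Kp; rewrite /pullback_coef (_ : g p = 0) ?mul0r //.
by apply/eqP; apply: contra_notT Kp => gp; exact: subset_closure.
Qed.

Lemma diff_phi s p v c : N p -> 0 <= s < T ->
  ('d (phi s) p v) 0 c = 'D_v (fun q => phi s q 0 c) p.
Proof.
move=> Np sT; have dphi : differentiable (phi s) p.
  apply: differentiable_coords => i.
  exact: (flow_differentiable oU oN T0 V_deriv_bounded flow).
by rewrite -deriveE // derive_coord //; exact: diff_derivable.
Qed.

Lemma pullback_coefE k s (w : kform U k) J p : N p -> 0 <= s < T ->
  pullback_coef s w J p = g p * \sum_(I : multi_index n k)
    \det (\matrix_(i, j) 'D_(vbase R (val J i)) (fun q => phi s q 0 (val I j)) p)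
      * coef w I (phi s p).
Proof.
move=> Np sT; rewrite /pullback_coef form_dpoint; last exact: (flow_in flow).
congr (_ * _); apply: eq_bigr => I _; congr (_ * _).
rewrite wedgeE; congr (\det _); apply/matrixP => i j.
by rewrite !mxE diff_phi.
Qed.

(** Near the support of [g] the bounds come from the regularity of the flow, and
    they are uniform by compactness; elsewhere the coefficients vanish. *)
Lemma pullback_coef_deriv_bounded k (b : R) m : 0 <= b < T -> exists2 C : R, 0 <= C &
  forall (w : kform U k) L s J, 0 <= L -> (forall I, deriv_bounded m L U (coef w I)) ->
    0 <= s <= b -> deriv_bounded m (C * L) [set: E] (pullback_coef s w J).
Proof.
move=> bT; pose K := closure [set p | g p != 0].
pose P x (C : R) := forall (w : kform U k) L s J, 0 <= L ->
    (forall I, deriv_bounded m L U (coef w I)) -> 0 <= s <= b ->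
    deriv_bounded m (C * L) [set x] (pullback_coef s w J).
have [C C0 HC] : exists2 C, 0 <= C & forall x, K x -> P x C.
  apply: compact_uniform => // [x Kx|x C C' CC H w L s J L0 HL sb]; last first.
    apply: deriv_bounded_leq (leqnn m) _ (@subset_refl _ _) (H w L s J L0 HL sb).
    by rewrite ler_wpM2r.
  have Nx := g_supp Kx.
  have [r [r0 rN] [Cp Cp0 HCp]] := flow_deriv_bounded oU oN T0 V_deriv_bounded flow m.+1 Nx bT.
  have oB : open (ball x r : set E) by exact: ball_open.
  have [Cd Cd0 HCd] := @deriv_bounded_det R n k m Cp Cp0.
  have [C1 C10 HC1] := @deriv_bounded_comp R n m Cp Cp0.
  have [Lg Lg0 HLg] := g_deriv_bounded m.
  pose C := 2 ^+ m * Lg * \sum_(I : multi_index n k) 2 ^+ m * Cd * C1.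
  exists C; have xB : nbhs x (ball x r) by exact: nbhsx_ballx.
  apply: filterS xB => y By w L s J L0 HL sb.
  have sT : 0 <= s < T.
    by case/andP: sb => -> /= sb; apply: le_lt_trans sb _; case/andP: bT.
  apply: (@deriv_bounded_leq _ _ m m _ (C * L) _ (ball x r)) => //; first by move=> z ->.
  have -> : C * L = 2 ^+ m * Lg * \sum_(I : multi_index n k) 2 ^+ m * Cd * (C1 * L).
    rewrite /C -!mulrA; congr (_ * (_ * _)); rewrite mulr_suml.
    by apply: eq_bigr => I _; ring.
  apply: (@deriv_bounded_eq _ _ _ _ _ (fun p => g p * \sum_(I : multi_index n k)
    \det (\matrix_(i, j) 'D_(vbase R (val J i)) (fun q => phi s q 0 (val I j)) p)
      * coef w I (phi s p))) => //.
    by move=> p Bp; rewrite pullback_coefE //; exact: rN.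
  apply: deriv_bounded_mul => //.
  - by apply: sumr_ge0 => I _; rewrite !mulr_ge0 ?exprn_ge0.
  - exact: deriv_bounded_leq HLg.
  apply: deriv_bounded_sum => // I.
  apply: (deriv_bounded_mul (f := fun p => \det (\matrix_(i, j)
      'D_(vbase R (val J i)) (fun q => phi s q 0 (val I j)) p))) => //.
  - by rewrite mulr_ge0.
  - apply: (HCd (ball x r) (fun i j p =>
      'D_(vbase R (val J i)) (fun q => phi s q 0 (val I j)) p)) => // i j.
    by have [_ [_ +]] := HCp s (val I j) sb; apply.
  - apply: (HC1 U (ball x r) (coef w I) (phi s)) => //.
      by move=> p Bp; apply: (flow_in flow) => //; exact: rN.
    by move=> i; apply: deriv_bounded_leq (HCp s i sb).
exists C => // w L s J L0 HL sb; apply: deriv_bounded_local => x _; have [Kx|Kx] :=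
  pselect (K x).
  by exists [set x] => //; exact: HC.
exists (~` K) => //.
have oK : open (~` K) by apply: closed_openC; exact: closed_closure.
apply: (@deriv_bounded_eq _ _ _ _ _ (fun=> 0)) => // [p Kp|]; first by rewrite
  pullback_coef_out.
apply: deriv_bounded_leq (leqnn m) _ (@subset_refl _ _) (deriv_bounded_cst m 0 (~` K)).
by rewrite normr0 mulr_ge0.
Qed.

(** The minors of the differential of [phi s] evolve by the equation of first
    variation and the coefficients of [w] by the chain rule along trajectories;
    [lie_deriv_wedge] recognizes the sum of the two contributions. *)
Lemma pullback_coef_time_derivative k (w : kform U k) J p : Bform w ->
  time_derivative T (fun s => pullback_coef s w J p) (fun s => pullback_coef s
    (lie_deriv V w) J p).
Proof.
move=> bw; have [Kp|Kp] := pselect (closure [set p | g p != 0] p); last first.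
  have E0 k' (w' : kform U k') J' : (fun s => pullback_coef s w' J' p) = (fun=> 0).
    by apply/funext => s; rewrite pullback_coef_out.
  by rewrite !E0; exact: time_derivative_cst.
have Np := g_supp Kp.
have [M M0 HM] := Bform_deriv_bounded oU bw 1.
have [LV LV0 HLV] := V_deriv_bounded 1.
have dw x I : U x -> differentiable (coef w I) x.
  by move=> Ux; have [_ [+ _]] := HM I; apply.
have dV x c : U x -> differentiable (fun y => V y 0 c) x.
  by move=> Ux; have [_ [+ _]] := HLV c; apply.
apply: (@time_derivative_eql _ _ (fun s => g p * \sum_(I : multi_index n k)
    \det (\matrix_(i, j) 'D_(vbase R (val J i)) (fun q => phi s q 0 (val I j)) p)
      * coef w I (phi s p))) => //.
  by move=> s sT; rewrite pullback_coefE.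
have H (I : multi_index n k) := time_derivative_mul
  (time_derivative_det (fun i j => flow_variation oU oN T0 V_deriv_bounded flow (val I
    j) (val J i) Np))
  (flow_time_derivative_comp T0 flow (fun x => dw x I) Np).
apply: time_derivative_eqr (time_derivative_scale (g p) (time_derivative_sum
  (index_enum (multi_index n k)) H)) => s sT.
have sT' : 0 <= s < T by case/andP: sT => /ltW -> ->.
have Uq : U (phi s p) by exact: (flow_in flow).
rewrite /pullback_coef; congr (_ * _); rewrite lie_deriv_wedge //; last by move=> c; exact: dV.
rewrite /flow_rate addrC big_split /=; congr (_ + _); apply: eq_bigr => I _; last first.
  congr (_ * _); rewrite wedgeE; congr (\det _); apply/matrixP => i j.
  by rewrite !mxE diff_phi.
congr (_ * _); apply: eq_bigr => a _.
rewrite wedgeE; congr (\det _); apply/matrixP => i j.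
rewrite !mxE /set_slot; case: eqP => [->|_]; last by rewrite diff_phi.
by rewrite mxE; apply: eq_bigr => l _; rewrite mxE diff_phi // mulrC.
Qed.

Lemma form_eval_seq k (c : E -> multi_index n k -> R) (A : Defs.dirac k U) :
  form_of U c A = \sum_(p <- finmap.enum_fset (fset_set (chain_support A))) \sum_J c p
    J * A p J.
Proof. by apply: fsbig_finite; have /asboolP[] := valP A. Qed.

Lemma cut_pullback_time_derivative k (w : kform U k) (A : Defs.dirac k U) : Bform w ->
  time_derivative T (fun s => cut_pullback g (phi s) w A)
    (fun s => cut_pullback g (phi s) (lie_deriv V w) A).
Proof.
move=> bw.
have H p : time_derivative T (fun s => \sum_J pullback_coef s w J p * A p J)
    (fun s => \sum_J pullback_coef s (lie_deriv V w) J p * A p J).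
  apply: time_derivative_sum => J; have := time_derivative_scale (A p J)
    (pullback_coef_time_derivative J p bw).
  have -> : (fun s => A p J * pullback_coef s w J p) = (fun s => pullback_coef s w J p * A p J).
    by apply/funext => s; rewrite mulrC.
  by apply: time_derivative_eqr => s _; rewrite mulrC.
have E (w' : kform U k) : (fun s => cut_pullback g (phi s) w' A) =
    (fun s => \sum_(p <- finmap.enum_fset (fset_set (chain_support A))) \sum_J
      pullback_coef s w' J p * A p J).
  by apply/funext => s; exact: form_eval_seq.
by rewrite !E; exact: time_derivative_sum.
Qed.

Lemma cut_pullback_bound k (b : R) m : 0 <= b < T -> exists2 C : R, 0 <= C &
  forall (w : kform U k) L s A, 0 <= L -> (forall I, deriv_bounded m L U (coef w I)) ->
    0 <= s <= b -> `|cut_pullback g (phi s) w A| <= C * L * bnorm m A.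
Proof.
move=> bT; have [C C0 HC] := pullback_coef_deriv_bounded k m bT.
exists (num_multi_index R n k * (n.+1%:R ^+ m * C)) => [|w L s A L0 HL sb].
  by rewrite !mulr_ge0 ?exprn_ge0 ?ler0n.
have H J : deriv_bounded m (C * L) U (coef (cut_pullback g (phi s) w) J).
  apply: (@deriv_bounded_eq _ _ _ _ _ (pullback_coef s w J)) => // [p Up|]; first by
    rewrite coef_form_of.
  exact: deriv_bounded_leq (HC w L s J L0 HL sb).
have CL0 : 0 <= C * L by rewrite mulr_ge0.
apply: le_trans (form_bounded_eval A (deriv_bounded_form CL0 H) _) _.
  by rewrite mulr_ge0 ?exprn_ge0.
by rewrite !mulrA.
Qed.

Lemma cut_pullback_lin k s (r : seq (R * kform U k)) (w : kform U k) A :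
  (forall B, w B = \sum_(c <- r) c.1 * c.2 B) ->
  cut_pullback g (phi s) w A = \sum_(c <- r) c.1 * cut_pullback g (phi s) c.2 A.
Proof.
move=> wE; under eq_bigr => c _ do rewrite form_eval_seq mulr_sumr.
rewrite form_eval_seq [RHS]exchange_big /=; apply: eq_bigr => p _.
under [RHS]eq_bigr => c _ do rewrite mulr_sumr.
rewrite [RHS]exchange_big /=; apply: eq_bigr => J _.
rewrite wE mulr_sumr mulr_suml; apply: eq_bigr => c _; ring.
Qed.

Section Evolution.
Variables (k : nat) (J0 : dchain k U).

(** The integral of [w] over the pushforward of [J0] by [phi s]. *)
Definition evolved_integral (s : R) (w : kform U k) : R :=
  dintegral J0 (cut_pullback g (phi s) w).

Let A : nat -> Defs.dirac k U := generic_quotient.repr J0 : cauchy_seq k U.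

Lemma approx_bounded : exists r, cauchy_bnorm r A /\
  exists2 B, 0 <= B & \forall i \near \oo, bnorm r (A i) <= B.
Proof.
have /asboolP[r Hr] := valP (generic_quotient.repr J0 : cauchy_seq k U).
exists r; split => //; have [i0 Hi0] := Hr 1 ltr01.
exists (1 + bnorm r (A i0)); first by rewrite addr_ge0 // bnorm_ge0.
exists i0 => // i /= i0i; rewrite -{1}[A i](subrK (A i0)).
apply: le_trans (bnormD_le _ _ _) _; rewrite lerD2r; apply: ltW.
exact: Hi0.
Qed.

(** The pullback is bounded for the norm in which the Dirac chains converge. *)
Lemma evolved_integral_cvg (w : kform U k) s : Bform w -> 0 <= s < T ->
  cut_pullback g (phi s) w (A i) @[i --> \oo] --> evolved_integral s w.
Proof.
move=> bw sT; have [r [Hr _]] := approx_bounded.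
have [C C0 HC] := cut_pullback_bound k r sT.
have [M M0 HM] := Bform_deriv_bounded oU bw r.
have ss : 0 <= s <= s by case/andP: sT => -> _; rewrite lexx.
suff : cvg (cut_pullback g (phi s) w (A i) @[i --> \oo]) by [].
apply: cauchy_cvg; apply: cauchy_exP => e e0.
have CM1 : 0 < C * M + 1 by rewrite ltr_wpDl // mulr_ge0.
have [i0 Hi0] := Hr _ (divr_gt0 e0 CM1).
exists (cut_pullback g (phi s) w (A i0)); exists i0 => // i /= i0i.
rewrite /ball /= -linearB; apply: le_lt_trans (HC w M s _ M0 HM ss) _.
have := Hi0 i0 i (leqnn _) i0i; rewrite ltr_pdivlMr // => h.
apply: le_lt_trans h; rewrite mulrC; apply: ler_wpM2l; first exact: bnorm_ge0.
by rewrite lerDl.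
Qed.

Lemma evolved_integral_bound (b : R) : 0 <= b < T -> exists m, exists2 C, 0 <= C &
  forall (w : kform U k) c s, Bform w -> 0 <= c ->
    (forall I, deriv_bounded m c U (coef w I)) -> 0 <= s <= b -> `|evolved_integral s
      w| <= C * c.
Proof.
move=> bT; have [r [Hr [B B0 HB]]] := approx_bounded.
have [C C0 HC] := cut_pullback_bound k r bT.
exists r, (C * B) => [|w c s bw c0 Hc sb]; first by rewrite mulr_ge0.
have sT : 0 <= s < T.
  by case/andP: sb => -> /= sb; apply: le_lt_trans sb _; case/andP: bT.
apply: (cvgr_to_le (cvg_norm (evolved_integral_cvg bw sT))).
apply: filterS HB => i Bi; apply: le_trans (HC w c s _ c0 Hc sb) _.
rewrite mulrAC; apply: ler_wpM2r => //; exact: ler_wpM2l.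
Qed.

(** The Dirac chains that converge to [J0] satisfy [time_derivative_taylor], with the
    second Lie derivative of [w] as second derivative in time; its uniform
    bound makes the estimate pass to the limit. *)
Lemma evolved_integral_taylor (b : R) (w : kform U k) : 0 <= b < T -> Bform w ->
  exists2 M, 0 <= M & forall s t, 0 <= s <= b -> 0 <= t <= b ->
    `|evolved_integral s w - evolved_integral t w - (s - t) * evolved_integral t
      (lie_deriv V w)| <= M * `|s - t| ^+ 2.
Proof.
move=> bT bw; have [r [Hr [B B0 HB]]] := approx_bounded.
have [C C0 HC] := cut_pullback_bound k r bT.
have bLw := Bform_lie_deriv oU V_deriv_bounded bw.
have bLLw := Bform_lie_deriv oU V_deriv_bounded bLw.
have [L L0 HL] := Bform_deriv_bounded oU bLLw r.
exists (C * L * B) => [|s t sb tb]; first by rewrite !mulr_ge0.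
have [b0 bT'] := andP bT.
have inT c : 0 <= c <= b -> 0 <= c < T.
  by case/andP => -> /= cb; apply: le_lt_trans bT'.
have cs := evolved_integral_cvg bw (inT s sb); have ct := evolved_integral_cvg bw (inT t tb).
have cl : (s - t) * cut_pullback g (phi t) (lie_deriv V w) (A i) @[i --> \oo]
    --> (s - t) * evolved_integral t (lie_deriv V w) by apply: cvgMr; exact:
      evolved_integral_cvg (inT t tb).
apply: (cvgr_to_le (cvg_norm (cvgB (cvgB cs ct) cl))).
apply: filterS HB => i Bi.
apply: (time_derivative_taylor (cut_pullback_time_derivative (A i) bw)
  (cut_pullback_time_derivative (A i) bLw) bT') => // c cb.
apply: le_trans (HC _ L c _ L0 HL cb) _; apply: ler_wpM2l => //; exact: mulr_ge0.
Qed.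

Lemma evolved_integral_lipschitz (b : R) (w : kform U k) : 0 <= b < T -> Bform w ->
  exists2 M, 0 <= M & forall s t, 0 <= s <= b -> 0 <= t <= b ->
    `|evolved_integral s w - evolved_integral t w| <= M * `|s - t|.
Proof.
move=> bT bw; have [r [Hr [B B0 HB]]] := approx_bounded.
have [C C0 HC] := cut_pullback_bound k r bT.
have bLw := Bform_lie_deriv oU V_deriv_bounded bw.
have [L L0 HL] := Bform_deriv_bounded oU bLw r.
exists (C * L * B) => [|s t sb tb]; first by rewrite !mulr_ge0.
have [b0 bT'] := andP bT.
have inT c : 0 <= c <= b -> 0 <= c < T.
  by case/andP => -> /= cb; apply: le_lt_trans bT'.
apply: (cvgr_to_le (cvg_norm (cvgB (evolved_integral_cvg bw (inT s sb))
  (evolved_integral_cvg bw (inT t tb))))).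
apply: filterS HB => i Bi.
apply: (time_derivative_lipschitz (cut_pullback_time_derivative (A i) bw) bT') => // c cb.
apply: le_trans (HC _ L c _ L0 HL cb) _; apply: ler_wpM2l => //; exact: mulr_ge0.
Qed.

Lemma evolved_integral_lin s (r : seq (R * kform U k)) (w : kform U k) : 0 <= s < T ->
  Bform w -> (forall c, c \in r -> Bform c.2) ->
  (forall B, w B = \sum_(c <- r) c.1 * c.2 B) ->
  evolved_integral s w = \sum_(c <- r) c.1 * evolved_integral s c.2.
Proof.
move=> sT bw br wE.
have c : cut_pullback g (phi s) w (A i) @[i --> \oo] --> \sum_(c <- r) c.1 *
  evolved_integral s c.2.
  rewrite (_ : (fun i => _) = (fun i =>
      \sum_(c <- r) c.1 * cut_pullback g (phi s) c.2 (A i))); last first.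
    by apply/funext => i; exact: cut_pullback_lin.
  elim: r br {wE} => [|c r IH] br.
    rewrite big_nil (_ : (fun i => _) = (fun=> 0)); first exact: cvg_cst.
    by apply/funext => i; rewrite big_nil.
  rewrite big_cons (_ : (fun i => _) = (fun i => c.1 * cut_pullback g (phi s) c.2 (A i)
    + \sum_(c <- r) c.1 * cut_pullback g (phi s) c.2 (A i))); last first.
    by apply/funext => i; rewrite big_cons.
  apply: cvgD; last by apply: IH => c' c'r; apply: br; rewrite inE c'r orbT.
  by apply: cvgMr; apply: evolved_integral_cvg => //; apply: br; exact: mem_head.
rewrite -[LHS](cvg_lim (@Rhausdorff R) (evolved_integral_cvg bw sT)).
exact: (cvg_lim (@Rhausdorff R) c).
Qed.

End Evolution.
End Pullback.

(** * Differentiating the integral *)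

Section LinearCombinations.
Variables (R : realType) (n k : nat) (U : set 'rV[R]_n).

Lemma Bform_lin (r : seq (R * kform U k)) (w : kform U k) : open U ->
  (forall c, c \in r -> Bform c.2) ->
  (forall B, w B = \sum_(c <- r) c.1 * c.2 B) -> Bform w.
Proof.
move=> oU br wE; apply: deriv_bounded_Bform => m.
have [M M0 HM] : exists2 M : R, 0 <= M & forall J,
    deriv_bounded m M U (fun p => \sum_(c <- r) c.1 * coef c.2 J p).
  elim: r br {wE} => [|c r IH] br.
    exists 0 => // J; have := deriv_bounded_cst m 0 U; rewrite normr0.
    by apply: deriv_bounded_eq => // p _; rewrite big_nil.
  have [|M M0 HM] := IH; first by move=> c' c'r; apply: br; rewrite inE c'r orbT.
  have [Mc Mc0 HMc] := Bform_deriv_bounded oU (br c (mem_head _ _)) m.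
  exists (2 ^+ m * `|c.1| * Mc + M) => [|J].
    by rewrite addr_ge0 // !mulr_ge0 ?exprn_ge0.
  apply: deriv_bounded_eq (deriv_bounded_add oU (deriv_bounded_mul oU _ Mc0
    (deriv_bounded_cst m c.1 U) (HMc J)) (HM J)) => //.
  by move=> p _; rewrite big_cons.
by exists M => // J; apply: deriv_bounded_eq (HM J) => // p _; rewrite [RHS]wE.
Qed.

Lemma kform_quotient (w1 w2 w3 : kform U k) (a : R) : exists w : kform U k,
  forall B, w B = a * (w1 B - w2 B) - w3 B.
Proof.
pose f (B : Defs.dirac k U) : R := a * (w1 B - w2 B) - w3 B.
have lf : scalar f.
  move=> c B B'.
  have E (v : kform U k) : v (c *: B + B') = c * v B + v B' by rewrite linearP.
  by rewrite /f !E; ring.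
pose f1 := GRing.isLinear.Build R (Defs.dirac k U) R *%R f lf.
pose f2 : {scalar (Defs.dirac k U)} := HB.pack f f1.
by exists f2.
Qed.

End LinearCombinations.

Theorem corollary10p3p2 (R : realType) (n k : nat) (U : set 'rV[R]_n)
    (V : 'rV[R]_n -> 'rV[R]_n) (J0 : dchain k U)
    (t0 : R) (N : set 'rV[R]_n) (phi : R -> 'rV[R]_n -> 'rV[R]_n)
    (g : 'rV[R]_n -> R) (J : R -> dchain k U) (w dw : R -> kform U k) :
  open U -> bounded_smooth U V ->
  compact (dsupp J0) -> dsupp J0 `<=` U ->
  0 < t0 -> open N -> dsupp J0 `<=` N -> is_flow U V N t0 phi ->
  cutoff N (dsupp J0) g ->
  (forall t : R, 0 <= t < t0 -> is_pushforward g (phi t) J0 (J t)) ->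
  (forall t : R, 0 <= t < t0 -> Bform (w t)) ->
  (forall t : R, 0 <= t < t0 -> Bform (dw t) /\ form_has_time_deriv t0 w t (dw t)) ->
  forall t : R, 0 <= t < t0 ->
    has_time_deriv t0 (fun s => dintegral (J s) (w s) : R^o) t
      (dintegral (J t) (dw t \+ lie_deriv V (w t))).
Proof.
move=> oU bV _ _ T0 oN _ flow [sg cg gN _] push bw Hdw t tT.
have V_deriv_bounded := bounded_smooth_deriv_bounded oU bV.
have g_deriv_bounded := cutoff_deriv_bounded sg cg.
have [bdw wdw] := Hdw t tT.
have [t00 tT'] := andP tT.
pose b := (t + t0) / 2.
have tb : t < b by rewrite /b; lra.
have bT : 0 <= b < t0 by rewrite /b; apply/andP; split; lra.
have tb' : 0 <= t <= b by rewrite t00 ltW.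
have inT s : 0 <= s <= b -> 0 <= s < t0.
  by case/andP => -> /= sb; apply: le_lt_trans sb _; case/andP: bT.
have blw := Bform_lie_deriv oU V_deriv_bounded (bw t tT).
have bsum : Bform (dw t \+ lie_deriv V (w t)).
  apply: (Bform_lin (r := [:: (1, dw t); (1, lie_deriv V (w t))])) => //.
    by move=> c; rewrite !inE => /orP[]/eqP ->.
  by move=> B; rewrite !big_cons big_nil addr0 !mul1r.
pose F := @evolved_integral R n U phi g k J0.
have FE s (v : kform U k) : 0 <= s < t0 -> Bform v -> dintegral (J s) v = F s v.
  by move=> sT bv; apply: push.
have Flin := evolved_integral_lin oU oN T0 V_deriv_bounded flow g_deriv_bounded cg gN J0.
rewrite FE //.
have -> : F t (dw t \+ lie_deriv V (w t)) = F t (dw t) + F t (lie_deriv V (w t)).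
  rewrite /F (Flin _ [:: (1, dw t); (1, lie_deriv V (w t))]) //.
  - by rewrite !big_cons big_nil addr0 !mul1r.
  - by move=> c; rewrite !inE => /orP[]/eqP ->.
  - by move=> B; rewrite !big_cons big_nil addr0 !mul1r.
have [M1 M10 HM1] := evolved_integral_taylor oU oN T0 V_deriv_bounded flow
  g_deriv_bounded cg gN J0 bT (bw t tT).
have [M2 M20 HM2] := evolved_integral_lipschitz oU oN T0 V_deriv_bounded flow
  g_deriv_bounded cg gN J0 bT bdw.
have [m [C C0 HC]] := evolved_integral_bound oU oN T0 V_deriv_bounded flow
  g_deriv_bounded cg gN J0 bT.
apply/cvgrPdist_le => e e0.
have C1 : 0 < 3 * (C + 1) by rewrite mulr_gt0 // ltr_wpDl.
pose c := e / (3 * (C + 1)).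
have c0 : 0 < c by rewrite divr_gt0.
pose q0 (s : R) (A : Defs.dirac k U) : R := (s - t)^-1 * (w s A - w t A) - dw t A.
have small : \forall s \near within [set s | 0 <= s < t0] t^',
    (form_norm (q0 s) m.+1 < c%:E)%E.
  exact: (wdw m.+1 [set x | (x < c%:E)%E] (@nbhs_open_ereal_lt R 0 (fun=> c) c0)).
rewrite near_withinE in small; rewrite near_withinE.
have M0 : 0 < 3 * (M1 + M2 + 1) by rewrite mulr_gt0 // ltr_wpDl // addr_ge0.
near=> s => sT.
have [s0 sT'] := andP sT.
have st : s != t by near: s; exact: nbhs_dnbhs_neq.
have sb : 0 <= s <= b.
  by rewrite s0 /=; apply: ltW; near: s; apply: nbhs_dnbhs; exact: lt_nbhsl.
have st0 : s - t != 0 by rewrite subr_eq0.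
have sd : `|s - t| < e / (3 * (M1 + M2 + 1)).
  near: s; apply: nbhs_dnbhs; apply/nbhs_ballP.
  exists (e / (3 * (M1 + M2 + 1))) => /=; first by rewrite divr_gt0.
  by move=> s; rewrite -ball_normE /ball_ /= distrC.
have [q qE] := kform_quotient (w s) (w t) (dw t) (s - t)^-1.
have wsE B : w s B = \sum_(c <- [:: (1, w t); (s - t, q); (s - t, dw t)]) c.1 * c.2 B.
  rewrite !big_cons big_nil /= qE; by field.
have qlin B : q B = \sum_(c <- [:: ((s - t)^-1, w s); (- (s - t)^-1, w t);
    (-1, dw t)]) c.1 * c.2 B.
  by rewrite !big_cons big_nil /= qE; ring.
have bq : Bform q.
  apply: Bform_lin qlin => // c'; rewrite !inE => /or3P[]/eqP -> //=; exact: bw.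
have qc : `|F s q| <= C * c.
  apply: HC => //; first exact: ltW.
  move=> I; apply: form_bounded_deriv => //; first exact: ltW.
  apply: (form_norm_form_bounded (f := fun A => (s - t)^-1 * (w s A - w t A) - dw t A)) => //.
  by apply: ltW; move: sT; near: s; exact: small.
have Fs : F s (w s) = F s (w t) + (s - t) * F s q + (s - t) * F s (dw t).
  rewrite /F (Flin _ [:: (1, w t); (s - t, q); (s - t, dw t)]) //.
  - by rewrite !big_cons big_nil /= addr0 mul1r addrA.
  - exact: bw.
  - by move=> c'; rewrite !inE => /or3P[]/eqP -> //=; exact: bw.
rewrite !FE //; try exact: bw.
rewrite distrC [_ *: _]/(_ * _) Fs.
have split3 (x a1 a2 a3 a4 a5 a6 : R) : x != 0 ->
    x^-1 * (a1 + x * a2 + x * a3 - a4) - (a5 + a6)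
    = a2 + (a3 - a5) + (a1 - a4 - x * a6) / x by move=> x0; field.
rewrite split3 //.
have h1 := HM1 s t sb tb'; have h2 := HM2 s t sb tb'.
rewrite -/F in h1 h2.
have ns : 0 < `|s - t| by rewrite normr_gt0.
have h3 : `|(F s (w t) - F t (w t) - (s - t) * F t (lie_deriv V (w t))) / (s - t)|
    <= M1 * `|s - t|.
  by rewrite normrM normfV ler_pdivrMr // -mulrA -expr2.
apply: le_trans (ler_normD _ _) _.
apply: le_trans (lerD (ler_normD _ _) h3) _.
apply: le_trans (lerD (lerD qc h2) (lexx _)) _.
have h4 : C * c <= e / 3.
  have -> : e / 3 = (C + 1) * c by rewrite /c; field; rewrite gt_eqF // ltr_wpDl.
  by rewrite ler_wpM2r ?(ltW c0) // lerDl.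
have h5 : (M1 + M2) * `|s - t| <= e / 3.
  have h : `|s - t| * (3 * (M1 + M2 + 1)) < e by rewrite -ltr_pdivlMr.
  rewrite ler_pdivlMr //; nra.
apply: (@le_trans _ _ (e / 3 + e / 3)); last by lra.
by rewrite -addrA; apply: lerD => //; rewrite addrC -mulrDl.
Unshelve. all: by end_near. Qed.
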